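(* Let $0<\gamma<n$ and let $X$ be a rearrangement-invariant (r.i.) space over $\mathbb{R}^n$. Assume that $$T_{\frac{\gamma}{n}}\colon X(0,\infty)\to X(0,\infty).$$ Define the functional $\tau$ by $$\tau(f)=\sup_{\|h\|_{X(0,\infty)}\le1}\int_0^\infty f^*(s)\,(PT_{\frac{\gamma}{n}}h)(s)\,s^{\frac{\gamma}{n}}\,ds,\qquad f\in\mathcal{M}_+(\mathbb{R}^n).$$ Then $\tau$ is an r.i. norm such that $M_\gamma\colon X\to Y$, where $M_\gamma$ is the fractional maximal operator and $Y=Y(\tau')$ is the r.i. space determined by the associate norm $\tau'$ of $\tau$, and $Y$ is the optimal (smallest) r.i. space over $\mathbb{R}^n$ for which $M_\gamma\colon X\to Y$ holds, i.e. $Y\hookrightarrow Z$ for every r.i. space $Z$ over $\mathbb{R}^n$ such that $M_\gamma\colon X\to Z$. Moreover, $\tau$ is equivalent (up to multiplicative positive constants independent of $f$) to the functional $$f\mapsto\left\|\int_t^\infty f^*(s)s^{\frac{\gamma}{n}-1}\,ds\right\|_{X'(0,\infty)},\qquad f\in\mathcal{M}_+(\mathbb{R}^n).$$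
   Context: Let $R$ be $\mathbb{R}^n$ or $(0,\infty)$ with Lebesgue measure $\mu$ (also written $|\cdot|$). $\mathcal{M}(R)$ is the set of measurable functions on $R$ with values in $[-\infty,\infty]$ and $\mathcal{M}_+(R)$ the set of nonnegative ones. For $f\in\mathcal{M}(R)$, $f^*(t)=\inf\{\lambda\in(0,\infty):\mu(\{|f|>\lambda\})\le t\}$. An r.i. norm on $R$ is a functional $\varrho\colon\mathcal{M}_+(R)\to[0,\infty]$ such that for all $f,g,f_j\in\mathcal{M}_+(R)$ and $\lambda\ge0$: (P1) $\varrho(f)=0$ iff $f=0$ a.e., $\varrho(\lambda f)=\lambda\varrho(f)$, $\varrho(f+g)\le\varrho(f)+\varrho(g)$; (P2) $f\le g$ a.e. implies $\varrho(f)\le\varrho(g)$; (P3) $f_j\nearrow f$ a.e. implies $\varrho(f_j)\nearrow\varrho(f)$; (P4) $\varrho(\chi_E)<\infty$ whenever $\mu(E)<\infty$; (P5) if $\mu(E)<\infty$, then $\int_Ef\,d\mu\le C_E\varrho(f)$ with a constant $C_E$ independent of $f$; (P6) $\varrho(f)=\varrho(g)$ whenever $f^*=g^*$. The r.i. space determined by $\varrho$ is $X(\varrho)=\{f\in\mathcal{M}(R):\varrho(|f|)<\infty\}$, with $\|f\|_{X(\varrho)}=\varrho(|f|)$. The associate norm of $\varrho$ is $\varrho'(g)=\sup\{\int_Rfg\,d\mu: f\in\mathcal{M}_+(R),\ \varrho(f)\le1\}$, which is again an r.i. norm; for $X=X(\varrho)$ the associate space is $X'=X(\varrho')$, and $X''=X$.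 For an r.i. space $X$ over $\mathbb{R}^n$, $X(0,\infty)$ denotes its representation space, the unique r.i. space over $(0,\infty)$ with $\|f\|_X=\|f^*\|_{X(0,\infty)}$ for all $f$; $X'(0,\infty)$ is the representation space of $X'$. $T\colon X\to Y$ means there is $C>0$ with $\|Tf\|_Y\le C\|f\|_X$ for all $f\in X$; $X\hookrightarrow Y$ means this for the identity operator. For $\alpha\ge0$ the supremum operator is $T_\alpha f(t)=t^{-\alpha}\sup_{t\le s<\infty}s^\alpha f^*(s)$, $t\in(0,\infty)$, $f\in\mathcal{M}(0,\infty)$. Also $(Pf)(t)=\frac1t\int_0^tf(s)\,ds$, $t\in(0,\infty)$. The fractional maximal operator is $M_\gamma f(x)=\sup_{Q\ni x}\frac{1}{|Q|^{1-\gamma/n}}\int_Q|f(y)|\,dy$, $x\in\mathbb{R}^n$, for locally integrable $f$ on $\mathbb{R}^n$, the supremum being over all cubes $Q\subset\mathbb{R}^n$ containing $x$ with edges parallel to the coordinate axes. *)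

(* Defs.v *)
From HB Require Import structures.
From mathcomp Require Import all_boot all_order all_algebra.
From mathcomp Require Import all_classical all_reals all_analysis.
From mathcomp Require Import measurable_realfun.

Set Implicit Arguments.
Unset Strict Implicit.
Unset Printing Implicit Defensive.
Import Order.TTheory GRing.Theory Num.Theory.
Import numFieldNormedType.Exports.

Local Open Scope classical_set_scope.
Local Open Scope ring_scope.
Local Open Scope ereal_scope.

Definition box (R : realType) (n : nat) (a b : 'rV[R]_n) : set 'rV[R]_n :=
  [set x | forall i, (a ord0 i <= x ord0 i <= b ord0 i)%R].

(* A countable, possibly finite, family of boxes.  Allowing the index set to be
   empty is what makes the outer measure of set0 vanish when n = 0. *)
Record box_family (R : realType) (n : nat) := BoxFamily {
  bf_index : set nat ;
  bf_low : nat -> 'rV[R]_n ;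
  bf_high : nat -> 'rV[R]_n ;
  bf_le : forall k, bf_index k ->
    forall i, (bf_low k ord0 i <= bf_high k ord0 i)%R }.

Section lebesgue_outer_measure.
Context (R : realType) (n : nat).
Implicit Types (A : set 'rV[R]_n) (F : box_family R n).

Definition bf_cover F : set 'rV[R]_n :=
  \bigcup_(k in bf_index F) box (bf_low F k) (bf_high F k).

Definition bf_volume F : \bar R :=
  \esum_(k in bf_index F)
    (\prod_(i < n) (bf_high F k ord0 i - bf_low F k ord0 i))%R%:E.

Definition lebesgue_outer A : \bar R :=
  ereal_inf [set bf_volume F | F in [set F | A `<=` bf_cover F]].

Let volume_ge0 F k : bf_index F k ->
  0 <= (\prod_(i < n) (bf_high F k ord0 i - bf_low F k ord0 i))%R%:E.
Proof.
move=> Fk; rewrite lee_fin; apply: prodr_ge0 => i _.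
by rewrite subr_ge0 bf_le.
Qed.

Let bf_volume_ge0 F : 0 <= bf_volume F.
Proof. by apply: esum_ge0 => k /volume_ge0. Qed.

Let lebesgue_outer_ge0 A : 0 <= lebesgue_outer A.
Proof. by apply: le_ereal_inf_tmp => _ [F _ <-]. Qed.

Let lebesgue_outer0 : lebesgue_outer set0 = 0.
Proof.
apply/eqP; rewrite eq_le lebesgue_outer_ge0 andbT.
pose z (k : nat) : 'rV[R]_n := 0%R.
have z_le k : set0 k -> forall i, (z k ord0 i <= z k ord0 i)%R by [].
apply: ereal_inf_lbound; exists (BoxFamily z_le) => //.
by rewrite /bf_volume esum_set0.
Qed.

Let le_lebesgue_outer : {homo lebesgue_outer : A B / A `<=` B >-> A <= B}.
Proof.
move=> A B AB; apply: ereal_inf_le_tmp => _ [F BF <-].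
by exists F => //=; exact: subset_trans BF.
Qed.

Let lebesgue_outer_sigma_subadditive : sigma_subadditive lebesgue_outer.
Proof.
move=> A; have [[i ioo]|] := pselect (exists i, lebesgue_outer (A i) = +oo).
  rewrite (eseries_pinfty _ _ ioo) ?leey// => k _.
  by rewrite -ltNye (lt_le_trans _ (lebesgue_outer_ge0 _)).
rewrite -forallNE => Aoo.
apply/lee_addgt0Pr => e e0.
apply: (le_trans _ (epsilon_trick xpredT _ (ltW e0))) => [|i]; last first.
  exact: lebesgue_outer_ge0.
pose P i F := A i `<=` bf_cover F /\
  bf_volume F <= lebesgue_outer (A i) + (e / (2 ^ i.+1)%:R)%:E.
have [G PG] : {G : nat -> box_family R n & forall i, P i (G i)}.
  apply: (@choice _ _ P) => i.
  have Afin : lebesgue_outer (A i) \is a fin_num.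
    by rewrite ge0_fin_numE// ltey; apply/eqP; exact: Aoo.
  have en1 : (0 < e / (2 ^ i.+1)%:R)%R by rewrite divr_gt0// ltr0n expn_gt0.
  have [_ [F AF <-] /ltW le] := lb_ereal_inf_adherent en1 Afin.
  by exists F.
have /card_esym/ppcard_eqP[f] := card_nat2.
have HF k : [set k | bf_index (G (f k).1) (f k).2] k -> forall i,
    (bf_low (G (f k).1) (f k).2 ord0 i <= bf_high (G (f k).1) (f k).2 ord0 i)%R.
  by move=> /= Gk i; exact: bf_le.
pose F := @BoxFamily R n _ (fun k => bf_low (G (f k).1) (f k).2)
  (fun k => bf_high (G (f k).1) (f k).2) HF.
apply: (@le_trans _ _ (bf_volume F)).
  apply: ereal_inf_lbound; exists F => //= x [i _ /(PG i).1 [j Gj xj]].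
  by exists (f^-1%FUN (i, j)); rewrite /= invK ?inE.
apply: (@le_trans _ _ (\sum_(i <oo) bf_volume (G i))); last first.
  by apply: lee_nneseries => i _ //; case: (PG i).
rewrite nneseries_esumT// /bf_volume esum_esum; last first.
  by move=> i j _; exact: volume_ge0.
rewrite (reindex_esum (bf_index F) _ f)//; split.
- by move=> k /= Fk; split.
- by move=> i j _ _ fij; apply: ('inj_f _ _ fij); rewrite inE.
- by move=> [i j] /= [_ Gij]; exists (f^-1%FUN (i, j)); rewrite /= invK ?inE.
Qed.

HB.instance Definition _ := isOuterMeasure.Build R 'rV[R]_n lebesgue_outer
  lebesgue_outer0 lebesgue_outer_ge0 le_lebesgue_outer
  lebesgue_outer_sigma_subadditive.

End lebesgue_outer_measure.

(* R^n and R with the sigma-algebras of Lebesgue measurable sets, i.e., of the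
   sets that are Caratheodory measurable for the Lebesgue outer measure.  The
   types are convertible to 'rV[R]_n and R, but measurable_fun on R itself would
   refer to Borel sets. *)
Notation Rn R n := (caratheodory_type (@lebesgue_outer R n)).
Notation line R := (caratheodory_type (wlength (@idfun (Real.sort R)))^*%mu).

Definition lebesgue_Rn (R : realType) (n : nat) : set (Rn R n) -> \bar R :=
  @lebesgue_outer R n.
Arguments lebesgue_Rn : clear implicits.

HB.instance Definition _ (R : realType) (n : nat) :=
  isMeasure.Build _ _ _ (lebesgue_Rn R n)
    (@caratheodory_measure0 _ _ (@lebesgue_outer R n))
    (@caratheodory_measure_ge0 _ _ (@lebesgue_outer R n))
    (@caratheodory_measure_sigma_additive _ _ (@lebesgue_outer R n)).

Notation lebesgue_line R := (@completed_lebesgue_measure R).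

Definition halfline (R : realType) : set (line R) := (`]0%R, +oo[ : set R).
Arguments halfline : clear implicits.

(* In what follows the measure space is D with the restriction of mu.  A
   function on D is represented by a function on T, whose values outside of D
   are irrelevant. *)
Section ri_spaces.
Context (R : realType) (d : measure_display) (T : measurableType d).
Variables (mu : {measure set T -> \bar R}) (D : set T).
Implicit Types (f g : T -> \bar R) (rho : (T -> \bar R) -> \bar R).

Definition Mfun : set (T -> \bar R) := [set f : T -> \bar R | measurable_fun D f].

Definition Mplus : set (T -> \bar R) :=
  [set f | Mfun f /\ forall x, D x -> 0 <= f x].

(* f^*, to be considered for 0 < t only *)
Definition rearr f (t : R) : \bar R :=
  ereal_inf [set l%:E | l in
    [set l : R | (0 < l)%R /\ mu (D `&` [set x | l%:E < `|f x|]) <= t%:E]].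

(* A functional on Mplus; its values on other functions are irrelevant. *)
Record is_ri_norm rho : Prop := {
  ri_ge0 : forall f, Mplus f -> 0 <= rho f ;
  ri_eq0 : forall f, Mplus f ->
    (rho f = 0 <-> {ae mu, forall x, D x -> f x = 0}) ;
  ri_homogeneous : forall (l : R) f, (0 <= l)%R -> Mplus f ->
    rho (fun x => l%:E * f x) = l%:E * rho f ;
  ri_triangle : forall f g, Mplus f -> Mplus g ->
    rho (fun x => f x + g x) <= rho f + rho g ;
  ri_lattice : forall f g, Mplus f -> Mplus g ->
    {ae mu, forall x, D x -> f x <= g x} -> rho f <= rho g ;
  ri_fatou : forall (fj : nat -> T -> \bar R) f,
    (forall j, Mplus (fj j)) -> Mplus f ->
    {ae mu, forall x, D x ->
      nondecreasing_seq (fun j => fj j x) /\ fj j x @[j --> \oo] --> f x} ->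
    nondecreasing_seq (fun j => rho (fj j)) /\
    rho (fj j) @[j --> \oo] --> rho f ;
  ri_finite : forall E : set T, measurable E -> E `<=` D -> mu E < +oo ->
    rho (fun x => (\1_E x)%:E) < +oo ;
  ri_integral : forall E : set T, measurable E -> E `<=` D -> mu E < +oo ->
    exists C : R, (0 < C)%R /\
      forall f, Mplus f -> \int[mu]_(x in E) f x <= C%:E * rho f ;
  ri_rearr : forall f g, Mplus f -> Mplus g ->
    (forall t, (0 < t)%R -> rearr f t = rearr g t) -> rho f = rho g }.

Definition ri_norm rho f : \bar R := rho (fun x => `|f x|).

Definition ri_space rho : set (T -> \bar R) :=
  [set f | Mfun f /\ ri_norm rho f < +oo].

Definition associate rho g : \bar R :=
  ereal_sup [set \int[mu]_(x in D) (f x * g x) | f in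
    [set f | Mplus f /\ rho f <= 1]].

(* op : X -> Y, for the spaces X and Y determined by rho and sigma.  This
   includes that op f belongs to Y. *)
Definition bounded_op (op : (T -> \bar R) -> T -> \bar R) rho sigma : Prop :=
  exists C : R, (0 < C)%R /\ forall f, ri_space rho f ->
    ri_space sigma (op f) /\ ri_norm sigma (op f) <= C%:E * ri_norm rho f.

Definition embedded rho sigma : Prop := bounded_op id rho sigma.

End ri_spaces.

Section fractional_maximal_operator.
Context (R : realType).
Implicit Types (n : nat) (gamma alpha : R).

Definition rearr_Rn n (f : Rn R n -> \bar R) : line R -> \bar R :=
  rearr (lebesgue_Rn R n) setT f.

Definition rearr_halfline (f : line R -> \bar R) : line R -> \bar R :=
  rearr (lebesgue_line R) (halfline R) f.

(* rhob determines the representation space X(0,oo) of the space X over R^n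
   determined by rho. *)
Definition is_representation n (rho : (Rn R n -> \bar R) -> \bar R)
    (rhob : (line R -> \bar R) -> \bar R) : Prop :=
  is_ri_norm (lebesgue_line R) (halfline R) rhob /\
  forall f, Mfun setT f -> ri_norm rho f = ri_norm rhob (rearr_Rn f).

Definition sup_op alpha (f : line R -> \bar R) (t : line R) : \bar R :=
  ((t : R) `^ (- alpha))%:E *
  ereal_sup [set (s `^ alpha)%:E * rearr_halfline f s |
             s in `[(t : R), +oo[].

Definition hardy_op (f : line R -> \bar R) (t : line R) : \bar R :=
  (t : R)^-1%:E *
  \int[lebesgue_line R]_(s in `]0%R, (t : R)[) f s.

Definition is_cube n (Q : set 'rV[R]_n) : Prop :=
  exists a (l : R), (0 < l)%R /\ Q = box a (a + const_mx l)%R.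

Definition frac_max n gamma (f : Rn R n -> \bar R) (x : Rn R n) : \bar R :=
  ereal_sup
    [set (fine (lebesgue_Rn R n Q) `^ (1 - gamma / n%:R))^-1%:E *
         \int[lebesgue_Rn R n]_(y in Q) `|f y| |
     Q in [set Q : set (Rn R n) | is_cube Q /\ Q x]].

Definition tau n gamma (rhob : (line R -> \bar R) -> \bar R)
    (f : Rn R n -> \bar R) : \bar R :=
  ereal_sup
    [set \int[lebesgue_line R]_(s in halfline R)
           (rearr_Rn f s * hardy_op (sup_op (gamma / n%:R) h) s *
            ((s : R) `^ (gamma / n%:R))%:E) |
     h in [set h | ri_space (halfline R) rhob h /\ ri_norm rhob h <= 1]].

Definition dual_hardy n gamma (f : Rn R n -> \bar R) (t : line R) : \bar R :=
  \int[lebesgue_line R]_(s in `](t : R), +oo[)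
    (rearr_Rn f s * ((s : R) `^ (gamma / n%:R - 1))%:E).

End fractional_maximal_operator.

(* Main.v *)
Require Import Defs.
From HB Require Import structures.
From mathcomp Require Import all_boot all_order all_algebra.
From mathcomp Require Import all_classical all_reals all_analysis.
From mathcomp Require Import measurable_realfun.
From mathcomp Require Import ring lra.
Import Order.TTheory GRing.Theory Num.Theory.
Import numFieldNormedType.Exports.
Local Open Scope classical_set_scope.
Local Open Scope ring_scope.
Local Open Scope ereal_scope.

Set Implicit Arguments.
Unset Strict Implicit.
Unset Printing Implicit Defensive.

(** Write al = gamma / n, f^* for the decreasing rearrangement and V (called
    [radial]) for the map x |-> (2 |x|)^n with |x| the sup-norm, so that {V < v}
    is a cube of volume v, up to a null set.  Composition with V turns a nonincreasing
    function on the half-line into an equimeasurable function on R^n.  Everything is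
    reduced to the kernels w_h(s) = s^al (P T_al h)(s) = s^(al-1) \int_0^s T_al h, for h in the
    unit ball of X(0,oo), against which tau integrates f^*.

    The kernels w_h are nonincreasing ([nonincreasing_weight]): substituting
    y = s x, w_h(s) is the integral over x < 1 of x^-al F(s x), where
    F(s) = sup_(r >= s) r^al h^*(r) is nonincreasing.  Hence f |-> \int f^* w_h is a
    Lorentz functional; it is the supremum of \int k f over all k with k^* <= w_h
    ([integral_rearr_le_sup], a sharp form of the Hardy-Littlewood inequality) and
    therefore subadditive.  A supremum of such functionals is an r.i. norm as soon
    as the weights have uniformly bounded integrals over every (0, a) and one of them
    is bounded below there ([lorentz_sup_ri_norm]).  The first property is where the
    boundedness of T_al enters; it gives w_h(s) <= const s^(al-1) on (0, a).

    Boundedness of M_gamma from X to Y(tau'): a Vitali covering by cubes gives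
    (M_gamma f)^* <= 3^n w_h with h = f^* ([rearr_frac_max_le]), and \int k^* w_h is at
    most tau(k) times the norm of f.

    Optimality: if M_gamma maps X to Z, apply it to (T_al h) o V.  Averaging over the
    cube {V <= V x} gives M_gamma((T_al h) o V) >= w_h o V ([frac_max_radial]), so the
    norms of the w_h o V in Z are bounded by a constant K and, by Hoelder's
    inequality, tau <= K zeta' where zeta is the norm of Z.  Taking associate norms
    once more, zeta'' <= K tau', and zeta = zeta'' by the Lorentz-Luxemburg theorem
    ([lorentz_luxemburg]).  The latter is proved by separating a bounded function
    from the unit ball of zeta through its projection in L^2.

    Equivalence with the dual Hardy operator: by Tonelli's theorem
    \int f^* w_h = \int (T_al h) (Hf), where Hf(t) = \int_t^oo f^*(s) s^(al-1) ds is
    nonincreasing.  As T_al h stays in a multiple of the unit ball, the supremum over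
    h is bounded by a multiple of the norm of Hf in X'(0,oo); it is at least that norm
    because k^* <= T_al k^* for every competitor k. *)

(** * Distribution functions and rearrangements *)

Lemma lee_fin_ubound (R : realType) (x y : \bar R) : 0 <= y ->
  (forall l : R, (0 <= l)%R -> y <= l%:E -> x <= l%:E) -> x <= y.
Proof.
move: y => [r| |] //; last by move=> _ _; rewrite leey.
by rewrite lee_fin => r0; apply.
Qed.

Section distribution.
Context (R : realType) (d : measure_display) (T : measurableType d).
Variables (mu : {measure set T -> \bar R}) (D : set T).
Hypothesis mD : measurable D.
Implicit Types f g : T -> \bar R.

Definition distrib f (l : R) : \bar R := mu (D `&` [set x | l%:E < `|f x|]).

Lemma measurable_superlevel f (l : R) : measurable_fun D f ->
  measurable (D `&` [set x | l%:E < `|f x|]).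
Proof.
move=> mf; apply: emeasurable_fun_o_infty => //; exact: measurableT_comp.
Qed.

Lemma le_distrib f (k l : R) : measurable_fun D f -> (k <= l)%R ->
  distrib f l <= distrib f k.
Proof.
move=> mf kl; apply: le_measure; rewrite ?inE; try exact: measurable_superlevel.
by move=> x [Dx /= lx]; split => //=; apply: le_lt_trans lx; rewrite lee_fin.
Qed.

(** Continuity from below of the measure along l + 1/(k+1). *)
Lemma distrib_right_continuous f (l : R) (c : \bar R) : measurable_fun D f ->
  (forall e, (0 < e)%R -> distrib f (l + e) <= c) -> distrib f l <= c.
Proof.
move=> mf Hc.
pose F k := D `&` [set x | (l + k.+1%:R^-1)%:E < `|f x|].
have UF : D `&` [set x | l%:E < `|f x|] = \bigcup_k F k.
  apply/seteqP; split=> [x [Dx /= lx]|x [k _ [Dx /= lx]]]; last first.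
    split => //=; apply: le_lt_trans lx.
    by rewrite lee_fin lerDl invr_ge0.
  case fx : (`|f x|) lx => [r| |] //= lx; last first.
    by exists 0%N => //; split => //=; rewrite fx ltry.
  rewrite lte_fin in lx.
  have r0 : (0 < r - l)%R by rewrite subr_gt0.
  have [k _ /(_ k (leqnn k))] := near_infty_natSinv_lt (PosNum r0).
  move=> /= kr; exists k => //; split => //=.
  by rewrite fx lte_fin addrC -ltrBrDr.
rewrite /distrib UF.
have /cvg_lim <- // : mu \o F @ \oo --> mu (\bigcup_n F n).
  apply: nondecreasing_cvg_mu.
  - by move=> k; exact: measurable_superlevel.
  - by apply: bigcupT_measurable => k; exact: measurable_superlevel.
  - move=> m n mn; apply/subsetPset => x [Dx /= mx]; split => //=.
    by apply: le_lt_trans mx; rewrite lee_fin lerD2l lef_pV2 ?posrE// ler_nat.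
apply: lime_le.
  apply: ereal_nondecreasing_is_cvgn => m n mn; apply: le_measure;
    rewrite ?inE; try exact: measurable_superlevel.
  move=> x [Dx /= mx]; split => //=.
  by apply: le_lt_trans mx; rewrite lee_fin lerD2l lef_pV2 ?posrE// ler_nat.
by apply: nearW => k; exact: Hc.
Qed.

(** The decreasing rearrangement is the generalized inverse of the distribution
    function; everything about f^* is read off from this equivalence. *)
Lemma rearr_leP f (t l : R) : measurable_fun D f -> (0 <= l)%R ->
  rearr mu D f t <= l%:E <-> distrib f l <= t%:E.
Proof.
move=> mf l0; split => [rl|dl].
  apply: distrib_right_continuous => // e e0.
  have /ereal_inf_lt [_ [k [k0 kt] <-] kle] : rearr mu D f t < (l + e)%:E.
    by apply: le_lt_trans rl _; rewrite lte_fin ltrDl.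
  apply: le_trans kt; apply: le_distrib => //.
  by rewrite lte_fin in kle; exact: ltW.
apply/lee_addgt0Pr => e e0; apply: ereal_inf_lbound.
exists (l + e)%R => //; split; first by rewrite ltr_wpDl.
by apply: le_trans dl; apply: le_distrib => //; rewrite lerDl ltW.
Qed.

Lemma rearr_gtP f (t l : R) : measurable_fun D f -> (0 <= l)%R ->
  l%:E < rearr mu D f t <-> t%:E < distrib f l.
Proof.
by move=> mf l0; split; rewrite !ltNge => /negP h; apply/negP => h';
  apply: h; apply/rearr_leP.
Qed.

Lemma rearr_ge0 f t : 0 <= rearr mu D f t.
Proof. by apply: le_ereal_inf_tmp => _ [l [l0 _] <-]; rewrite lee_fin ltW. Qed.

Lemma rearr_nonincreasing f (s t : R) : (s <= t)%R ->
  rearr mu D f t <= rearr mu D f s.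
Proof.
move=> st; apply: ereal_inf_le_tmp => _ [l [l0 ls] <-].
by exists l => //; split => //; apply: le_trans ls _; rewrite lee_fin.
Qed.

Lemma distrib_ge0 f l : 0 <= distrib f l. Proof. exact: measure_ge0. Qed.

Lemma ae_le_distrib f g l : measurable_fun D f -> measurable_fun D g ->
  {ae mu, forall x, D x -> `|f x| <= `|g x|} -> distrib f l <= distrib g l.
Proof.
move=> mf mg [N [mN N0 fgN]].
apply: (@le_trans _ _ (mu (D `&` [set x | l%:E < `|g x|] `|` N))).
  apply: le_measure; rewrite ?inE; first exact: measurable_superlevel.
    by apply: measurableU => //; exact: measurable_superlevel.
  move=> x [Dx /= lx]; have [Nx|Nx] := pselect (N x); [by right|left].
  split => //=; apply: lt_le_trans lx _; apply: contrapT => h; apply: Nx.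
  by apply: fgN => /= /(_ Dx).
apply: (@le_trans _ _ (distrib g l + mu N)).
  by apply: measureU2 => //; exact: measurable_superlevel.
by rewrite N0 adde0.
Qed.

End distribution.

Section rearr_compare.
Context (R : realType) (d d' : measure_display) (T : measurableType d)
  (T' : measurableType d').
Variables (mu : {measure set T -> \bar R}) (D : set T)
  (nu : {measure set T' -> \bar R}) (E : set T').
Hypotheses (mD : measurable D) (mE : measurable E).

Lemma le_rearr (f : T -> \bar R) (g : T' -> \bar R) t :
  measurable_fun D f -> measurable_fun E g ->
  (forall l, (0 <= l)%R -> distrib mu D f l <= distrib nu E g l) ->
  rearr mu D f t <= rearr nu E g t.
Proof.
move=> mf mg fg; apply: lee_fin_ubound => [|l l0 /rearr_leP gl].
  exact: rearr_ge0.
by apply/rearr_leP => //; apply: le_trans (fg _ l0) (gl _ _ _).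
Qed.

End rearr_compare.

Lemma eq_rearr (R : realType) (d d' : measure_display) (T : measurableType d)
    (T' : measurableType d') (mu : {measure set T -> \bar R}) (D : set T)
    (nu : {measure set T' -> \bar R}) (E : set T') f g t :
  measurable D -> measurable E -> measurable_fun D f -> measurable_fun E g ->
  (forall l, (0 <= l)%R -> distrib mu D f l = distrib nu E g l) ->
  rearr mu D f t = rearr nu E g t.
Proof.
move=> mD mE mf mg fg; apply/eqP; rewrite eq_le.
by rewrite !le_rearr// => l l0; rewrite fg.
Qed.

(** * The half-line and the kernel of the Hardy operator *)

Lemma measurable_line (R : realType) (A : set R) :
  measurable (A : set (measurableTypeR R)) -> measurable (A : set (line R)).
Proof. exact: sub_caratheodory. Qed.

Lemma measurable_fun_line (R : realType) (D : set (line R)) :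
  measurable D -> measurable_fun D (fun s : line R => (s : measurableTypeR R)).
Proof. by move=> mD _ Y mY; apply: measurableI => //; exact: measurable_line. Qed.

Lemma measurable_line_EFin (R : realType) (D : set (line R)) :
  measurable D -> measurable_fun D (fun s : line R => (s : R)%:E).
Proof.
move=> mD; apply: (@measurableT_comp _ _ _ _ _ _ (EFin : measurableTypeR R -> \bar R)).
  exact: EFin_measurable.
exact: measurable_fun_line.
Qed.

Lemma measurable_halfline (R : realType) : measurable (halfline R).
Proof. by apply: measurable_line; exact: measurable_itv. Qed.

Lemma lebesgue_line_itv (R : realType) (i : interval R) :
  lebesgue_line R [set` i] = lebesgue_measure [set` i].
Proof. by []. Qed.

Lemma halflineP (R : realType) (s : line R) : halfline R s <-> (0 < (s : R))%R.
Proof. by rewrite /halfline /= in_itv/= andbT. Qed.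

Section tonelli.
Context (R : realType) (d : measure_display) (T : measurableType d).
Variables (mu : {sigma_finite_measure set T -> \bar R}) (D : set T).
Hypothesis mD : measurable D.
Local Notation H := (halfline R).

(** Tonelli's theorem on the region {(x, y) : y < phi x}: with G = 1 it gives
    the layer-cake formula, and with phi the identity of the half-line the duality
    between the Hardy operator and its dual. *)
Lemma tonelli_kernel (phi F : T -> \bar R) (G : line R -> \bar R) :
  measurable_fun D phi -> measurable_fun D F -> measurable_fun H G ->
  (forall x, D x -> 0 <= F x) -> (forall y, H y -> 0 <= G y) ->
  \int[mu]_(x in D)
     (F x * \int[lebesgue_line R]_(y in H `&` [set y : line R | (y : R)%:E < phi x]) G y) =
  \int[lebesgue_line R]_(y in H)
     (G y * \int[mu]_(x in D `&` [set x | (y : R)%:E < phi x]) F x).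
Proof.
move=> mphi mF mG F0 G0.
have mH := @measurable_halfline R.
pose F' := F \_ D; pose G' := G \_ H; pose phi' := phi \_ D.
have mF' : measurable_fun setT F' by apply/(measurable_restrictT _ mD).
have mG' : measurable_fun setT G' by apply/(measurable_restrictT _ mH).
have mphi' : measurable_fun setT phi' by apply/(measurable_restrictT _ mD).
have F'0 x : 0 <= F' x by rewrite /F' /patch; case: ifPn => // /set_mem; exact: F0.
have G'0 x : 0 <= G' x by rewrite /G' /patch; case: ifPn => // /set_mem; exact: G0.
have mE : measurable_fun setT (fun y : line R => (y : R)%:E).
  exact: measurable_line_EFin.
pose f (z : T * line R) := if (z.2 : R)%:E < phi' z.1 then F' z.1 * G' z.2 else 0.
have mf : measurable_fun setT f.
  apply: measurable_fun_ifT => //.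
    apply: measurable_fun_lte.
      exact: (measurableT_comp mE measurable_snd).
    exact: (measurableT_comp mphi' measurable_fst).
  apply: emeasurable_funM.
    exact: (measurableT_comp mF' measurable_fst).
  exact: (measurableT_comp mG' measurable_snd).
have f0 z : 0 <= f z by rewrite /f; case: ifP => // _; exact: mule_ge0.
have := @fubini_tonelli _ _ _ _ _ mu (lebesgue_line R) f mf f0.
have mphiy y : measurable (D `&` [set x | y%:E < phi x]).
  exact: emeasurable_fun_o_infty.
have mphix c : measurable (H `&` [set y : line R | (y : R)%:E < c]).
  by apply: measurable_lte => //; exact: measurable_funTS.
rewrite [in X in _ -> X]integral_mkcond [in X in _ -> _ = X]integral_mkcond.
have -> : (fun x => \int[lebesgue_line R]_y f (x, y)) = (fun x => F x *
     \int[lebesgue_line R]_(y in H `&` [set y : line R | (y : R)%:E < phi x]) G y) \_ D.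
  apply/funext => x; rewrite [RHS]/patch; case: ifPn => [xD|xD]; last first.
    rewrite integral0_eq// => y _; rewrite /f /= /F' /patch (negbTE xD).
    by case: ifP; rewrite ?mul0e.
  rewrite -ge0_integralZl//; last 3 first.
  - by apply: measurable_funS mG => // ? [].
  - by move=> y [Hy _]; exact: G0.
  - exact: (F0 _ (set_mem xD)).
  rewrite [in RHS]integral_mkcond; apply: eq_integral => y _.
  rewrite /f /= /phi' /F' /G' /patch xD in_setI.
  case: (y \in H) => /=; last by rewrite mule0 if_same.
  by rewrite mem_setE; case: ifP => h; rewrite ?h.
have -> : (fun y => \int[mu]_x f (x, y)) = (fun y => G y *
     \int[mu]_(x in D `&` [set x | (y : R)%:E < phi x]) F x) \_ H.
  apply/funext => y; rewrite [RHS]/patch; case: ifPn => [yD|yD]; last first.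
    rewrite integral0_eq// => x _; rewrite /f /= /G' /patch (negbTE yD).
    by case: ifP; rewrite ?mule0.
  rewrite -ge0_integralZl//; last 3 first.
  - by apply: measurable_funS mF => // ? [].
  - by move=> x [Dx _]; exact: F0.
  - exact: (G0 _ (set_mem yD)).
  rewrite [in RHS]integral_mkcond; apply: eq_integral => x _.
  rewrite /f /= /phi' /F' /G' /patch yD in_setI.
  case: (x \in D) => /=; last by rewrite mul0e if_same.
  by rewrite mem_setE muleC; case: ifP => h; rewrite ?h.
by [].
Qed.

End tonelli.

(** * Spaces that are transported to the half-line *)

Lemma lebesgue_line_below (R : realType) (c : \bar R) : 0 <= c ->
  lebesgue_line R (halfline R `&` [set s : line R | (s : R)%:E < c]) = c.
Proof.
case: c => [r| |] // r0.
  have -> : halfline R `&` [set s : line R | (s : R)%:E < r%:E] = `]0%R, r[%classic.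
    by apply/seteqP; split => s /=; rewrite /halfline /= !in_itv/= andbT ?lte_fin;
      [case=> -> ->|case/andP=> -> ->].
  rewrite lebesgue_line_itv lebesgue_measure_itv/= lte_fin.
  rewrite lee_fin in r0; case: ltP => r0'; first by rewrite -EFinD subr0.
  by congr EFin; apply/eqP; rewrite eq_le r0 r0'.
have -> : halfline R `&` [set s : line R | (s : R)%:E < +oo] = `]0%R, +oo[%classic.
  by apply/seteqP; split => s /=; rewrite /halfline /= !in_itv/= ?ltry // => -[].
by rewrite lebesgue_line_itv lebesgue_measure_itv/= ltry.
Qed.

Definition nonincreasing_on_pos (R : realType) (u : R -> \bar R) :=
  forall s t : R, (0 < s)%R -> (s <= t)%R -> u t <= u s.

(** A map V to the positive reals under which the restriction of mu to D is
    transported to Lebesgue measure on the half-line. *)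
Record uniformizes (R : realType) (d : measure_display) (T : measurableType d)
    (mu : {measure set T -> \bar R}) (D : set T) (V : T -> R) : Prop := {
  unif_measurable : measurable_fun D (V : T -> measurableTypeR R) ;
  unif_gt0 : forall x, D x -> (0 < V x)%R ;
  unif_below : forall v : R, (0 < v)%R -> mu (D `&` [set x | (V x < v)%R]) = v%:E }.

Lemma uniformizes_line (R : realType) :
  uniformizes (lebesgue_line R) (halfline R) (id : line R -> R).
Proof.
have mH := @measurable_halfline R.
split; first exact: measurable_fun_line.
  by move=> x /halflineP.
move=> v v0; rewrite -[RHS]lebesgue_line_below ?lee_fin ?ltW//.
Qed.

Section uniformized.
Context (R : realType) (d : measure_display) (T : measurableType d).
Variables (mu : {measure set T -> \bar R}) (D : set T) (V : T -> R).
Hypotheses (mD : measurable D) (UV : uniformizes mu D V).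

Lemma measurable_nonincreasing_comp (u : R -> \bar R) :
  nonincreasing_on_pos u -> measurable_fun D (u \o V).
Proof.
move=> nu. apply: (measurability _ (ErealGenOInfty.measurableE R)) => //.
move=> _ [_ [y ->] <-].
have -> : D `&` (u \o V) @^-1` `]y%:E, +oo[ =
    D `&` V @^-1` [set v | (0 < v)%R /\ y%:E < u v].
  apply/seteqP; split => x [Dx] /=; rewrite in_itv/= andbT.
    by move=> yu; split => //; split => //; exact: (unif_gt0 UV).
  by move=> [_ ?].
apply: (unif_measurable UV) => //.
apply: is_interval_measurable => v w /= [v0 yv] [w0 yw] z /andP[vz zw].
have z0 : (0 < z)%R by apply: lt_le_trans vz.
by split => //; apply: lt_le_trans yw _; exact: nu.
Qed.

Lemma measurable_unif_below (v : R) : measurable (D `&` [set x | (V x < v)%R]).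
Proof.
have -> : [set x | (V x < v)%R] = V @^-1` `]-oo, v[.
  by apply/seteqP; split => x /=; rewrite in_itv.
exact: (unif_measurable UV).
Qed.

Lemma measurable_unif : measurable_fun D (fun x => (V x)%:E).
Proof.
apply: (@measurableT_comp _ _ _ _ _ _ (EFin : measurableTypeR R -> \bar R)).
  exact: EFin_measurable.
exact: unif_measurable UV.
Qed.

Lemma measurable_unif_belowe (c : \bar R) :
  measurable (D `&` [set x | (V x)%:E < c]).
Proof. by apply: emeasurable_fun_infty_o => //; exact: measurable_unif. Qed.

Lemma unif_belowe (c : \bar R) : 0 <= c ->
  mu (D `&` [set x | (V x)%:E < c]) = c.
Proof.
case: c => [r| |] // r0.
  rewrite lee_fin le_eqVlt in r0; case/orP : r0 => [/eqP <-|/(unif_below UV)] //.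
  rewrite (_ : _ `&` _ = set0) ?measure0//; apply/seteqP; split => // x [Dx] /=.
  by rewrite lte_fin ltNge ltW// (unif_gt0 UV).
apply/eqyP => v v0; rewrite -(unif_below UV v0); apply: le_measure; rewrite ?inE.
- exact: measurable_unif_below.
- rewrite (_ : [set x | _] = setT) ?setIT//.
  by apply/seteqP; split => x //= _; rewrite ltry.
- by move=> x [Dx _]; split => //=; rewrite ltry.
Qed.

End uniformized.

Section uniformized_compare.
Context (R : realType) (d d' : measure_display) (T : measurableType d)
  (T' : measurableType d').
Variables (mu : {measure set T -> \bar R}) (D : set T) (V : T -> R).
Variables (nu : {measure set T' -> \bar R}) (D' : set T') (V' : T' -> R).
Hypotheses (mD : measurable D) (UV : uniformizes mu D V).
Hypotheses (mD' : measurable D') (UV' : uniformizes nu D' V').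
Variable u : R -> \bar R.
Hypotheses (nu_ : nonincreasing_on_pos u) (u0 : forall s, (0 < s)%R -> 0 <= u s).

(** If u o V exceeds l at a point x with V x > m, then it exceeds l on the whole
    of {V' < V x}; so superlevel sets of u o V have the same measure for all V. *)
Lemma le_distrib_comp l : (0 <= l)%R ->
  distrib mu D (u \o V) l <= distrib nu D' (u \o V') l.
Proof.
move=> l0; apply/lee_addgt0Pr => e e0.
have [->|] := eqVneq (distrib nu D' (u \o V') l) +oo; first by rewrite leey.
rewrite -ltey -ge0_fin_numE ?distrib_ge0// => /fineK mE.
set m := fine _ in mE; have m0 : (0 <= m)%R by rewrite fine_ge0// distrib_ge0.
have me0 : (0 < m + e)%R by rewrite ltr_wpDl.
rewrite -mE -EFinD -(unif_below UV me0); apply: le_measure; rewrite ?inE.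
- by apply: measurable_superlevel => //; exact: (measurable_nonincreasing_comp mD UV nu_).
- exact: (measurable_unif_below mD UV).
move=> x [Dx /= lu]; split => //=; rewrite ltNge; apply/negP => meV.
have Vx0 := unif_gt0 UV Dx.
have : (V x)%:E <= m%:E.
  rewrite mE -(unif_below UV' Vx0); apply: le_measure; rewrite ?inE.
  - exact: (measurable_unif_below mD' UV').
  - by apply: measurable_superlevel => //; exact: (measurable_nonincreasing_comp mD' UV' nu_).
  - move=> y [Dy /= yx]; split => //=; apply: lt_le_trans lu _.
    have Vy0 := unif_gt0 UV' Dy.
    by rewrite !gee0_abs ?u0//; apply: nu_ => //; exact: ltW.
rewrite lee_fin; apply/negP; rewrite -ltNge; apply: lt_le_trans meV.
by rewrite ltrDl.
Qed.

End uniformized_compare.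

(** * Layer cakes and equimeasurability *)

Lemma measurable_nonincreasing_line (R : realType) (u : R -> \bar R) :
  nonincreasing_on_pos u -> measurable_fun (halfline R) (u : line R -> \bar R).
Proof.
exact: (measurable_nonincreasing_comp (@measurable_halfline R) (@uniformizes_line R)).
Qed.

Lemma le_integral_halfline (R : realType) (u v : R -> \bar R) :
  measurable_fun (halfline R) (u : line R -> \bar R) ->
  measurable_fun (halfline R) (v : line R -> \bar R) ->
  (forall y, (0 < y)%R -> 0 <= u y) -> (forall y, (0 < y)%R -> u y <= v y) ->
  \int[lebesgue_line R]_(y in halfline R) u y <=
  \int[lebesgue_line R]_(y in halfline R) v y.
Proof.
move=> mu_ mv u0 uv; apply: ge0_le_integral.
- exact: measurable_halfline.
- by move=> y /halflineP; exact: u0.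
- exact: mu_.
- exact: mv.
- by move=> y /halflineP; exact: uv.
Qed.

Lemma measurable_line_belowe (R : realType) (c : \bar R) :
  measurable (halfline R `&` [set s : line R | (s : R)%:E < c]).
Proof.
have mH := @measurable_halfline R.
by apply: measurable_lte => //; exact: measurable_line_EFin.
Qed.

Section layer_cake.
Context (R : realType) (d : measure_display) (T : measurableType d).
Variables (mu : {sigma_finite_measure set T -> \bar R}) (D : set T).
Hypothesis mD : measurable D.
Local Notation H := (halfline R).

Lemma measurable_superlevel_ge0 (f : T -> \bar R) (y : \bar R) :
  measurable_fun D f -> measurable (D `&` [set x | y < f x]).
Proof. by move=> mf; exact: emeasurable_fun_o_infty. Qed.

Lemma layer_cake (F f : T -> \bar R) :
  measurable_fun D F -> measurable_fun D f ->
  (forall x, D x -> 0 <= F x) -> (forall x, D x -> 0 <= f x) ->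
  \int[mu]_(x in D) (F x * f x) =
  \int[lebesgue_line R]_(y in H) \int[mu]_(x in D `&` [set x | (y : R)%:E < f x]) F x.
Proof.
move=> mF mf F0 f0.
have mH := @measurable_halfline R.
have := @tonelli_kernel _ _ _ mu D mD f F (cst 1) mf mF
  (@measurable_cst _ _ _ _ _ _) F0 (fun _ _ => lee01).
under [X in _ = X -> _]eq_integral do rewrite mul1e.
move=> <-; apply: eq_integral => x /set_mem Dx; congr (_ * _).
rewrite integral_cst; last exact: measurable_line_belowe.
rewrite mul1e; exact/esym/lebesgue_line_below/f0.
Qed.

Lemma nonincreasing_layer (F f : T -> \bar R) :
  measurable_fun D F -> measurable_fun D f -> (forall x, D x -> 0 <= F x) ->
  nonincreasing_on_pos (fun y : R => \int[mu]_(x in D `&` [set x | y%:E < f x]) F x).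
Proof.
move=> mF mf F0 s t s0 st; apply: ge0_subset_integral.
- exact: measurable_superlevel_ge0.
- exact: measurable_superlevel_ge0.
- by apply: measurable_funS mF => // ? [].
- by move=> x [/F0].
- by move=> x [Dx /= tf]; split => //=; apply: le_lt_trans tf; rewrite lee_fin.
Qed.

Lemma integral_distrib (f : T -> \bar R) : measurable_fun D f ->
  (forall x, D x -> 0 <= f x) ->
  \int[mu]_(x in D) f x = \int[lebesgue_line R]_(y in H) distrib mu D f y.
Proof.
move=> mf f0; have := @layer_cake (cst 1) f (@measurable_cst _ _ _ _ _ _) mf
  (fun _ _ => lee01) f0.
under eq_integral do rewrite mul1e.
move=> ->; apply: eq_integral => y /set_mem/halflineP y0.
rewrite integral_cst ?mul1e//; last exact: measurable_superlevel_ge0.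
congr (mu _); apply/seteqP; split => x [Dx /= yf]; split => //=.
  by rewrite gee0_abs// f0.
by move: yf; rewrite gee0_abs// f0.
Qed.

End layer_cake.

Section layer_comparison.
Context (R : realType) (d d' : measure_display) (T : measurableType d)
  (T' : measurableType d').
Variables (mu : {sigma_finite_measure set T -> \bar R}) (D : set T)
  (nu : {sigma_finite_measure set T' -> \bar R}) (D' : set T').
Hypotheses (mD : measurable D) (mD' : measurable D').

(** Comparison of integrals of products through the superlevel sets of the second
    factor: both Hardy-Littlewood inequalities reduce to the case of indicators. *)
Lemma le_integral_layers (F f : T -> \bar R) (F' f' : T' -> \bar R) :
  measurable_fun D F -> measurable_fun D f ->
  (forall x, D x -> 0 <= F x) -> (forall x, D x -> 0 <= f x) ->
  measurable_fun D' F' -> measurable_fun D' f' ->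
  (forall x, D' x -> 0 <= F' x) -> (forall x, D' x -> 0 <= f' x) ->
  (forall y : R, (0 < y)%R -> \int[mu]_(x in D `&` [set x | y%:E < f x]) F x <=
    \int[nu]_(x in D' `&` [set x | y%:E < f' x]) F' x) ->
  \int[mu]_(x in D) (F x * f x) <= \int[nu]_(x in D') (F' x * f' x).
Proof.
move=> mF mf F0 f0 mF' mf' F'0 f'0 Ff; rewrite (layer_cake mu mD mF mf F0 f0) (layer_cake nu mD' mF' mf' F'0 f'0).
apply: (@le_integral_halfline _
  (fun y => \int[mu]_(x in D `&` [set x | y%:E < f x]) F x)
  (fun y => \int[nu]_(x in D' `&` [set x | y%:E < f' x]) F' x)).
- by apply: measurable_nonincreasing_line; exact: nonincreasing_layer.
- by apply: measurable_nonincreasing_line; exact: nonincreasing_layer.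
- by move=> y _; apply: integral_ge0 => x [/F0].
- exact: Ff.
Qed.

Lemma le_integral_distrib (f : T -> \bar R) (f' : T' -> \bar R) :
  measurable_fun D f -> (forall x, D x -> 0 <= f x) ->
  measurable_fun D' f' -> (forall x, D' x -> 0 <= f' x) ->
  (forall l : R, (0 < l)%R -> distrib mu D f l <= distrib nu D' f' l) ->
  \int[mu]_(x in D) f x <= \int[nu]_(x in D') f' x.
Proof.
move=> mf f0 mf' f'0 ff'; rewrite (integral_distrib mu mD mf f0) (integral_distrib nu mD' mf' f'0).
have nd d1 (T1 : measurableType d1) (m : {measure set T1 -> \bar R}) E (g : T1 -> \bar R) :
    measurable E -> measurable_fun E g -> nonincreasing_on_pos (distrib m E g).
  by move=> mE mg s t _; exact: le_distrib.
apply: (@le_integral_halfline _ (distrib mu D f) (distrib nu D' f')).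
- by apply: measurable_nonincreasing_line; exact: nd.
- by apply: measurable_nonincreasing_line; exact: nd.
- by move=> y _; exact: distrib_ge0.
- exact: ff'.
Qed.

End layer_comparison.

Section rearr_line.
Context (R : realType) (d : measure_display) (T : measurableType d).
Variables (mu : {measure set T -> \bar R}) (D : set T).
Hypothesis mD : measurable D.
Implicit Types f g : T -> \bar R.
Local Notation H := (halfline R).

Lemma nonincreasing_rearr f : nonincreasing_on_pos (rearr mu D f).
Proof. by move=> s t _; exact: rearr_nonincreasing. Qed.

Lemma measurable_rearr f : measurable_fun H (rearr mu D f : line R -> \bar R).
Proof. apply: measurable_nonincreasing_line; exact: nonincreasing_rearr. Qed.

Lemma superlevel_rearr f (l : R) : measurable_fun D f -> (0 <= l)%R ->
  [set s : R | l%:E < rearr mu D f s] = [set s : R | s%:E < distrib mu D f l].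
Proof. by move=> mf l0; apply/seteqP; split => s /=; move/(rearr_gtP _ mD) => /(_ mf l0). Qed.

(** A function and its rearrangement, read through any uniformizing map, are
    equimeasurable. *)
Lemma distrib_rearr_comp f (d' : measure_display) (T' : measurableType d')
    (nu : {measure set T' -> \bar R}) (D' : set T') (V : T' -> R) (l : R) :
  measurable D' -> uniformizes nu D' V -> measurable_fun D f -> (0 <= l)%R ->
  distrib nu D' (rearr mu D f \o V) l = distrib mu D f l.
Proof.
move=> mD' UV mf l0; rewrite -[RHS](unif_belowe mD' UV) ?distrib_ge0//.
congr (nu _); congr (_ `&` _).
have /seteqP[h1 h2] := superlevel_rearr mf l0.
apply/seteqP; split => x /=; rewrite gee0_abs ?rearr_ge0//.
  exact: h1. 
exact: h2.
Qed.

Lemma distrib_rearr f (l : R) : measurable_fun D f -> (0 <= l)%R ->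
  distrib (lebesgue_line R) H (rearr mu D f) l = distrib mu D f l.
Proof.
exact: (distrib_rearr_comp (@measurable_halfline R) (@uniformizes_line R)).
Qed.

Lemma rearr_rearr f (t : R) : measurable_fun D f ->
  rearr_halfline (rearr mu D f) t = rearr mu D f t.
Proof.
move=> mf; apply: eq_rearr => //; first exact: measurable_halfline.
  exact: measurable_rearr.
by move=> l l0; exact: distrib_rearr.
Qed.

End rearr_line.

(** * The Hardy-Littlewood inequality and its sharpness *)

Section hardy_littlewood.
Context (R : realType) (d : measure_display) (T : measurableType d).
Variables (mu : {sigma_finite_measure set T -> \bar R}) (D : set T).
Hypothesis mD : measurable D.
Implicit Types f g : T -> \bar R.
Local Notation H := (halfline R).

Lemma distrib_rearr_below f (m : \bar R) (l : R) : measurable_fun D f ->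
  0 <= m -> (0 <= l)%R ->
  distrib (lebesgue_line R) (H `&` [set s : line R | (s : R)%:E < m])
    (rearr mu D f) l = mine m (distrib mu D f l).
Proof.
move=> mf m0 l0; rewrite -[RHS]lebesgue_line_below ?le_min ?m0 ?distrib_ge0//.
congr (lebesgue_line R _); rewrite -setIA; congr (_ `&` _).
have /seteqP[h1 h2] := superlevel_rearr mu mD mf l0.
apply/seteqP; split => s /=; rewrite gee0_abs ?rearr_ge0// lt_min.
  by case=> -> /h1.
by case/andP=> -> /h2.
Qed.

(** The superlevel set {f > l}, cut to E, has measure at most
    min (mu E) (mu {f > l}), which is that of {f^* > l} cut to (0, mu E). *)
Lemma hardy_littlewood_set f (E : set T) : measurable_fun D f ->
  (forall x, D x -> 0 <= f x) -> measurable E -> E `<=` D ->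
  \int[mu]_(x in E) f x <=
  \int[lebesgue_line R]_(s in H `&` [set s : line R | (s : R)%:E < mu E]) rearr mu D f s.
Proof.
move=> mf f0 mE ED; apply: le_integral_distrib.
- exact: mE.
- exact: measurable_line_belowe.
- exact: measurable_funS mf.
- by move=> x /ED/f0.
- have mr : measurable_fun H (rearr mu D f : line R -> \bar R) by exact: measurable_rearr.
  by apply: measurable_funS mr => [|s []//]; exact: measurable_halfline.
- by move=> s _; exact: rearr_ge0.
move=> l l0; rewrite (distrib_rearr_below mf (measure_ge0 mu E) (ltW l0)) le_min.
have mEl : measurable (E `&` [set x | l%:E < `|f x|]).
  by apply: measurable_superlevel => //; exact: measurable_funS mf.
apply/andP; split; first by apply: le_measure; rewrite ?inE// => x [].
apply: le_measure; rewrite ?inE//; first exact: measurable_superlevel.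
by move=> x [/ED].
Qed.

Lemma hardy_littlewood f g : measurable_fun D f -> measurable_fun D g ->
  (forall x, D x -> 0 <= f x) -> (forall x, D x -> 0 <= g x) ->
  \int[mu]_(x in D) (f x * g x) <=
  \int[lebesgue_line R]_(s in H) (rearr mu D f s * rearr mu D g s).
Proof.
move=> mf mg f0 g0; apply: le_integral_layers => //.
- exact: measurable_halfline.
- exact: measurable_rearr.
- exact: measurable_rearr.
- by move=> s _; exact: rearr_ge0.
- by move=> s _; exact: rearr_ge0.
move=> y y0.
have -> : H `&` [set s | y%:E < rearr mu D g s] =
    H `&` [set s | s%:E < mu (D `&` [set x | y%:E < g x])].
  have /seteqP[h1 h2] := superlevel_rearr mu mD mg (ltW y0).
  have <- : distrib mu D g y = mu (D `&` [set x | y%:E < g x]).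
    congr (mu _); apply/seteqP; split => x [Dx /= yx]; split => //=.
      by rewrite -(gee0_abs (g0 _ Dx)).
    by rewrite (gee0_abs (g0 _ Dx)).
  by apply/seteqP; split => s [Hs] => [/h1|/h2].
by apply: hardy_littlewood_set => //; exact: measurable_superlevel_ge0.
Qed.

End hardy_littlewood.

Section sharp.
Context (R : realType) (d : measure_display) (T : measurableType d).
Variables (mu : {sigma_finite_measure set T -> \bar R}) (D : set T) (V : T -> R).
Hypotheses (mD : measurable D) (UV : uniformizes mu D V).
Variable g : T -> \bar R.
Hypotheses (mg : measurable_fun D g) (g0 : forall x, D x -> 0 <= g x).
Hypothesis gfin : distrib mu D g 0 < +oo.
Local Notation H := (halfline R).

(** Superlevel sets of g for the lexicographic order in which ties of g are
    broken by V. *)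
Let U (a v : \bar R) : set T :=
  D `&` [set x | a < g x \/ (a <= g x /\ (V x)%:E < v)].

Let measurable_U a v : measurable (U a v).
Proof.
have -> : U a v = (D `&` [set x | a < g x]) `|`
   ((D `&` [set x | a <= g x]) `&` (D `&` [set x | (V x)%:E < v])).
  apply/seteqP; split => x /=.
    by move=> [Dx [ag|[ag Vv]]]; [left|right].
  by move=> [[Dx ag]|[[Dx ag] [_ Vv]]]; split => //; [left|right].
apply: measurableU; first exact: measurable_superlevel_ge0.
apply: measurableI; first exact: emeasurable_fun_c_infty.
exact: (measurable_unif_belowe mD UV).
Qed.

Let U_total a v a' v' : U a v `<=` U a' v' \/ U a' v' `<=` U a v.
Proof.
have key b w b' w' : b < b' -> U b' w' `<=` U b w.
  move=> bb' x [Dx /= h]; split => //=; left; apply: lt_le_trans bb' _.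
  by case: h => [/ltW|[]].
have [/key|/key|<-] := ltgtP a a'; [by right|by left|].
have mono w w' : w <= w' -> U a w `<=` U a w'.
  move=> ww' x [Dx /= h]; split => //=; case: h => [|[ag wV]]; [by left|right].
  by split => //; apply: lt_le_trans ww'.
by have [/mono|/ltW/mono] := leP v v'; [left|right].
Qed.

Let U0E a : U a 0 = D `&` [set x | a < g x].
Proof.
apply/seteqP; split => x [Dx /= h]; split => //=; last by left.
by case: h => // -[_]; rewrite lte_fin ltNge (ltW (unif_gt0 UV Dx)).
Qed.

Let UyE a : U a +oo = D `&` [set x | a <= g x].
Proof.
apply/seteqP; split => x [Dx /= h]; split => //=; first by case: h => [/ltW|[]].
by right; rewrite ltry.
Qed.

Let U_sub0 a v : 0 < a -> U a v `<=` D `&` [set x | 0 < `|g x|].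
Proof.
move=> a0 x [Dx /= h]; split => //=; rewrite gee0_abs ?g0//.
by apply: lt_le_trans a0 _; case: h => [/ltW|[]].
Qed.

(** Passing from V < v to V < v' adds a set of measure at most v' - v: along each
    plateau the measure varies continuously. *)
Let U_lipschitz a (v e : R) : (0 <= v)%R -> (0 < e)%R ->
  mu (U a (v + e)%:E) <= mu (U a v%:E) + e%:E.
Proof.
move=> v0 e0; pose B (w : R) := D `&` [set x | (V x)%:E < w%:E].
have mB w : measurable (B w) by exact: (measurable_unif_belowe mD UV).
have muB w : (0 <= w)%R -> mu (B w) = w%:E by move=> w0; exact: (unif_belowe mD UV).
have mBB : measurable (B (v + e)%R `\` B v) by apply: measurableD.
apply: (@le_trans _ _ (mu (U a v%:E `|` (B (v + e)%R `\` B v)))).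
  apply: le_measure; rewrite ?inE//; first by apply: measurableU.
  move=> x [Dx /= [ag|[ag Vx]]]; first by left; split => //; left.
  have [Vv|Vv] := ltP (V x)%:E v%:E; first by left; split => //; right.
  by right; split => //= -[_] /=; rewrite ltNge Vv.
apply: le_trans (@measureU2 _ _ _ mu _ _ (measurable_U _ _) mBB) _.
rewrite leeD2l//.
have muBve : mu (B (v + e)%R) = (v + e)%:E by exact/muB/addr_ge0/ltW.
rewrite (measureD (mB _) (mB _)); last first.
  by have := ltry (v + e)%R; rewrite -muBve.
have -> : B (v + e)%R `&` B v = B v.
  apply/seteqP; split => x; first by case.
  move=> [Dx /= xv]; split; split => //=; apply: lt_trans xv _.
  by rewrite lte_fin ltrDl.
apply: (@le_trans _ _ ((v + e)%:E - v%:E)).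
  by rewrite -muBve -(muB _ v0); exact: lexx.
by rewrite -EFinB addrAC subrr add0r.
Qed.

Let measure_ge_rearr (c : R) : (0 < c)%R -> c%:E < distrib mu D g 0 ->
  c%:E <= mu (D `&` [set x | rearr mu D g c <= g x]).
Proof.
move=> c0 cg; set a := rearr mu D g c.
have a0 : 0 < a by apply/rearr_gtP.
pose l (k : nat) : R := if a is r%:E then (r - r / k.+1%:R)%R else k%:R.
have [la [[l0 lnd] lP]] : (forall k, (l k)%:E < a /\ (0 <= l k)%R) /\
    (l 0%N = 0%R /\ {homo l : i j / (i <= j)%N >-> (i <= j)%R}) /\
    forall y, (forall k, (l k)%:E < y) -> a <= y.
  rewrite /l; clear l; case: a a0 => [r| |] // r0; last first.
    split; first by move=> k; rewrite ltry ler0n.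
    split; first by split => // i j; rewrite ler_nat.
    move=> [y| |] // h; last by have := h 0%N.
    have := h (Num.bound `|y|); rewrite lte_fin => yb; exfalso.
    have := archi_boundP (normr_ge0 y).
    by move/(le_lt_trans (ler_norm y)); rewrite ltNge (ltW yb).
  rewrite lte_fin in r0; split.
    move=> k; rewrite lte_fin ltrBlDr ltrDl divr_gt0// subr_ge0; split => //.
    by rewrite ler_pdivrMr// ler_peMr ?ler1n// ltW.
  split.
    split; first by rewrite divr1 subrr.
    move=> i j ij; rewrite lerB// ler_pM2l// lef_pV2 ?posrE// ler_nat ltnS//.
  move=> [y| |] h; rewrite ?leey//; last by have := h 0%N.
  rewrite lee_fin leNgt; apply/negP => yr.
  have e0 : (0 < (r - y) / r)%R by rewrite divr_gt0// subr_gt0.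
  have [k _ /(_ k (leqnn k)) /= kr] := near_infty_natSinv_lt (PosNum e0).
  have := h k; rewrite lte_fin ltNge => /negP; apply.
  by rewrite lerBrDr -lerBrDl mulrC -ler_pdivlMr// ltW.
pose F k := D `&` [set x | (l k)%:E < `|g x|].
have mF k : measurable (F k) by exact: measurable_superlevel.
have cF k : c%:E <= mu (F k) by have [la' l0'] := la k; exact/ltW/rearr_gtP.
have sub : \bigcap_k F k `<=` D `&` [set x | a <= g x].
  move=> x Fx; have [Dx _] := Fx 0%N I; split => //=; apply: lP => k.
  by have [_ /=] := Fx k I; rewrite gee0_abs// g0.
have mcap : measurable (\bigcap_k F k) by exact: bigcapT_measurable.
apply: (@le_trans _ _ (mu (\bigcap_k F k))); last first.
  by apply: le_measure; rewrite ?inE//; exact: emeasurable_fun_c_infty.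
have ndF : nonincreasing_seq F.
  move=> i j ij; apply/subsetPset => x [Dx /= lx]; split => //=.
  by apply: le_lt_trans lx; rewrite lee_fin lnd.
have F0fin : mu (F 0%N) < +oo by rewrite /F l0.
have cF' := nonincreasing_cvg_mu F0fin mF mcap ndF.
rewrite -(cvg_lim _ cF')//; apply: lime_ge; last exact: nearW.
by apply/cvg_ex; exists (mu (\bigcap_k F k)).
Qed.

Let level_set_of_measure (c : R) : (0 < c)%R -> c%:E < distrib mu D g 0 ->
  exists a v, 0 < a /\ mu (U a v) = c%:E.
Proof.
move=> c0 cg; pose a := rearr mu D g c; exists a.
have a0 : 0 < a by apply/rearr_gtP.
pose u v := mu (U a v).
have u0 : u 0 <= c%:E.
  rewrite /u U0E; have [aE|] := eqVneq a +oo.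
    rewrite aE (_ : _ `&` _ = set0) ?measure0 ?lee_fin ?ltW//.
    by apply/seteqP; split => x // [_] /=; rewrite ltNge leey.
  rewrite -ltey -ge0_fin_numE ?(ltW a0)// => /fineK aE.
  have ar0 : (0 <= fine a)%R by rewrite fine_ge0// ltW.
  have /(rearr_leP _ mD) : rearr mu D g c <= (fine a)%:E by rewrite aE.
  move=> /(_ mg ar0); apply: le_trans; apply: le_measure; rewrite ?inE//.
  - exact: measurable_superlevel_ge0.
  - exact: measurable_superlevel.
  - by move=> x [Dx /= ag]; split => //=; rewrite aE gee0_abs// g0.
have uy : c%:E <= u +oo by rewrite /u UyE; exact: measure_ge_rearr.
have [uyc|cuy] := leP (u +oo) c%:E.
  by exists +oo; split=> //; apply/eqP; rewrite eq_le uy uyc.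
pose S := [set v : R | (0 <= v)%R /\ u v%:E <= c%:E].
have mono v w : v <= w -> u v <= u w.
  move=> vw; apply: le_measure; rewrite ?inE// => x [Dx /= [ag|[ag Vv]]]; split => //=.
    by left.
  by right; split => //; exact: lt_le_trans vw.
have [M cM] : exists k : nat, c%:E < u k%:R%:E.
  apply: contrapT => /forallNP h.
  have UU : U a +oo = \bigcup_k U a k%:R%:E.
    apply/seteqP; split => [x [Dx /= h']|x [k _ [Dx /= h']]]; last first.
      by split => //=; case: h' => [|[ag _]]; [left|right; rewrite ltry].
    exists (Num.bound (V x)) => //; split => //=; case: h' => [|[ag _]]; first by left.
    by right; split => //; rewrite lte_fin archi_boundP// ltW// (unif_gt0 UV).
  have cvgU : u k%:R%:E @[k --> \oo] --> u +oo.
    rewrite /u UU; apply: nondecreasing_cvg_mu => //.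
      exact: bigcupT_measurable.
    move=> i j ij; apply/subsetPset => x [Dx /= [ag|[ag Vv]]]; split => //=.
      by left.
    by right; split => //; apply: lt_le_trans Vv _; rewrite lee_fin ler_nat.
  move: cuy; apply/negP; rewrite -leNgt -(cvg_lim _ cvgU)//.
  apply: lime_le; first by apply/cvg_ex; exists (u +oo).
  by apply: nearW => k; rewrite leNgt; apply/negP; exact: h.
have S0 : S 0%R by split.
have SM : ubound S M%:R.
  move=> v [v0 uv]; rewrite leNgt; apply/negP => Mv; move: cM; apply/negP.
  by rewrite -leNgt; apply: le_trans uv; apply: mono; rewrite lee_fin ltW.
have hS : has_sup S by split; [exists 0%R|exists M%:R].
exists (sup S)%:E; split => //; apply/eqP; rewrite eq_le; apply/andP; split.
  apply/lee_addgt0Pr => e e0.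
  have [v [v0 uv] ev] := sup_adherent e0 hS.
  apply: (@le_trans _ _ (u v%:E + e%:E)); last by rewrite leeD2r.
  apply: le_trans (U_lipschitz a v0 e0); apply: mono.
  by rewrite lee_fin -lerBlDr ltW.
apply/lee_addgt0Pr => e e0.
have sS0 : (0 <= sup S)%R by apply: ub_le_sup => //; exists M%:R.
apply: le_trans (U_lipschitz a sS0 e0).
rewrite leNgt; apply/negP => /ltW uc.
have : (sup S + e <= sup S)%R.
  apply: ub_le_sup; first by exists M%:R.
  by split => //; rewrite addr_ge0// ltW.
by rewrite gerDl leNgt e0.
Qed.

(** The sets B c play the role of the intervals (0, c): they increase with c and
    are as small, and as concentrated where g is large, as possible. *)
Let nested_family : exists B : R -> set T, forall c, (0 < c)%R ->
  [/\ measurable (B c), B c `<=` D, mu (B c) <= c%:E,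
      forall c', (c <= c')%R -> B c `<=` B c' &
      forall a, (0 <= a)%R ->
        mine c%:E (distrib mu D g a) <= mu (D `&` [set x | a%:E < `|g x|] `&` B c)].
Proof.
pose P c B := (0 < c)%R ->
  if c%:E < distrib mu D g 0 then exists a v, [/\ 0 < a, B = U a v & mu B = c%:E]
  else B = U 0 0.
have [B PB] : {B : R -> set T & forall c, P c (B c)}.
  apply: (@choice _ _ P) => c; rewrite /P.
  have [c0|c0] := ltP 0%R c; last by exists set0.
  have [cg|cg] := boolP (c%:E < distrib mu D g 0); last by exists (U 0 0).
  by have [a [v [a0 Uc]]] := level_set_of_measure c0 cg; exists (U a v) => _; exists a, v.
have distribU a : (0 <= a)%R -> D `&` [set x | a%:E < `|g x|] = U a%:E 0.
  move=> a0; rewrite U0E; apply/seteqP; split => x [Dx /= ag]; split => //=.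
    by rewrite -(gee0_abs (g0 Dx)).
  by rewrite gee0_abs// g0.
have BU c : (0 < c)%R -> exists a v, B c = U a v.
  move=> c0; have := PB c c0; case: ifP => _; first by move=> [a [v [_ -> _]]]; exists a, v.
  by move=> ->; exists 0, 0.
have muU0 : distrib mu D g 0 = mu (U 0 0) by rewrite /distrib distribU.
have sub00 a v : 0 < a -> U a v `<=` U 0 0 by rewrite -distribU//; exact: U_sub0.
exists B => c c0; have [a [v BcE]] := BU c c0; have PBc := PB c c0; split.
- by rewrite BcE.
- by rewrite BcE => x [].
- move: PBc; case: ifPn => [_ [? [? [_ _ ->]]]|]; first exact: lexx.
  by rewrite -leNgt muU0 => gc ->.
- move=> c' cc'; have c'0 := lt_le_trans c0 cc'; have PBc' := PB c' c'0.
  have [E|cc'E] := eqVneq c c'; first by rewrite E.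
  move: PBc; case: ifPn => [_ [b [w [b0 BE Bc]]]|cg ->]; last first.
    move: PBc'; case: ifPn => [c'g _|_ ->]; last exact: subset_refl.
    by exfalso; move/negP: cg; apply; apply: le_lt_trans c'g; rewrite lee_fin.
  move: PBc'; case: ifPn => [_ [b' [w' [b'0 B'E Bc']]]|_ ->]; last first.
    by rewrite BE; exact: sub00.
  have [|sub] := U_total b w b' w'; first by rewrite BE B'E.
  have : mu (B c') <= mu (B c) by apply: le_measure; rewrite ?inE ?BE ?B'E.
  by rewrite Bc Bc' lee_fin leNgt lt_neqAle cc'E cc'.
- move=> b b0; rewrite /distrib (distribU _ b0) BcE.
  have [sub|sub] := U_total b%:E 0 a v.
    by rewrite (setIidl sub) ge_min lexx orbT.
  rewrite (setIidr sub); move: PBc; case: ifPn => [_ [b' [w' [_ _ Bc]]]|cg B0].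
    by rewrite -BcE Bc ge_min lexx.
  have -> : U a v = U b%:E 0.
    apply/seteqP; split => //; rewrite -BcE B0 -!distribU// => x [Dx /= bg].
    by split => //=; apply: le_lt_trans bg; rewrite lee_fin.
  by rewrite ge_min lexx orbT.
Qed.

(** The extremal k x is the supremum of the w c over the rational c with x in B c.
    Then {k > l} lies in B c as soon as w c <= l, while each superlevel set of g
    meets the sets B c in as much measure as possible, which is the case of equality
    in the Hardy-Littlewood inequality. *)
Lemma hardy_littlewood_sharp (w : R -> \bar R) :
  nonincreasing_on_pos w -> (forall s, (0 < s)%R -> 0 <= w s) ->
  exists k, [/\ Mplus D k, forall t, (0 < t)%R -> rearr mu D k t <= w t &
    \int[lebesgue_line R]_(s in H) (w s * rearr mu D g s) <=
    \int[mu]_(x in D) (k x * g x)].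
Proof.
move=> nw w0; have [B PB] := nested_family.
pose S x := [set w (ratr q) | q in [set q : rat | (0 < ratr q :> R)%R /\ B (ratr q) x]].
pose k x := ereal_sup (0 |` S x).
have k0 x : 0 <= k x by apply: ereal_sup_ubound; left.
have kP (l : R) : (0 <= l)%R -> [set x | l%:E < k x] =
    \bigcup_(q in [set q : rat | (0 < ratr q :> R)%R /\ l%:E < w (ratr q)]) B (ratr q).
  move=> l0; apply/seteqP; split => x /=.
    move=> /ereal_sup_gt[y [->|[q [q0 Bq] <-]] ly]; last by exists q.
    by move: ly; rewrite lte_fin ltNge l0.
  move=> [q /= [q0 lq] Bq]; apply: lt_le_trans lq _.
  by apply: ereal_sup_ubound; right; exists q.
have mk_level (l : R) : (0 <= l)%R -> measurable (D `&` [set x | l%:E < k x]).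
  move=> l0; rewrite kP// setI_bigcupr bigcup_mkcond.
  apply: countable_bigcupT_measurable; first exact: countableP.
  move=> q; case: ifPn => // /set_mem[q0 _]; apply: measurableI => //.
  by have [] := PB _ q0.
have mk : measurable_fun D k.
  apply: (measurability _ (ErealGenOInfty.measurableE R)) => //.
  move=> _ [_ [l ->] <-].
  have -> : k @^-1` `]l%:E, +oo[ = [set x | l%:E < k x].
    by apply/seteqP; split => x /=; rewrite in_itv/= andbT.
  have [l0|l0] := leP 0%R l; first exact: mk_level.
  rewrite (_ : [set x | _] = setT) ?setIT//; apply/seteqP; split => x //= _.
  by apply: lt_le_trans (k0 x); rewrite lte_fin.
exists k; split; first by split.
  move=> t t0; apply: lee_fin_ubound => [|l l0 wl]; first exact: w0.
  apply/rearr_leP => //; have [mBt _ Bt _ _] := PB _ t0.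
  apply: le_trans Bt; apply: le_measure; rewrite ?inE//.
    exact: measurable_superlevel.
  move=> x [Dx /=]; rewrite gee0_abs// => lk.
  have : [set x | l%:E < k x] x by [].
  rewrite kP// => -[q /= [q0 lq] Bq]; have [_ _ _ + _] := PB _ q0; apply => //.
  rewrite leNgt; apply/negP => tq; move: lq; rewrite ltNge; move/negP; apply.
  by apply: le_trans (nw _ _ t0 (ltW tq)) wl.
apply: le_integral_layers => //.
- exact: measurable_halfline.
- exact: measurable_nonincreasing_line.
- exact: measurable_rearr.
- by move=> s /halflineP/w0.
- by move=> s _; exact: rearr_ge0.
move=> y y0.
have -> : D `&` [set x | y%:E < g x] = D `&` [set x | y%:E < `|g x|].
  by apply/seteqP; split => x [Dx /= yg]; split => //=;
    [rewrite gee0_abs// g0|rewrite -(gee0_abs (g0 Dx))].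
have -> : H `&` [set s | y%:E < rearr mu D g s] =
    H `&` [set s | s%:E < distrib mu D g y].
  have /seteqP[h1 h2] := superlevel_rearr mu mD mg (ltW y0).
  by apply/seteqP; split => s [Hs] => [/h1|/h2].
have mw : measurable_fun H (w : line R -> \bar R) by exact: measurable_nonincreasing_line.
apply: le_integral_distrib.
- exact: measurable_line_belowe.
- exact: measurable_superlevel.
- by apply: measurable_funS mw => [|s []//]; exact: measurable_halfline.
- by move=> s [/halflineP/w0].
- by apply: measurable_funS mk => // s [].
- by move=> s _; exact: k0.
move=> l l0; set r := distrib mu _ k l.
have [->|] := eqVneq r +oo; first by rewrite leey.
rewrite -ltey -ge0_fin_numE ?distrib_ge0// => /fineK rE.
have r0 : (0 <= fine r)%R by rewrite fine_ge0// distrib_ge0.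
apply/lee_addgt0Pr => e e0; rewrite -rE -EFinD.
rewrite -[leRHS]lebesgue_line_below ?lee_fin ?addr_ge0// ?(ltW e0)//.
apply: le_measure; rewrite ?inE.
- apply: measurable_superlevel; first exact: measurable_line_belowe.
  by apply: measurable_funS mw => [|s []//]; exact: measurable_halfline.
- exact: measurable_line_belowe.
move=> s [[Hs /= sg] lw]; split => //=; rewrite lte_fin ltNge; apply/negP => res.
have s0 := (halflineP s).1 Hs.
have [q] : exists q : rat, ratr q \in `]fine r, s[.
  by apply: rat_in_itvoo; apply: lt_le_trans res; rewrite ltrDl.
rewrite in_itv/= => /andP[rq qs].
have q0 : (0 < ratr q :> R)%R by exact: le_lt_trans rq.
have [_ BD _ _ /(_ y (ltW y0))] := PB _ q0.
rewrite min_l; last by apply: ltW; apply: lt_trans sg; rewrite lte_fin.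
move=> qB; have : (ratr q)%:E <= r.
  apply: le_trans qB _; apply: le_measure; rewrite ?inE.
  - by apply: measurableI; [exact: measurable_superlevel|have [] := PB _ q0].
  - apply: measurable_superlevel; first exact: measurable_superlevel.
    by apply: measurable_funS mk => // ? [].
  - move=> x [[Dx yg] Bq]; split => //=; rewrite gee0_abs//.
    have : [set x | l%:E < k x] x; last by [].
    rewrite kP ?ltW//; exists q => //=; split => //.
    rewrite (gee0_abs (w0 _ s0)) in lw; apply: lt_le_trans lw _.
    by apply: nw => //; exact: ltW.
by rewrite -rE lee_fin leNgt rq.
Qed.

End sharp.

(** * Fatou properties and associate functionals *)

(** For v >= 0, the inequality v <= liminf u, stated through finite levels. *)
Definition eventually_above (R : realType) (v : \bar R) (u : nat -> \bar R) :=
  forall y : R, (0 <= y)%R -> y%:E < v -> exists n, forall j, (n <= j)%N -> y%:E < u j.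

Lemma cvg_eventually_above (R : realType) (v : \bar R) (u : nat -> \bar R) :
  u @ \oo --> v -> eventually_above v u.
Proof.
move=> uv y y0 yv; have : nbhs v [set z | y%:E < z].
  apply: open_nbhs_nbhs; split => //; exact: open_ereal_gt_ereal.
by move/uv => [n _ h]; exists n => j nj; exact: h.
Qed.

Lemma lee_fin_lbound (R : realType) (x y : \bar R) : 0 <= y ->
  (forall l : R, (0 <= l)%R -> l%:E < x -> l%:E <= y) -> x <= y.
Proof.
move=> y0 h; apply: lee_fin_ubound => // l l0 yl; rewrite leNgt; apply/negP => lx.
have ylE : y = l%:E by apply/eqP; rewrite eq_le yl h.
have [k lk kx] : exists2 k : R, (l < k)%R & k%:E < x.
  case: x lx {h} => [r| |] //; last by move=> _; exists (l + 1)%R; rewrite ?ltrDl// ltry.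
  by rewrite lte_fin => lr; exists ((l + r) / 2)%R; rewrite ?lte_fin ?midf_lt.
have := h k (le_trans l0 (ltW lk)) kx.
by rewrite ylE lee_fin leNgt lk.
Qed.

Lemma eventually_above_mule (R : realType) (c v : \bar R) (u : nat -> \bar R) :
  0 <= c -> (forall j, 0 <= u j) -> eventually_above v u ->
  eventually_above (c * v) (fun j => c * u j).
Proof.
move=> c0 u0 vu y y0; have [v0|v0] := leP v 0.
  by move=> ycv; have := lt_le_trans ycv (mule_ge0_le0 c0 v0); rewrite lte_fin ltNge y0.
case: c c0 => [c| |] // c0; last first.
  move=> _; have [n h] := vu 0%R (lexx _) v0; exists n => j nj.
  by rewrite gt0_mulye ?ltry// h.
move: c0; rewrite lee_fin le_eqVlt => /orP[/eqP <-|c0].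
  by rewrite mul0e lte_fin ltNge y0.
move=> ycv; have /vu : (c^-1 * y)%:E < v by rewrite EFinM lte_pdivrMl.
have cy0 : (0 <= c^-1 * y)%R by rewrite mulr_ge0// invr_ge0 ltW.
move=> /(_ cy0)[n h]; exists n => j /h; rewrite EFinM lte_pdivrMl//.
Qed.

Section fatou.
Context (R : realType) (d : measure_display) (T : measurableType d).
Variables (mu : {measure set T -> \bar R}) (D : set T).
Hypothesis mD : measurable D.

(** Fatou's lemma, of which only the inequality h <= liminf hj is the input. *)
Lemma integral_eventually_above_le (h : T -> \bar R) (hj : nat -> T -> \bar R) c :
  measurable_fun D h -> (forall j, measurable_fun D (hj j)) ->
  (forall x, D x -> 0 <= h x) -> (forall j x, D x -> 0 <= hj j x) ->
  {ae mu, forall x, D x -> eventually_above (h x) (hj ^~ x)} ->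
  (forall j, \int[mu]_(x in D) hj j x <= c) -> \int[mu]_(x in D) h x <= c.
Proof.
move=> mh mhj h0 hj0 [N [mN N0 hN]] hc.
pose L x := limn_einf (hj ^~ x).
have L0 x : D x -> 0 <= L x.
  move=> Dx; rewrite /L limn_einf_lim; apply: lime_ge; first exact: is_cvg_einfs.
  apply: nearW => n; apply: le_ereal_inf_tmp => _ [k _ <-]; exact: hj0.
have mL : measurable_fun D L.
  apply: (@measurableT_comp _ _ _ _ _ _ (@oppe R)) => //.
  apply: (measurable_fun_limn_esup (f := fun j x => - hj j x)) => j.
  exact: measurableT_comp.
apply: (@le_trans _ _ (\int[mu]_(x in D) L x)).
  apply: ae_ge0_le_integral; [exact: mD|exact: h0|exact: mh|exact: L0|exact: mL|].
  exists N; split => // x /= xN; apply: hN => /= Dxh; apply: xN => Dx.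
  apply: lee_fin_lbound => [|l l0 lh]; first exact: L0.
  have [n hn] := Dxh Dx l l0 lh.
  rewrite /L limn_einf_lim (cvg_lim _ (@cvg_einfs_sup _ _))//.
  apply: (@le_trans _ _ (einfs (hj ^~ x) n)); last by apply: ereal_sup_ubound; exists n.
  by apply: le_ereal_inf_tmp => _ [k /= nk <-]; exact/ltW/hn.
apply: le_trans (fatou mu mD mhj hj0) _.
rewrite limn_einf_lim; apply: lime_le; first exact: is_cvg_einfs.
by apply: nearW => n; apply: ge_ereal_inf; exists (\int[mu]_(x in D) hj n x) => //; exists n => /=.
Qed.

Lemma distrib_eventually_above_le (h : T -> \bar R) (hj : nat -> T -> \bar R) (l : R) c :
  measurable_fun D h -> (forall j, measurable_fun D (hj j)) -> (0 <= l)%R ->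
  {ae mu, forall x, D x -> eventually_above `|h x| (fun j => `|hj j x|)} ->
  (forall j, distrib mu D (hj j) l <= c) -> distrib mu D h l <= c.
Proof.
move=> mh mhj l0 hN hc.
pose K (f : T -> \bar R) : set T := D `&` [set x | l%:E < `|f x|].
have ind (f : T -> \bar R) : measurable_fun D f ->
    \int[mu]_(x in D) (\1_(K f) x)%:E = distrib mu D f l.
  move=> mf; rewrite integral_indic//; last exact: measurable_superlevel.
  by congr (mu _); rewrite /K setIAC setIid.
have mind (f : T -> \bar R) : measurable_fun D f ->
    measurable_fun D (fun x => (\1_(K f) x)%:E : \bar R).
  by move=> mf; apply/measurable_EFinP; apply: measurable_indic; exact: measurable_superlevel.
rewrite -(ind _ mh); apply: (@integral_eventually_above_le _
   (fun j x => (\1_(K (hj j)) x)%:E)) => //.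
- exact: mind.
- by move=> j; exact: mind.
- case: hN => N [mN N0 hN]; exists N; split => // x /= xN; apply: hN => /= H.
  apply: xN => Dx y y0; rewrite !indicE.
  have [/set_mem[_ /= lh]|_] := boolP (x \in _); last by rewrite lte_fin ltNge y0.
  move=> y1; have [n hn] := H Dx l l0 lh; exists n => j nj.
  by rewrite indicE mem_set//; split => //=; exact: hn.
- by move=> j; rewrite ind.
Qed.

Lemma rearr_eventually_above_le (h : T -> \bar R) (hj : nat -> T -> \bar R) t c :
  measurable_fun D h -> (forall j, measurable_fun D (hj j)) ->
  {ae mu, forall x, D x -> eventually_above `|h x| (fun j => `|hj j x|)} ->
  (forall j, rearr mu D (hj j) t <= c) -> rearr mu D h t <= c.
Proof.
move=> mh mhj hN hc; apply: lee_fin_ubound => [|l l0 cl].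
  by apply: le_trans (hc 0%N); exact: rearr_ge0.
apply/rearr_leP => //; apply: (distrib_eventually_above_le mh mhj l0 hN) => j.
by apply/(rearr_leP mu mD _ _ l0) => //; apply: le_trans (hc j) cl.
Qed.

Lemma rearr_eventually_above (h : T -> \bar R) (hj : nat -> T -> \bar R) t :
  measurable_fun D h -> (forall j, measurable_fun D (hj j)) ->
  {ae mu, forall x, D x -> eventually_above `|h x| (fun j => `|hj j x|)} ->
  eventually_above (rearr mu D h t) (fun j => rearr mu D (hj j) t).
Proof.
move=> mh mhj hN y y0 yh; apply: contrapT => nh.
have hn n : exists j, (n <= j)%N /\ rearr mu D (hj j) t <= y%:E.
  apply: contrapT => hc; apply: nh; exists n => j nj; rewrite ltNge; apply/negP => h'.
  by apply: hc; exists j.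
have [p Pp] := choice hn.
have : rearr mu D h t <= y%:E; last by rewrite leNgt yh.
apply: (@rearr_eventually_above_le _ (fun n => hj (p n))) => //.
  apply: filterS hN => x hx Dx l l0 lh; have [n hn'] := hx Dx l l0 lh.
  by exists n => j nj; apply: hn'; apply: leq_trans nj _; case: (Pp j).
by move=> n; case: (Pp n).
Qed.

End fatou.

Section mplus.
Context (R : realType) (d : measure_display) (T : measurableType d).
Variable D : set T.
Hypothesis mD : measurable D.
Implicit Types f g : T -> \bar R.

Lemma Mplus0 : Mplus D (fun _ : T => 0 : \bar R).
Proof. by split; [exact: measurable_cst|move=> x _]. Qed.

Lemma MplusD f g : Mplus D f -> Mplus D g -> Mplus D (fun x => f x + g x).
Proof.
move=> [mf f0] [mg g0]; split; first exact: emeasurable_funD.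
by move=> x Dx; rewrite adde_ge0 ?f0 ?g0.
Qed.

Lemma MplusM f g : Mplus D f -> Mplus D g -> Mplus D (fun x => f x * g x).
Proof.
move=> [mf f0] [mg g0]; split; first exact: emeasurable_funM.
by move=> x Dx; rewrite mule_ge0 ?f0 ?g0.
Qed.

Lemma MplusZ (l : R) f : (0 <= l)%R -> Mplus D f -> Mplus D (fun x => l%:E * f x).
Proof.
move=> l0 [mf f0]; split; first exact: emeasurable_funM.
by move=> x Dx; rewrite mule_ge0 ?f0 ?lee_fin.
Qed.

Lemma Mplus_indic (E : set T) : measurable E -> Mplus D (fun x => (\1_E x)%:E : \bar R).
Proof.
move=> mE; split; last by move=> x _; rewrite lee_fin.
by apply/measurable_EFinP; exact: measurable_indic.
Qed.

Lemma Mplus_abs f : Mfun D f -> Mplus D (fun x => `|f x|).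
Proof. by move=> mf; split; [exact: measurableT_comp|move=> x _; exact: abse_ge0]. Qed.

End mplus.
#[global] Hint Resolve Mplus0 : core.

Section sharp_supremum.
Context (R : realType) (d : measure_display) (T : measurableType d).
Variables (mu : {sigma_finite_measure set T -> \bar R}) (D : set T) (V : T -> R).
Hypotheses (mD : measurable D) (UV : uniformizes mu D V).
Local Notation H := (halfline R).

(** The integral of w g^* is the supremum of the integrals of k g over all k with
    k^* <= w: exhaust g by its truncations to sets of finite measure. *)
Lemma integral_rearr_le_sup (w : R -> \bar R) (g : T -> \bar R) c :
  nonincreasing_on_pos w -> (forall s, (0 < s)%R -> 0 <= w s) -> Mplus D g ->
  (forall k, Mplus D k -> (forall t, (0 < t)%R -> rearr mu D k t <= w t) ->
    \int[mu]_(x in D) (k x * g x) <= c) ->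
  \int[lebesgue_line R]_(s in H) (w s * rearr mu D g s) <= c.
Proof.
move=> nw w0 Mg kgc; have [mg g0] := Mg.
pose B (j : nat) : set T := D `&` [set x | (V x)%:E < j%:R%:E].
pose gj (j : nat) x := g x * (\1_(B j) x)%:E.
have mB (j : nat) : measurable (B j) by exact: (measurable_unif_belowe mD UV).
have Mgj j : Mplus D (gj j) by apply: MplusM => //; exact: Mplus_indic.
have gjg j x : D x -> gj j x <= g x.
  move=> Dx; rewrite /gj -[leRHS]mule1; apply: lee_wpmul2l; first exact: g0.
  by rewrite lee_fin indicE lern1 leq_b1.
have mw := measurable_nonincreasing_line nw.
have mr (k : T -> \bar R) : measurable_fun H (rearr mu D k : line R -> \bar R).
  exact: measurable_rearr.
apply: (@integral_eventually_above_le _ _ _ (lebesgue_line R) H _ _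
   (fun j s => w s * rearr mu D (gj j) s)).
- exact: measurable_halfline.
- by apply: emeasurable_funM; [exact: mw|exact: mr].
- by move=> j; apply: emeasurable_funM; [exact: mw|exact: mr].
- by move=> s /halflineP/w0 ws; rewrite mule_ge0// rearr_ge0.
- by move=> j s /halflineP/w0 ws; rewrite mule_ge0// rearr_ge0.
- apply: aeW => s /halflineP/w0 ws; apply: eventually_above_mule => //.
    by move=> j; exact: rearr_ge0.
  apply: rearr_eventually_above => //; first by move=> j; case: (Mgj j).
  apply: aeW => x Dx y y0; rewrite gee0_abs ?g0// => yg.
  exists (Num.bound (V x)).+1 => j nj; rewrite gee0_abs; last by case: (Mgj j) => _; exact.
  rewrite /gj indicE mem_set ?mule1//; split => //=; rewrite lte_fin.
  apply: lt_le_trans (archi_boundP _) _; first exact/ltW/(unif_gt0 UV Dx).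
  by rewrite ler_nat ltnW.
move=> j; have [mgj gj0] := Mgj j.
have gjfin : distrib mu D (gj j) 0 < +oo.
  apply: (@le_lt_trans _ _ (mu (B j))); last first.
    by rewrite (unif_belowe mD UV) ?lee_fin// ltry.
  apply: le_measure; rewrite ?inE//; first exact: measurable_superlevel.
  move=> x [Dx /=]; rewrite /gj indicE; case: (boolP (x \in _)) => [/set_mem//|_].
  by rewrite mule0 abse0 ltxx.
have [k [Mk kw kgj]] := hardy_littlewood_sharp mD UV mgj gj0 gjfin nw w0.
apply: le_trans kgj _; apply: le_trans (kgc k Mk kw).
have [mkg kg0] := MplusM Mk (Mgj j); have [mkg' kg'0] := MplusM Mk Mg.
apply: ge0_le_integral => // x Dx; apply: lee_wpmul2l; last exact: gjg.
by case: Mk => _; exact.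
Qed.

End sharp_supremum.

Section ri_theory.
Context (R : realType) (d : measure_display) (T : measurableType d).
Variables (mu : {sigma_finite_measure set T -> \bar R}) (D : set T) (V : T -> R).
Hypotheses (mD : measurable D) (UV : uniformizes mu D V).
Variable rho : (T -> \bar R) -> \bar R.
Hypothesis rho_ri : is_ri_norm mu D rho.
Implicit Types f g : T -> \bar R.
Local Notation H := (halfline R).
Local Notation rho' := (associate mu D rho).

Lemma ri0 : rho (fun _ => 0) = 0.
Proof. by apply/(ri_eq0 rho_ri); [exact: Mplus0|exact: aeW]. Qed.

Lemma ri_le f g : Mplus D f -> Mplus D g -> (forall x, D x -> f x <= g x) ->
  rho f <= rho g.
Proof. by move=> Mf Mg fg; apply: (ri_lattice rho_ri) => //; exact: aeW. Qed.

Lemma Mplus_comp (u : R -> \bar R) : nonincreasing_on_pos u ->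
  (forall s, (0 < s)%R -> 0 <= u s) -> Mplus D (u \o V).
Proof.
move=> nu u0; split; first exact: (measurable_nonincreasing_comp mD UV nu).
by move=> x Dx; exact/u0/(unif_gt0 UV Dx).
Qed.

(** Rearrangement invariance only identifies equimeasurable functions; composing the
    rearrangements with V makes them comparable pointwise. *)
Lemma ri_le_rearr f g : Mplus D f -> Mplus D g ->
  (forall t, (0 < t)%R -> rearr mu D f t <= rearr mu D g t) -> rho f <= rho g.
Proof.
move=> Mf Mg fg.
have M k : Mplus D (rearr mu D k \o V).
  apply: Mplus_comp; first exact: nonincreasing_rearr.
  by move=> s _; exact: rearr_ge0.
have E k : Mplus D k -> rho (rearr mu D k \o V) = rho k.
  move=> Mk; apply: (ri_rearr rho_ri) => // t t0; apply: eq_rearr => //.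
  - by have [] := M k.
  - by case: Mk.
  - by move=> l l0; apply: distrib_rearr_comp => //; case: Mk.
rewrite -(E f)// -(E g)//; apply: ri_le => // x Dx; exact/fg/(unif_gt0 UV Dx).
Qed.

Lemma assoc_ge0 g : 0 <= rho' g.
Proof.
apply: ereal_sup_ubound; exists (fun _ => 0).
  by split; [exact: Mplus0|rewrite ri0 lee01].
by rewrite integral0_eq// => x _; rewrite mul0e.
Qed.

Lemma assoc_holder (C : R) f g : (0 < C)%R -> Mplus D f -> Mplus D g ->
  rho f <= C%:E -> \int[mu]_(x in D) (f x * g x) <= C%:E * rho' g.
Proof.
move=> C0 Mf Mg fC; have iC0 : (0 <= C^-1)%R by rewrite invr_ge0 ltW.
have [mf f0] := Mf; have [mg g0] := Mg.
have : \int[mu]_(x in D) ((C^-1%:E * f x) * g x) <= rho' g.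
  apply: ereal_sup_ubound; exists (fun x => C^-1%:E * f x) => //.
  split; first exact: MplusZ.
  by rewrite (ri_homogeneous rho_ri)// lee_pdivrMl// mule1.
under eq_integral do rewrite -muleA.
have [mfg fg0] := MplusM Mf Mg.
by rewrite ge0_integralZl_EFin// lee_pdivrMl.
Qed.

Lemma assoc_le g g' : Mplus D g -> Mplus D g' ->
  {ae mu, forall x, D x -> g x <= g' x} -> rho' g <= rho' g'.
Proof.
move=> Mg Mg' gg'; apply: ge_ereal_sup => _ [f [Mf f1] <-].
apply: le_ereal_sup_tmp; exists (\int[mu]_(x in D) (f x * g' x)); first by exists f.
have [mfg fg0] := MplusM Mf Mg; have [mfg' fg'0] := MplusM Mf Mg'.
apply: ae_ge0_le_integral => //.
apply: filterS gg' => x h Dx; apply: lee_wpmul2l; last exact: h.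
by case: Mf => _; exact.
Qed.

Lemma assoc_eventually_above_le g (gj : nat -> T -> \bar R) c :
  Mplus D g -> (forall j, Mplus D (gj j)) ->
  {ae mu, forall x, D x -> eventually_above (g x) (gj ^~ x)} ->
  (forall j, rho' (gj j) <= c) -> rho' g <= c.
Proof.
move=> Mg Mgj gjg gc; apply: ge_ereal_sup => _ [f [Mf f1] <-].
have [mfg fg0] := MplusM Mf Mg.
apply: (@integral_eventually_above_le _ _ _ mu D mD _ (fun j x => f x * gj j x)) => //.
- by move=> j; case: (MplusM Mf (Mgj j)).
- by move=> j; case: (MplusM Mf (Mgj j)).
- apply: filterS gjg => x h Dx; have [_ /(_ _ Dx) fx0] := Mf.
  move=> y y0 /(eventually_above_mule fx0 _ (h Dx)) []//; first by move=> j; case: (Mgj j) => _; exact.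
  by move=> n hn; exists n.
- move=> j; apply: le_trans (gc j); apply: ereal_sup_ubound; by exists f.
Qed.

(** The sharp Hardy-Littlewood inequality turns the integral of f g into that of
    f^* g^*, so that the associate norm only sees the rearrangement of g. *)
Lemma assoc_le_rearr g g' : Mplus D g -> Mplus D g' ->
  (forall t, (0 < t)%R -> rearr mu D g t <= rearr mu D g' t) -> rho' g <= rho' g'.
Proof.
move=> [mg g0] Mg' gg'; have [mg' g'0] := Mg'.
apply: ge_ereal_sup => _ [f [Mf f1] <-]; have [mf f0] := Mf.
apply: (le_trans (hardy_littlewood mu mD mf mg f0 g0)).
apply: (@le_trans _ _ (\int[lebesgue_line R]_(s in H) (rearr mu D f s * rearr mu D g' s))).
  apply: (@le_integral_halfline _ (fun s => rearr mu D f s * rearr mu D g s)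
    (fun s => rearr mu D f s * rearr mu D g' s)).
  - by apply: emeasurable_funM; exact: measurable_rearr.
  - by apply: emeasurable_funM; exact: measurable_rearr.
  - by move=> s _; rewrite mule_ge0// rearr_ge0.
  - by move=> s s0; apply: lee_wpmul2l; [exact: rearr_ge0|exact: gg'].
apply: (integral_rearr_le_sup mD UV) => //.
- exact: nonincreasing_rearr.
- by move=> s _; exact: rearr_ge0.
move=> k Mk kf; apply: ereal_sup_ubound; exists k => //; split => //.
by apply: le_trans f1; exact: ri_le_rearr.
Qed.

End ri_theory.

(** * The associate functional is a rearrangement-invariant norm *)

Section ae_integral.
Context (R : realType) (d : measure_display) (T : measurableType d).
Variables (mu : {measure set T -> \bar R}) (D : set T).
Hypothesis mD : measurable D.

Lemma ge0_integral_eq0 (E : set T) (f : T -> \bar R) : measurable E -> measurable_fun E f ->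
  (forall x, E x -> 0 <= f x) -> \int[mu]_(x in E) f x = 0 ->
  {ae mu, forall x, E x -> f x = 0}.
Proof.
move=> mE mf f0 int0; apply/(ae_eq_integral_abs mu mE mf).
by rewrite -int0; apply: eq_integral => x /set_mem Ex; rewrite gee0_abs ?f0.
Qed.

Lemma ge0_integral_ae0 (f : T -> \bar R) : measurable_fun D f ->
  {ae mu, forall x, D x -> f x = 0} -> \int[mu]_(x in D) f x = 0.
Proof.
move=> mf f0; rewrite (ae_eq_integral (cst 0))//.
by rewrite integral0_eq.
Qed.

Lemma ae_exhaust (E : nat -> set T) (P : T -> Prop) : D `<=` \bigcup_j E j ->
  (forall j : nat, {ae mu, forall x, E j x -> P x}) -> {ae mu, forall x, D x -> P x}.
Proof.
move=> DE /ae_foralln h; apply: filterS h => x h Dx; have [j _ Ej] := DE _ Dx.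
exact: (h j).
Qed.

End ae_integral.

Section associate_norm.
Context (R : realType) (d : measure_display) (T : measurableType d).
Variables (mu : {sigma_finite_measure set T -> \bar R}) (D : set T) (V : T -> R).
Hypotheses (mD : measurable D) (UV : uniformizes mu D V).
Variable rho : (T -> \bar R) -> \bar R.
Hypothesis rho_ri : is_ri_norm mu D rho.
Implicit Types f g : T -> \bar R.
Local Notation H := (halfline R).
Local Notation rho' := (associate mu D rho).

Lemma unif_exhaust : D `<=` \bigcup_j (D `&` [set x | (V x)%:E < j%:R%:E]).
Proof.
move=> x Dx; exists (Num.bound (V x)) => //; split => //=.
by rewrite lte_fin archi_boundP// ltW// (unif_gt0 UV).
Qed.

Lemma integral_indic_mul (E : set T) f : measurable E -> E `<=` D ->
  \int[mu]_(x in D) (f x * (\1_E x)%:E) = \int[mu]_(x in E) f x.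
Proof.
move=> mE ED; rewrite -[in RHS](setIidr ED) integral_mkcondr.
by apply: eq_integral => x _; rewrite patchE indicE; case: (x \in E);
  rewrite ?mule1 ?mule0.
Qed.

Lemma assoc_integral (E : set T) : measurable E -> E `<=` D -> mu E < +oo ->
  exists C : R, (0 < C)%R /\
    forall g, Mplus D g -> \int[mu]_(x in E) g x <= C%:E * rho' g.
Proof.
move=> mE ED muE; have rE := ri_finite rho_ri mE ED muE.
have ME : Mplus D (fun x => (\1_E x)%:E : \bar R) by exact: Mplus_indic.
have rE0 := ri_ge0 rho_ri ME.
have rEfin : rho (fun x => (\1_E x)%:E) \is a fin_num by rewrite ge0_fin_numE.
pose C := (fine (rho (fun x => (\1_E x)%:E)) + 1)%R.
have C0 : (0 < C)%R by rewrite ltr_wpDl// fine_ge0.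
exists C; split => // g Mg; rewrite -(integral_indic_mul _ mE ED).
under eq_integral do rewrite muleC.
by apply: assoc_holder => //; rewrite /C EFinD fineK// leeDl.
Qed.

Lemma assoc_eq0 g : Mplus D g -> rho' g = 0 <-> {ae mu, forall x, D x -> g x = 0}.
Proof.
move=> Mg; have [mg g0] := Mg; split => [rg|g_0]; last first.
  apply/eqP; rewrite eq_le assoc_ge0 // andbT; apply: ge_ereal_sup => _ [f [Mf f1] <-].
  rewrite ge0_integral_ae0//; first by case: (MplusM Mf Mg).
  by apply: filterS g_0 => x h Dx; rewrite h// mule0.
apply: (ae_exhaust unif_exhaust) => j.
set E := D `&` _; have mE : measurable E by exact: (measurable_unif_belowe mD UV).
have ED : E `<=` D by move=> x [].
have muE : mu E < +oo by rewrite (unif_belowe mD UV) ?lee_fin// ltry.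
have [C [C0 hC]] := assoc_integral mE ED muE.
apply: ge0_integral_eq0 => //; first exact: measurable_funS mg.
  by move=> x /ED/g0.
apply/eqP; rewrite eq_le; apply/andP; split.
  by have := hC _ Mg; rewrite rg mule0.
by apply: integral_ge0 => x /ED/g0.
Qed.

Lemma assoc_homogeneous (l : R) g : (0 <= l)%R -> Mplus D g ->
  rho' (fun x => l%:E * g x) = l%:E * rho' g.
Proof.
move=> l0 Mg; have MZ (k : R) : (0 <= k)%R -> Mplus D (fun x => k%:E * g x).
  by move=> k0; exact: MplusZ.
have key f (k : R) : (0 <= k)%R -> Mplus D f ->
    \int[mu]_(x in D) (f x * (k%:E * g x)) = k%:E * \int[mu]_(x in D) (f x * g x).
  move=> k0 Mf; have [mfg fg0] := MplusM Mf Mg.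
  rewrite -ge0_integralZl_EFin//; apply: eq_integral => x _.
  by rewrite muleCA.
move: l0; rewrite le_eqVlt => /orP[/eqP <-|l0].
  rewrite mul0e; apply/(assoc_eq0 (MZ _ (lexx _))); apply: aeW => x _.
  by rewrite mul0e.
rewrite /associate -ereal_sup_pZl//; congr ereal_sup; apply/seteqP; split => y.
  move=> [f [Mf f1] <-]; exists (\int[mu]_(x in D) (f x * g x)); first by exists f.
  by rewrite key// ltW.
by move=> [_ [f [Mf f1] <-] <-]; exists f => //; rewrite key// ltW.
Qed.

Lemma assoc_triangle f g : Mplus D f -> Mplus D g ->
  rho' (fun x => f x + g x) <= rho' f + rho' g.
Proof.
move=> Mf Mg; apply: ge_ereal_sup => _ [k [Mk k1] <-].
have [mkf kf0] := MplusM Mk Mf; have [mkg kg0] := MplusM Mk Mg.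
have -> : \int[mu]_(x in D) (k x * (f x + g x)) =
    \int[mu]_(x in D) (k x * f x) + \int[mu]_(x in D) (k x * g x).
  rewrite -ge0_integralD//; apply: eq_integral => x /set_mem Dx.
  by rewrite ge0_muleDr//; [case: Mf => _; exact|case: Mg => _; exact].
by apply: leeD; apply: ereal_sup_ubound; exists k.
Qed.

Lemma nondecreasing_sup_cvg (u : nat -> \bar R) l : nondecreasing_seq u ->
  (forall j, u j <= l) -> (forall c, (forall j, u j <= c) -> l <= c) ->
  u @ \oo --> l.
Proof.
move=> ndu ul lmin; have := ereal_nondecreasing_cvgn ndu.
suff -> : ereal_sup (range u) = l by [].
apply/eqP; rewrite eq_le; apply/andP; split.
  by apply: ge_ereal_sup => _ [j _ <-].
by apply: lmin => j; apply: ereal_sup_ubound; exists j.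
Qed.

Lemma ae_nondecreasing_le (fj : nat -> T -> \bar R) f :
  {ae mu, forall x, D x ->
      nondecreasing_seq (fun j => fj j x) /\ fj j x @[j --> \oo] --> f x} ->
  (forall i j, (i <= j)%N -> {ae mu, forall x, D x -> fj i x <= fj j x}) /\
  (forall j, {ae mu, forall x, D x -> fj j x <= f x}) /\
  {ae mu, forall x, D x -> eventually_above (f x) (fj ^~ x)}.
Proof.
move=> h; split; last split.
- by move=> i j ij; apply: filterS h => x h Dx; have [nd _] := h Dx; exact: nd.
- move=> j; apply: filterS h => x h Dx; have [nd fc] := h Dx.
  rewrite -(cvg_lim _ fc)//; apply: lime_ge; first by apply/cvg_ex; exists (f x).
  by exists j => // n /= jn; exact: nd.
- apply: filterS h => x h Dx; have [nd fc] := h Dx.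
  exact: cvg_eventually_above.
Qed.

Lemma assoc_fatou (fj : nat -> T -> \bar R) f :
  (forall j, Mplus D (fj j)) -> Mplus D f ->
  {ae mu, forall x, D x ->
      nondecreasing_seq (fun j => fj j x) /\ fj j x @[j --> \oo] --> f x} ->
  nondecreasing_seq (fun j => rho' (fj j)) /\ rho' (fj j) @[j --> \oo] --> rho' f.
Proof.
move=> Mfj Mf /ae_nondecreasing_le[h1 [h2 h3]].
have nd : nondecreasing_seq (fun j => rho' (fj j)).
  by move=> i j ij; apply: assoc_le => //; exact: h1.
split => //; apply: nondecreasing_sup_cvg => //.
  by move=> j; apply: assoc_le => //; exact: h2.
by move=> c hc; exact: (assoc_eventually_above_le mD Mf Mfj h3 hc).
Qed.

Lemma assoc_finite (E : set T) : measurable E -> E `<=` D -> mu E < +oo ->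
  rho' (fun x => (\1_E x)%:E) < +oo.
Proof.
move=> mE ED muE; have [C [C0 hC]] := ri_integral rho_ri mE ED muE.
apply: le_lt_trans (ltry C); apply: ge_ereal_sup => _ [f [Mf f1] <-].
rewrite integral_indic_mul//; apply: le_trans (hC _ Mf) _.
by rewrite -[leRHS]mule1; apply: lee_wpmul2l => //; rewrite lee_fin ltW.
Qed.

(** Most properties of the associate functional are inherited from the pairing; the
    local properties of the norm and of its associate (finiteness on indicators and
    local integrability) exchange their roles. *)
Theorem associate_ri_norm : is_ri_norm mu D rho'.
Proof.
split.
- by move=> f _; exact: assoc_ge0.
- exact: assoc_eq0.
- exact: assoc_homogeneous.
- exact: assoc_triangle.
- by move=> f g; exact: assoc_le.
- exact: assoc_fatou.
- exact: assoc_finite.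
- exact: assoc_integral.
- move=> f g Mf Mg fg; apply/eqP; rewrite eq_le; apply/andP; split;
    by apply: (assoc_le_rearr mD UV rho_ri) => // t t0; rewrite fg.
Qed.

End associate_norm.

(** * Reflexivity of the norm *)

Section ri_lsc.
Context (R : realType) (d : measure_display) (T : measurableType d).
Variables (mu : {sigma_finite_measure set T -> \bar R}) (D : set T).
Hypotheses (mD : measurable D).
Variable rho : (T -> \bar R) -> \bar R.
Hypothesis rho_ri : is_ri_norm mu D rho.

(** Lower semicontinuity: apply the Fatou property to the infima of the tails. *)
Lemma ri_eventually_above_le (h : T -> \bar R) (hj : nat -> T -> \bar R) c :
  Mplus D h -> (forall j, Mplus D (hj j)) ->
  {ae mu, forall x, D x -> eventually_above (h x) (hj ^~ x)} ->
  (forall j, rho (hj j) <= c) -> rho h <= c.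
Proof.
move=> Mh Mhj hN hc.
pose L n x := einfs (hj ^~ x) n.
have L0 n x : D x -> 0 <= L n x.
  by move=> Dx; apply: le_ereal_inf_tmp => _ [k _ <-]; case: (Mhj k) => _; exact.
have ML n : Mplus D (L n).
  split; last exact: L0.
  by apply: measurable_fun_einfs => k; case: (Mhj k).
pose K n x := mine (h x) (L n x).
have MK n : Mplus D (K n).
  split; first by apply: measurable_mine; [case: Mh|case: (ML n)].
  by move=> x Dx; rewrite le_min L0// andbT; case: Mh => _; exact.
have [_ cvgK] : nondecreasing_seq (fun n => rho (K n)) /\ rho (K n) @[n --> \oo] --> rho h.
  apply: (ri_fatou rho_ri) => //; apply: filterS hN => x hx Dx.
  have ndK : nondecreasing_seq (fun n => K n x).
    move=> m n mn; rewrite /K le_min ge_min lexx /=.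
    by rewrite ge_min orbC (nondecreasing_einfs (hj ^~ x) mn).
  split => //; apply: nondecreasing_sup_cvg => //.
    by move=> j; rewrite /K ge_min lexx.
  move=> c' Kc'; have c'0 : 0 <= c'.
    by apply: le_trans (Kc' 0%N); case: (MK 0%N) => _; exact.
  apply: lee_fin_lbound => // l l0 lh; have [n hn] := hx Dx l l0 lh.
  apply: le_trans (Kc' n); rewrite /K le_min ltW//=.
  by apply: le_ereal_inf_tmp => _ [k /= nk <-]; exact/ltW/hn.
rewrite -(cvg_lim _ cvgK)//; apply: lime_le; first by apply/cvg_ex; exists (rho h).
apply: nearW => n; apply: le_trans (hc n); apply: (ri_le rho_ri) => // x Dx.
by rewrite /K ge_min; apply/orP; right; apply: ereal_inf_lbound; exists n => /=.
Qed.

End ri_lsc.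

Section projection.
Context (R : realType) (d : measure_display) (T : measurableType d).
Variables (mu : {sigma_finite_measure set T -> \bar R}) (D E : set T).
Hypotheses (mD : measurable D) (mE : measurable E) (ED : E `<=` D) (muE : mu E < +oo).
Variable rho : (T -> \bar R) -> \bar R.
Hypothesis rho_ri : is_ri_norm mu D rho.
Local Open Scope ring_scope.
Variables (f : T -> R) (M : R).
Hypotheses (mf : measurable_fun D f) (fM : forall x, 0 <= f x <= M).

Let bd (g : T -> R) := measurable_fun D g /\ exists N : R, forall x, `|g x| <= N.

Let I (g : T -> R) : R := \int[mu]_(x in E) g x.

Let bd_int g : bd g -> mu.-integrable E (EFin \o g).
Proof.
move=> [mg [N gN]]; apply: measurable_bounded_integrable => //.
  exact: measurable_funS mg.
exists N; split; first exact: num_real.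
by move=> y Ny x _; apply: le_trans (gN x) (ltW Ny).
Qed.

Let bdD g h : bd g -> bd h -> bd (fun x => g x + h x).
Proof.
move=> [mg [N gN]] [mh [N' hN']]; split; first exact: measurable_funD.
by exists (N + N') => x; apply: le_trans (ler_normD _ _) (lerD _ _).
Qed.

Let bdM g h : bd g -> bd h -> bd (fun x => g x * h x).
Proof.
move=> [mg [N gN]] [mh [N' hN']]; split; first exact: measurable_funM.
by exists (N * N') => x; rewrite normrM ler_pM.
Qed.

Let bdc (c : R) : bd (fun=> c).
Proof. by split => //; exists `|c|. Qed.

Let bdZ c g : bd g -> bd (fun x => c * g x).
Proof. by move=> bg; apply: bdM. Qed.

Let bdB g h : bd g -> bd h -> bd (fun x => g x - h x).
Proof.
move=> bg bh; have := bdD bg (bdZ (-1) bh).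
by under eq_fun do rewrite mulN1r.
Qed.

Let bdX2 g : bd g -> bd (fun x => g x ^+ 2).
Proof. by move=> bg; under eq_fun do rewrite expr2; exact: bdM. Qed.

Let ID g h : bd g -> bd h -> I (fun x => g x + h x) = I g + I h.
Proof. by move=> bg bh; apply: RintegralD => //; exact: bd_int. Qed.

Let IZ c g : bd g -> I (fun x => c * g x) = c * I g.
Proof. by move=> bg; apply: RintegralZl => //; exact: bd_int. Qed.

Let I_le g h : bd g -> bd h -> (forall x, E x -> g x <= h x) -> I g <= I h.
Proof. by move=> bg bh gh; apply: le_Rintegral => //; exact: bd_int. Qed.

Let I_ge0 g : (forall x, 0 <= g x) -> 0 <= I g.
Proof. by move=> g0; apply: Rintegral_ge0. Qed.

Let EI g : bd g -> (I g)%:E = (\int[mu]_(x in E) (g x)%:E)%E.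
Proof. by move=> /bd_int ig; rewrite /I /Rintegral fineK//; exact: integrable_fin_num. Qed.

Let bf : bd f.
Proof.
by split => //; exists M => x; have /andP[f0 ?] := fM x; rewrite ger0_norm.
Qed.

Let S (g : T -> R) := [/\ measurable_fun D g, exists N, forall x, 0 <= g x <= N,
  forall x, ~ E x -> g x = 0 & (rho (EFin \o g) <= 1)%E].

Let bS g : S g -> bd g.
Proof.
move=> [mg [N gN] _ _]; split => //; exists N => x.
by have /andP[g0 ?] := gN x; rewrite ger0_norm.
Qed.

Let MS g : S g -> Mplus D (EFin \o g).
Proof.
move=> [mg [N gN] _ _]; split; first exact/measurable_EFinP.
by move=> x _ /=; rewrite lee_fin; have /andP[] := gN x.
Qed.

Let S0 : S (fun=> 0).
Proof.
split => //; first by exists 0 => x; rewrite lexx.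
by rewrite (ri0 rho_ri) lee01.
Qed.

Let S_convex t g h : 0 <= t <= 1 -> S g -> S h -> S (fun x => (1 - t) * g x + t * h x).
Proof.
move=> /andP[t0 t1] Sg Sh; have t1' : 0 <= 1 - t by rewrite subr_ge0.
have [mg [N gN] gE g1] := Sg; have [mh [N' hN'] hE h1] := Sh; split.
- by apply: measurable_funD; apply: measurable_funM.
- exists ((1 - t) * N + t * N') => x.
  have /andP[g0 gN1] := gN x; have /andP[h0 hN1] := hN' x.
  by rewrite addr_ge0 ?mulr_ge0//= lerD// ler_wpM2l.
- by move=> x Ex; rewrite gE// hE// !mulr0 addr0.
- have -> : EFin \o (fun x => (1 - t) * g x + t * h x) =
     (fun x => ((1 - t)%:E * (EFin \o g) x + t%:E * (EFin \o h) x)%E) by [].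
  have Mg := MS Sg; have Mh := MS Sh.
  apply: le_trans (ri_triangle rho_ri (MplusZ t1' Mg) (MplusZ t0 Mh)) _.
  rewrite !(ri_homogeneous rho_ri)//.
  apply: (@le_trans _ _ ((1 - t)%:E * 1 + t%:E * 1)%E).
    by apply: leeD; apply: lee_wpmul2l => //; rewrite lee_fin.
  by rewrite !mule1 -EFinD subrK.
Qed.

Let S_min g N : 0 <= N -> S g -> S (fun x => Num.min (g x) N).
Proof.
move=> N0 Sg; have [mg [N' gN] gE g1] := Sg; split.
- exact: measurable_minr.
- by exists N => x; have /andP[g0 _] := gN x; rewrite le_min g0 N0 ge_min lexx orbT.
- by move=> x Ex; rewrite gE// min_l.
- apply: le_trans g1; apply: (ri_le rho_ri); [|exact: MS|].
    split; first by apply/measurable_EFinP; exact: measurable_minr.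
    by move=> x _; rewrite lee_fin le_min N0 andbT; have /andP[] := gN x.
  by move=> x _ /=; rewrite lee_fin ge_min lexx.
Qed.

(** The squared distance to f in L^2, to be minimized over S. *)
Let J g := I (fun x => (f x - g x) ^+ 2).

Let bJ g : S g -> bd (fun x => (f x - g x) ^+ 2).
Proof. by move=> /bS bg; apply: bdX2; exact: bdB. Qed.

Let J_min g : S g -> J (fun x => Num.min (g x) M) <= J g.
Proof.
move=> Sg; have /andP[f0 f1] := fM point; have M0 := le_trans f0 f1.
apply: I_le; [exact/bJ/S_min|exact: bJ|move=> x _].
have /andP[fx0 fx1] := fM x.
have [gM|Mg] := leP (g x) M; first by [].
nra.
Qed.

Let midpoint (g h : T -> R) := fun x : T => (1 - 2^-1) * g x + 2^-1 * h x.

Let parallelogram g h : S g -> S h ->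
  I (fun x => (g x - h x) ^+ 2) = 2 * J g + 2 * J h - 4 * J (midpoint g h).
Proof.
move=> Sg Sh; have Sm : S (midpoint g h) by apply: S_convex => //; lra.
have bg := bS Sg; have bh := bS Sh.
have b2 : bd (fun x => (g x - h x) ^+ 2) by apply: bdX2; exact: bdB.
have : I (fun x => (g x - h x) ^+ 2 + 4 * (f x - midpoint g h x) ^+ 2) =
    I (fun x => 2 * (f x - g x) ^+ 2 + 2 * (f x - h x) ^+ 2).
  congr (I _); apply/funext => x; by rewrite /midpoint; field.
have := ID b2 (bdZ 4 (bJ Sm)); have := ID (bdZ 2 (bJ Sg)) (bdZ 2 (bJ Sh)).
rewrite (IZ 4 (bJ Sm)) (IZ 2 (bJ Sg)) (IZ 2 (bJ Sh)) => e2 e1 e0.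
have {e0 e1 e2} := etrans (esym e1) (etrans e0 e2).
rewrite -/(J g) -/(J h) -/(J (midpoint g h)); lra.
Qed.

Let d0 := inf [set J g | g in S].

Let hlb : has_lbound [set J g | g in S].
Proof. by exists 0 => _ [g _ <-]; apply: I_ge0 => x; exact: sqr_ge0. Qed.

Let d0_le g : S g -> d0 <= J g.
Proof. by move=> Sg; apply: ge_inf => //; exists g. Qed.

Let minimizing : exists g : nat -> T -> R, forall k,
  [/\ S (g k), forall x : T, 0 <= g k x <= M & J (g k) <= d0 + 4^-1 ^+ k].
Proof.
have /andP[f0 f1] := fM point; have M0 := le_trans f0 f1.
have h k : exists g : T -> R, [/\ S g, forall x : T, 0 <= g x <= M & J g <= d0 + 4^-1 ^+ k].
  have k0 : (0 : R) < 4^-1 ^+ k by rewrite exprn_gt0.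
  have hi : has_inf [set J g | g in S].
    by split => //; exists (J (fun=> 0)); exists (fun=> 0).
  have [_ [g Sg <-] gk] := inf_adherent k0 hi.
  exists (fun x => Num.min (g x) M); split; first exact: S_min.
    move=> x; have [_ [N gN] _ _] := Sg; have /andP[g0 _] := gN x.
    by rewrite le_min g0 M0 ge_min lexx orbT.
  by apply: le_trans (J_min Sg) (ltW gk).
by have [g gP] := choice h; exists g.
Qed.

(** A minimizing sequence converges almost everywhere: by the parallelogram law
    its successive differences are summable. *)
Let minimizing_cvg (g : nat -> T -> R) :
  (forall k, S (g k) /\ J (g k) <= d0 + 4^-1 ^+ k) ->
  {ae mu, forall x, E x -> cvgn (g ^~ x)}.
Proof.
move=> gP; pose D_ k x := `|g k.+1 x - g k x|.
have bD k : bd (fun x => g k.+1 x - g k x) by apply: bdB; [have [] := gP k.+1|have [] := gP k] => /bS.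
have bD2 := fun k => bdX2 (bD k).
have bDa k : bd (D_ k).
  have [mD' [N hN]] := bD k; split; first exact: measurableT_comp.
  by exists N => x; rewrite /D_ normr_id.
pose m := fine (mu E); have m0 : 0 <= m by rewrite fine_ge0.
have D2 k : I (fun x => (g k.+1 x - g k x) ^+ 2) <= 4 * 4^-1 ^+ k.
  have [Sg Jg] := gP k; have [Sg' Jg'] := gP k.+1.
  have Sm : S (midpoint (g k.+1) (g k)).
    by apply: (@S_convex 2^-1) => //; lra.
  have := d0_le Sm; rewrite parallelogram//.
  have : 4^-1 ^+ k.+1 <= 4^-1 ^+ k :> R.
    by rewrite exprS ler_piMl ?exprn_ge0// invf_le1//; lra.
  lra.
(* Integrate 2 z <= a^-1 + a z^2 with a = 2^k. *)
have D1 k : I (D_ k) <= (m + 4) / 2 ^+ k.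
  have k0 : 0 < 2 ^+ k :> R by rewrite exprn_gt0.
  have bR : bd (fun x => 2^-1 ^+ k * 1 + 2 ^+ k * (g k.+1 x - g k x) ^+ 2).
    exact: bdD (bdZ _ (bdc 1)) (bdZ _ (bD2 k)).
  apply: (@le_trans _ _ (I (fun x => 2^-1 ^+ k * 1 + 2 ^+ k * (g k.+1 x - g k x) ^+ 2))).
    apply: I_le => // x _; rewrite /D_ mulr1 exprVn -[X in _ * X]real_normK ?num_real//.
    move: k0; set z := `|_|; set a := 2 ^+ k => a0.
    have z0 : 0 <= z by exact: normr_ge0.
    have : 0 <= a^-1 * (a * z - 1) ^+ 2 by rewrite mulr_ge0 ?sqr_ge0// invr_ge0 ltW.
    have -> : a^-1 * (a * z - 1) ^+ 2 = a * z ^+ 2 - 2 * z + a^-1.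
      by field; rewrite gt_eqF.
    lra.
  have := ID (bdZ (2^-1 ^+ k) (bdc 1)) (bdZ (2 ^+ k) (bD2 k)).
  rewrite (IZ _ (bdc 1)) (IZ _ (bD2 k)) => /= ->.
  have -> : I (fun=> 1) = m by rewrite /I Rintegral_cst// mul1r.
  have : 2 ^+ k * I (fun x => (g k.+1 x - g k x) ^+ 2) <= 4 / 2 ^+ k.
    apply: (@le_trans _ _ (2 ^+ k * (4 * 4^-1 ^+ k))); first by rewrite ler_pM2l.
    rewrite mulrCA; apply: ler_wpM2l => //.
    have -> : 4^-1 = 2^-1 * 2^-1 :> R by lra.
    by rewrite exprMn mulrA -exprMn divff// expr1n mul1r exprVn.
  by move=> h; rewrite exprVn mulrDl [X in X + _]mulrC; exact: lerD (lexx _) h.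
have sumfin : (\int[mu]_(x in E) \sum_(k <oo) (D_ k x)%:E < +oo)%E.
  rewrite integral_nneseries//; last 2 first.
  - by move=> k; apply/measurable_EFinP; apply: measurable_funS (bDa k).1.
  - by move=> k x _; rewrite lee_fin normr_ge0.
  apply: (@le_lt_trans _ _ (\sum_(k <oo) ((m + 4) * 2 / (2 ^ (k + 0.+1))%:R)%:E)%E).
    apply: lee_nneseries => [k _ _|k _].
      by apply: integral_ge0 => x _; rewrite lee_fin normr_ge0.
    rewrite -EI// lee_fin (le_trans (D1 k))// addn1 expnS natrM natrX.
    by rewrite invfM mulrA mulfK ?pnatr_eq0.
  by rewrite (cvg_lim _ (@cvg_geometric_eseries_half R _ 0%N))// ltry.
have intsum : mu.-integrable E (fun x => \sum_(k <oo) (D_ k x)%:E)%E.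
  apply/integrableP; split.
    apply: ge0_emeasurable_sum => k.
      by move=> x _ _; rewrite lee_fin normr_ge0.
    by move=> _; apply/measurable_EFinP; apply: measurable_funS (bDa k).1.
  rewrite (eq_integral (fun x => \sum_(k <oo) (D_ k x)%:E)%E)// => x _.
  by rewrite gee0_abs//; apply: nneseries_ge0 => k _ _; rewrite lee_fin normr_ge0.
have := integrable_ae mE intsum; apply: filterS => x h /h {}h.
have cvgD : cvgn (series (fun k => D_ k x)).
  apply: nnseries_is_cvg; first by move=> k; exact: normr_ge0.
  by move: h; rewrite ge0_fin_numE//; apply: nneseries_ge0 => k _ _; rewrite lee_fin normr_ge0.
have cvgT : cvgn (series (telescope (g ^~ x))) by apply: normed_cvg.
rewrite (_ : g ^~ x = fun n => g 0%N x + series (telescope (g ^~ x)) n).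
  by apply: is_cvgD => //; exact: is_cvg_cst.
by apply/funext => n; rewrite telescopeK /= addrC subrK.
Qed.

(** The limit of a minimizing sequence belongs to S by lower semicontinuity of rho. *)
Let minimizer : exists g0, S g0 /\ forall g, S g -> J g0 <= J g.
Proof.
have [g gP] := minimizing.
have gcvg := minimizing_cvg (fun k => let: And3 a _ c := gP k in conj a c).
pose L x := limn_einf (fun k => (g k x)%:E).
have M0 : 0 <= M by have /andP[f0 f1] := fM point; exact: le_trans f0 f1.
have gM k x : (0 <= (g k x)%:E <= M%:E)%E by have [_ /(_ x) + _] := gP k; rewrite !lee_fin.
have L0 x : (0 <= L x <= M%:E)%E.
  rewrite /L limn_einf_lim; apply/andP; split.
    apply: lime_ge; first exact: is_cvg_einfs.
    by apply: nearW => n; apply: le_ereal_inf_tmp => _ [k _ <-]; case/andP: (gM k x).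
  apply: lime_le; first exact: is_cvg_einfs.
  apply: nearW => n; apply: ge_ereal_inf; exists (g n x)%:E; first by exists n => /=.
  by case/andP: (gM n x).
pose g0 x := fine (L x).
have LE x : (g0 x)%:E = L x.
  rewrite fineK// ge0_fin_numE; last by case/andP: (L0 x).
  by case/andP: (L0 x) => _ /le_lt_trans; apply; rewrite ltry.
have mL : measurable_fun D L.
  apply: (@measurableT_comp _ _ _ _ _ _ (@oppe R)) => //.
  apply: (measurable_fun_limn_esup (f := fun j x => (- (g j x)%:E)%E)) => j.
  apply: (@measurableT_comp _ _ _ _ _ _ (@oppe R)) => //; apply/measurable_EFinP.
  by have [[]] := gP j.
have mg0 : measurable_fun D g0 by apply: measurableT_comp.
have g0cvg : {ae mu, forall x, E x -> g k x @[k --> \oo] --> g0 x}.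
  apply: filterS gcvg => x h /h {}h.
  have hE : (g k x)%:E @[k --> \oo] --> (limn (g ^~ x))%:E.
    by apply: cvg_EFin; [exact: nearW|exact: h].
  suff -> : g0 x = limn (g ^~ x) by [].
  by rewrite /g0 /L is_cvg_limn_einfE ?(cvg_lim _ hE)//; apply/cvg_ex; exists (limn (g ^~ x))%:E.
have gE x : ~ E x -> g0 x = 0.
  move=> Ex; rewrite /g0 /L (_ : (fun k => (g k x)%:E) = cst 0%E).
    by have [-> _] := @cvg_limn_einf_sup R (cst 0%E) 0%E (cvg_cst _).
  by apply/funext => k; have [[_ _ + _]] := gP k; move=> ->.
have Sg0 : S g0.
  split => //.
    by exists M => x; rewrite -!lee_fin LE.
  apply: (ri_eventually_above_le rho_ri (hj := fun k => EFin \o g k)).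
  - by split; [exact/measurable_EFinP|move=> x _ /=; rewrite LE; case/andP: (L0 x)].
  - by move=> k; have [Sk _ _] := gP k; exact: MS.
  - apply: filterS g0cvg => x h Dx; have [Ex|Ex] := pselect (E x).
      by apply: cvg_eventually_above; apply: cvg_EFin; [exact: nearW|exact: h].
    by move=> y y0 /=; rewrite gE// lte_fin ltNge y0.
  - by move=> k; have [[]] := gP k.
exists g0; split => // h Sh; apply: le_trans (d0_le Sh).
apply/ler_addgt0Pr => e e0.
have [n ne] : exists n, 4^-1 ^+ n <= e.
  have c4 : (4^-1 : R) ^+ n @[n --> \oo] --> 0 by apply: cvg_expr; rewrite ger0_norm; lra.
  have /cvgr0Pnorm_le/(_ _ e0) [n _ /(_ n (leqnn n))] := c4.
  by rewrite ger0_norm ?exprn_ge0//; exists n.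
apply: (@le_trans _ _ (d0 + 4^-1 ^+ n)); last by rewrite lerD2l.
rewrite -lee_fin EI; last exact: bJ.
apply: (@integral_eventually_above_le _ _ _ mu E mE _ (fun k x => ((f x - g (k + n)%N x) ^+ 2)%:E)).
- by apply/measurable_EFinP; apply: measurable_funS (bJ Sg0).1.
- move=> k; have [Sk _ _] := gP (k + n)%N; apply/measurable_EFinP.
  by apply: measurable_funS (bJ Sk).1.
- by move=> x _; rewrite lee_fin sqr_ge0.
- by move=> k x _; rewrite lee_fin sqr_ge0.
- apply: filterS g0cvg => x hx Ex; apply: cvg_eventually_above; apply: cvg_EFin; first exact: nearW.
  rewrite (_ : _ \o _ = fun k => (f x - g (k + n)%N x) ^+ 2)//.
  under eq_fun do rewrite expr2; rewrite expr2.
  have c1 : f x - g (k + n)%N x @[k --> \oo] --> f x - g0 x.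
    by apply: cvgB; [exact: cvg_cst|rewrite (cvg_shiftn n (g ^~ x)); exact: hx].
  exact: cvgM.
- move=> k; have [Sk _ Jk] := gP (k + n)%N.
  rewrite -EI; last exact: bJ.
  rewrite lee_fin (le_trans Jk)// lerD2l exprD ler_piMl ?exprn_ge0// exprn_ile1//; lra.
Qed.

(** The first-order condition at g0 along the segments of the convex set S. *)
Let variational g0 : S g0 -> (forall g, S g -> J g0 <= J g) ->
  forall g, S g -> I (fun x => (f x - g0 x) * g x) <= I (fun x => (f x - g0 x) * g0 x).
Proof.
move=> Sg0 mg0 g Sg; have b0 := bS Sg0; have bg := bS Sg.
pose A := I (fun x => (f x - g0 x) * (g x - g0 x)).
pose B := I (fun x => (g x - g0 x) ^+ 2).
have bA : bd (fun x => (f x - g0 x) * (g x - g0 x)) by apply: bdM; apply: bdB.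
have bB : bd (fun x => (g x - g0 x) ^+ 2) by apply: bdX2; apply: bdB.
have B0 : 0 <= B by apply: I_ge0 => x; exact: sqr_ge0.
have quad t : 0 <= t <= 1 -> 2 * t * A <= t ^+ 2 * B.
  move=> t01; have Jt := mg0 _ (S_convex t01 Sg0 Sg).
  have := ID (bJ Sg0) (bdD (bdZ (- (2 * t)) bA) (bdZ (t ^+ 2) bB)).
  have := ID (bdZ (- (2 * t)) bA) (bdZ (t ^+ 2) bB).
  rewrite (IZ _ bA) (IZ _ bB) => /= e1; rewrite e1 => e2.
  move: Jt; rewrite /J -/(J g0).
  have -> : (fun x => (f x - ((1 - t) * g0 x + t * g x)) ^+ 2) =
     (fun x => (f x - g0 x) ^+ 2 + (- (2 * t) * ((f x - g0 x) * (g x - g0 x)) +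
        t ^+ 2 * (g x - g0 x) ^+ 2)).
    by apply/funext => x; ring.
  rewrite e2 -/(J g0) -/A -/B; lra.
have A0 : A <= 0.
  rewrite leNgt; apply/negP => A0; pose s := A + B + 1.
  have s0 : 0 < s by rewrite /s; lra.
  have t1 : 0 <= A / s <= 1.
    by rewrite divr_ge0 ?ler_pdivrMr ?mul1r ?ltW//= /s; lra.
  have := quad _ t1; rewrite leNgt => /negP; apply.
  have As : 0 < A / s by rewrite divr_gt0.
  rewrite expr2 -subr_gt0.
  have -> : 2 * (A / s) * A - A / s * (A / s) * B = (A / s) * (A / s) * (2 * s - B).
    by field; rewrite gt_eqF.
  by apply: mulr_gt0; [exact: mulr_gt0|rewrite /s; lra].
have -> : I (fun x => (f x - g0 x) * g x) = A + I (fun x => (f x - g0 x) * g0 x).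
  rewrite -ID//; last by apply: bdM => //; exact: bdB.
  by congr (I _); apply/funext => x; ring.
by rewrite gerDr.
Qed.

(** If rho f > 1, the projection g0 of f onto the unit ball of rho in L^2 gives
    the functional f - g0, whose positive part separates f from the ball. *)
Lemma bounded_le_bidual : is_ri_norm mu D (associate mu D rho) ->
  (forall x, ~ E x -> f x = 0) ->
  (associate mu D (associate mu D rho) (EFin \o f) <= 1)%E ->
  (rho (EFin \o f) <= 1)%E.
Proof.
move=> rho'_ri fE f1; rewrite leNgt; apply/negP => f_gt1.
have [g0 [Sg0 min_g0]] := minimizer.
have b0 := bS Sg0; have bphi : bd (fun x => f x - g0 x) by exact: bdB.
have var := variational Sg0 min_g0.
set a := I (fun x => (f x - g0 x) * g0 x) in var.
have a0 : 0 <= a.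
  have := var _ S0; rewrite (_ : I _ = 0)//.
  by rewrite /I (_ : (fun x => _) = fun=> 0) ?Rintegral_cst ?mul0r//;
    apply/funext => x; rewrite mulr0.
have Mf : Mplus D (EFin \o f).
  split; first exact/measurable_EFinP.
  by move=> x _ /=; rewrite lee_fin; case/andP: (fM x).
have J0 : 0 < J g0.
  rewrite lt_neqAle I_ge0 ?andbT//; last by move=> x; exact: sqr_ge0.
  apply/eqP => J0.
  have : (\int[mu]_(x in E) ((f x - g0 x) ^+ 2)%:E = 0)%E.
    by rewrite -EI; [rewrite -/(J g0) -J0|exact: bJ].
  move/(ge0_integral_eq0 mE) => h.
  have {}h : {ae mu, forall x, E x -> ((f x - g0 x) ^+ 2)%:E = 0%E}.
    apply: h; first by apply/measurable_EFinP; apply: measurable_funS (bJ Sg0).1.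
    by move=> x _; rewrite lee_fin sqr_ge0.
  move: f_gt1; apply/negP; rewrite -leNgt; have [_ _ g0E] := Sg0; apply: le_trans.
  apply: (ri_lattice rho_ri) => //; first exact: MS.
  apply: filterS h => x hx Dx /=; have [Ex|Ex] := pselect (E x); last by rewrite fE ?g0E.
  have /eqP := hx Ex; rewrite eqe sqrf_eq0 subr_eq0 => /eqP ->; exact: lexx.
pose psi x := (Num.max (f x - g0 x) 0 * \1_E x)%:E.
have mmax : measurable_fun D (fun x => Num.max (f x - g0 x) 0).
  by apply: measurable_maxr => //; exact: bphi.1.
have psi0 x : (0 <= psi x)%E.
  by rewrite lee_fin mulr_ge0// le_max lexx orbT.
have Mpsi : Mplus D psi.
  split; last by move=> x _.
  by apply/measurable_EFinP; apply: measurable_funM => //; exact: measurable_indic.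
have psi_a : (associate mu D rho psi <= a%:E)%E.
  apply: ge_ereal_sup => _ [k [Mk k1] <-]; have [mk k0] := Mk.
  pose kj (j : nat) x := mine (k x) j%:R%:E.
  have mkj j : measurable_fun D (kj j) by apply: measurable_mine.
  have kj0 j x : D x -> (0 <= kj j x)%E by move=> Dx; rewrite le_min k0//= lee_fin.
  have kjfin j x : D x -> kj j x \is a fin_num.
    move=> Dx; rewrite ge0_fin_numE ?kj0//; apply: le_lt_trans (ltry j%:R).
    by rewrite ge_min lexx orbT.
  have [mkp kp0] := MplusM Mk Mpsi.
  have Mkj j : Mplus D (kj j) by split; [exact: mkj|exact: kj0].
  apply: (@integral_eventually_above_le _ _ _ mu D mD _ (fun j x => kj j x * psi x)%E) => //.
  - by move=> j; case: (MplusM (Mkj j) Mpsi).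
  - by move=> j; case: (MplusM (Mkj j) Mpsi).
  - apply: aeW => x Dx.
    have : eventually_above (psi x * k x)%E (fun j => psi x * kj j x)%E.
      apply: eventually_above_mule => [//|j|]; first exact: kj0.
      move=> y y0 yk; exists (Num.bound y).+1 => j nj; rewrite lt_min yk/= lte_fin.
      by apply: lt_le_trans (archi_boundP y0) _; rewrite ler_nat ltnW.
    by rewrite muleC; under eq_fun do rewrite muleC.
  move=> j; pose F : set T := E `&` [set x | 0 < f x - g0 x].
  have mF : measurable F.
    have -> : F = E `&` (D `&` [set x | (0 < (f x - g0 x)%:E)%E]).
      by apply/seteqP; split => x [Ex]; [move=> h; split => //; split => //; exact: ED|case].
    apply: measurableI => //; apply: emeasurable_fun_o_infty => //.
    by apply/measurable_EFinP; exact: bphi.1.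
  pose kappa x := fine (kj j x) * \1_F x.
  have Skappa : S kappa.
    split.
    - apply: measurable_funM; last exact: measurable_indic.
      by apply: measurableT_comp.
    - exists j%:R => x; rewrite /kappa indicE.
      have [/set_mem[/ED Dx _]|_] := boolP (x \in F); last by rewrite mulr0 lexx ler0n.
      by rewrite mulr1 fine_ge0 ?kj0//= -lee_fin fineK ?kjfin// ge_min lexx orbT.
    - by move=> x Ex; rewrite /kappa indicE memNset ?mulr0// => -[].
    - apply: le_trans k1; apply: (ri_le rho_ri) => //.
        split.
          apply/measurable_EFinP; apply: measurable_funM; last exact: measurable_indic.
          by apply: measurableT_comp.
        by move=> x Dx; rewrite lee_fin mulr_ge0// fine_ge0// kj0.
      move=> x Dx /=; rewrite /kappa indicE; case: (x \in F); last by rewrite mulr0 k0.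
      by rewrite mulr1 fineK ?kjfin// ge_min lexx.
  have -> : (\int[mu]_(x in D) (kj j x * psi x) =
      \int[mu]_(x in D) (((f x - g0 x) * kappa x)%:E * (\1_E x)%:E))%E.
    apply: eq_integral => x /set_mem Dx; rewrite -(fineK (kjfin j x Dx)) /psi /kappa -!EFinM.
    congr EFin; rewrite !indicE.
    have [Ex|Ex] := boolP (x \in E); last by rewrite !mulr0.
    have [Fx|Fx] := boolP (x \in F).
      have [_ /= /ltW h] := set_mem Fx.
      by rewrite max_l//; ring.
    rewrite max_r ?mul0r ?mulr0 ?mul0r// leNgt; apply/negP => h; move/negP: Fx; apply.
    by apply/mem_set; split => //; exact: set_mem.
  rewrite integral_indic_mul// -EI ?lee_fin; last by apply: bdM => //; exact: bS.
  exact: var.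
have C0 : 0 < a + J g0 / 2 by lra.
have psiC : (associate mu D rho psi <= (a + J g0 / 2)%:E)%E.
  by apply: le_trans psi_a _; rewrite lee_fin; lra.
have := assoc_holder mD rho'_ri C0 Mpsi Mf psiC.
have bm : bd (fun x => Num.max (f x - g0 x) 0 * f x).
  apply: bdM => //; split => //; have [_ [N hN]] := bphi; exists N => x.
  have N0 := le_trans (normr_ge0 _) (hN x).
  by have [_|_] := leP (f x - g0 x) 0; rewrite ?normr0.
have -> : (\int[mu]_(x in D) (psi x * (EFin \o f) x) =
    \int[mu]_(x in D) ((Num.max (f x - g0 x) 0 * f x)%:E * (\1_E x)%:E))%E.
  by apply: eq_integral => x _; rewrite /psi /= -!EFinM mulrAC.
rewrite integral_indic_mul// -EI// leNgt => /negP; apply.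
apply: (@le_lt_trans _ _ (a + J g0 / 2)%:E).
  by rewrite -[leRHS]mule1; apply: lee_wpmul2l => //; rewrite lee_fin ltW.
rewrite lte_fin; apply: (@lt_le_trans _ _ (J g0 + a)); first by lra.
rewrite -ID; [|exact: bJ|by apply: bdM].
apply: I_le => //; first by apply: bdD; [exact: bJ|apply: bdM].
move=> x _; have /andP[f0 _] := fM x.
have : (f x - g0 x) * f x <= Num.max (f x - g0 x) 0 * f x.
  by apply: ler_wpM2r => //; rewrite le_max lexx.
apply: le_trans; rewrite le_eqVlt; apply/orP; left; apply/eqP; ring.
Qed.

End projection.

Section lorentz_luxemburg.
Context (R : realType) (d : measure_display) (T : measurableType d).
Variables (mu : {sigma_finite_measure set T -> \bar R}) (D : set T) (V : T -> R).
Hypotheses (mD : measurable D) (UV : uniformizes mu D V).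
Variable rho : (T -> \bar R) -> \bar R.
Hypothesis rho_ri : is_ri_norm mu D rho.

(** By homogeneity and the Fatou property, it suffices to bound the norm of bounded
    functions of bounded support in the unit ball of the second associate norm. *)
Theorem lorentz_luxemburg (f : T -> \bar R) : Mplus D f ->
  rho f <= associate mu D (associate mu D rho) f.
Proof.
move=> Mf; have [mf f0] := Mf.
have rho'_ri := associate_ri_norm mD UV rho_ri.
have rho''_ri := associate_ri_norm mD UV rho'_ri.
set rho'' := associate _ _ (associate _ _ _) in rho''_ri *.
apply: lee_fin_ubound => [|c c0' fc]; first exact: (ri_ge0 rho''_ri).
apply/lee_addgt0Pr => e e0; rewrite -EFinD; set c1 := (c + e)%R.
have c0 : (0 < c1)%R by rewrite /c1 ltr_wpDl.
have {}fc : rho'' f <= c1%:E by apply: le_trans fc _; rewrite lee_fin lerDl ltW.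
have ic0 : (0 <= c1^-1)%R by rewrite invr_ge0 ltW.
pose E (j : nat) : set T := D `&` [set x | (V x)%:E < j%:R%:E].
have mE j : measurable (E j) by exact: (measurable_unif_belowe mD UV).
have ED j : E j `<=` D by move=> x [].
pose fj (j : nat) x : R := (fine (mine (f x) j%:R%:E) / c1 * \1_(E j) x)%R.
have mnfin (j : nat) x : D x -> mine (f x) j%:R%:E \is a fin_num.
  move=> Dx; have h0 : 0 <= mine (f x) j%:R%:E by rewrite le_min f0//= lee_fin.
  rewrite ge0_fin_numE//; apply: le_lt_trans (ltry j%:R).
  by rewrite ge_min lexx orbT.
have mfj j : measurable_fun D (fj j).
  apply: measurable_funM; last exact: measurable_indic.
  by apply: measurable_funM => //; apply: measurableT_comp => //; exact: measurable_mine.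
have fjb j x : (0 <= fj j x <= j%:R / c1)%R.
  rewrite /fj indicE; have [/set_mem[Dx _]|_] := boolP (x \in E j); last first.
    by rewrite mulr0 lexx divr_ge0// ltW.
  have h0 : 0 <= mine (f x) j%:R%:E by rewrite le_min f0//= lee_fin.
  rewrite mulr1 mulr_ge0 ?fine_ge0//=; apply: ler_wpM2r => //.
  by rewrite -lee_fin fineK ?mnfin// ge_min lexx orbT.
have Mfj j : Mplus D (EFin \o fj j).
  by split; [exact/measurable_EFinP|move=> x _ /=; rewrite lee_fin; case/andP: (fjb j x)].
have MZf : Mplus D (fun x => c1^-1%:E * f x) by exact: MplusZ.
have fjf j x : D x -> (EFin \o fj j) x <= c1^-1%:E * f x.
  move=> Dx /=; rewrite /fj indicE; case: (x \in E j) => /=; last first.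
    by rewrite mulr0 mule_ge0 ?lee_fin ?f0.
  rewrite mulr1 mulrC EFinM fineK ?mnfin//; apply: lee_wpmul2l; first by rewrite lee_fin.
  by rewrite ge_min lexx.
have fj1 j : rho (EFin \o fj j) <= 1.
  apply: (@bounded_le_bidual _ _ _ mu D (E j) mD (mE j) (@ED j) _ rho rho_ri _ (j%:R / c1)%R) => //.
  - by rewrite (unif_belowe mD UV) ?lee_fin// ltry.
  - by move=> x Ex; rewrite /fj indicE memNset ?mulr0.
  - apply: (@le_trans _ _ (rho'' (fun x => c1^-1%:E * f x))).
      by apply: (ri_le rho''_ri) => // x Dx; exact: fjf.
    by rewrite (ri_homogeneous rho''_ri)// lee_pdivrMl// mule1.
have : rho (fun x => c1^-1%:E * f x) <= 1.
  apply: (ri_eventually_above_le rho_ri (hj := fun j => EFin \o fj j)) => //.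
  apply: aeW => x Dx.
  have : eventually_above (c1^-1%:E * f x) (fun j : nat => c1^-1%:E * mine (f x) j%:R%:E).
    apply: eventually_above_mule; first by rewrite lee_fin.
      by move=> j; rewrite le_min f0//= lee_fin.
    move=> y y0 yf; exists (Num.bound y).+1 => j nj; rewrite lt_min yf/= lte_fin.
    by apply: lt_le_trans (archi_boundP y0) _; rewrite ler_nat ltnW.
  move=> h y y0 /(h y y0)[n hn]; exists (maxn n (Num.bound (V x)).+1) => j.
  rewrite geq_max => /andP[nj bj] /=.
  rewrite /fj indicE mem_set ?mulr1; last first.
    split => //=; rewrite lte_fin; apply: lt_le_trans (archi_boundP _) _.
      exact/ltW/(unif_gt0 UV Dx).
    by rewrite ler_nat ltnW.
  by rewrite mulrC EFinM fineK ?mnfin//; exact: hn.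
by rewrite (ri_homogeneous rho_ri)// lee_pdivrMl// mule1.
Qed.

End lorentz_luxemburg.

(** * Volumes of boxes *)

(** Integrating one coordinate at a time turns a weighted covering in dimension n.+1
    into one in dimension n, the width of the last side of each box being absorbed
    into its weight. *)
Lemma weighted_cover_volume (R : realType) n : forall (a b : nat -> R)
    (al bl : nat -> nat -> R) (w : nat -> R) (v : R),
  (forall i, (i < n)%N -> (a i <= b i)%R) ->
  (forall k i, (al k i <= bl k i)%R) -> (forall k, (0 <= w k)%R) -> (0 <= v)%R ->
  (forall x : nat -> R, (forall i, (i < n)%N -> (a i <= x i <= b i)%R) ->
    v%:E <= \sum_(k <oo)
      (w k * \prod_(i < n) (al k i <= x i <= bl k i)%R%:R)%:E) ->
  (v * \prod_(i < n) (b i - a i))%:E <=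
    \sum_(k <oo) (w k * \prod_(i < n) (bl k i - al k i))%:E.
Proof.
elim: n => [|n IH] a b al bl w v ab albl w0 v0 cover.
  rewrite big_ord0 mulr1; have := cover (fun=> 0%R).
  by under eq_eseriesr do rewrite big_ord0; under [X in _ -> _ <= X]eq_eseriesr do
    rewrite big_ord0; exact.
have abn : (a n <= b n)%R by exact: ab.
rewrite big_ord_recr /= mulrA mulrAC.
under eq_eseriesr do rewrite big_ord_recr /= mulrA mulrAC.
apply: IH.
- by move=> i ni; apply: ab; rewrite ltnW.
- by [].
- by move=> k; rewrite mulr_ge0// subr_ge0.
- by rewrite mulr_ge0// subr_ge0.
move=> x abx.
pose c k := (w k * \prod_(i < n) (al k i <= x i <= bl k i)%R%:R)%R.
have c0 k : (0 <= c k)%R by rewrite mulr_ge0// prodr_ge0.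
pose I := (`[a n, b n]%classic : set (measurableTypeR R)).
have muI (s t : R) : (s <= t)%R -> lebesgue_measure (`[s, t]%classic : set (measurableTypeR R)) = (t - s)%:E.
  move=> st; rewrite lebesgue_measure_itv/= lte_fin; case: ltP => // ts.
  by rewrite (_ : t = s) ?subrr//; apply/eqP; rewrite eq_le ts st.
have -> : (v * (b n - a n))%:E = \int[lebesgue_measure]_(y in I) v%:E.
  by rewrite integral_cst; [rewrite EFinM -(muI _ _ abn)|exact: measurable_itv].
apply: (@le_trans _ _ (\int[lebesgue_measure]_(y in I)
   \sum_(k <oo) (c k * \1_(`[al k n, bl k n]%classic : set (measurableTypeR R)) y)%:E)).
  apply: ge0_le_integral.
  - exact: measurable_itv.
  - by move=> y _; rewrite lee_fin.
  - exact: measurable_cst.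
  - apply: ge0_emeasurable_sum => k *; first by rewrite lee_fin mulr_ge0.
    by apply/measurable_EFinP; apply: measurable_funM => //; exact: measurable_indic.
  - move=> y Iy; pose x' i := if i == n then y else x i.
    have x'i (i : 'I_n) : x' i = x i by rewrite /x' ltn_eqF.
    have x'n : x' n = y by rewrite /x' eqxx.
    have := cover x'; under eq_eseriesr => k _.
      rewrite big_ord_recr/= x'n; under eq_bigr do rewrite x'i.
      rewrite mulrA -/(c k); over.
    move=> h; apply: le_trans (h _) _ => [i|].
      rewrite ltnS leq_eqVlt => /orP[/eqP ->|ni]; first by rewrite x'n; move: Iy; rewrite /I /= in_itv.
      by rewrite /x' ltn_eqF// abx.
    by rewrite le_eqVlt; apply/orP; left; apply/eqP; apply: eq_eseriesr => k _;
      rewrite indicE mem_setE in_itv.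
rewrite integral_nneseries//; last 2 first.
- by move=> k; apply/measurable_EFinP; apply: measurable_funM => //; exact: measurable_indic.
- by move=> k y _; rewrite lee_fin mulr_ge0.
apply: lee_nneseries => [k _ _|k _].
  by apply: integral_ge0 => y _; rewrite lee_fin mulr_ge0.
under eq_integral do rewrite EFinM.
have mI : measurable I by exact: measurable_itv.
rewrite (ge0_integralZl_EFin _ mI)//; last first.
- by apply/measurable_EFinP; exact: measurable_indic.
rewrite integral_indic//.
rewrite -mulrA [X in (_ <= (_ * X)%:E)]mulrC mulrA -/(c k) EFinM.
apply: lee_wpmul2l; first by rewrite lee_fin.
rewrite -(muI _ _ (albl k n)); apply: le_measure; rewrite ?inE//.
  exact: measurableI.
exact: measurable_itv.
Qed.

Section box_measure.
Context (R : realType) (n : nat).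
Implicit Types a b : 'rV[R]_n.

(** A box covers itself; conversely, the indicators of a covering sum up to at least
    1 on the box, which is what the weighted estimate needs. *)
Lemma lebesgue_box a b : (forall i, (a ord0 i <= b ord0 i)%R) ->
  lebesgue_Rn R n (box a b) = (\prod_(i < n) (b ord0 i - a ord0 i))%:E.
Proof.
move=> ab; apply/eqP; rewrite eq_le; apply/andP; split.
  have abF k : [set k | k = 0%N] k -> forall i, (a ord0 i <= b ord0 i)%R by [].
  apply: ge_ereal_inf; exists (\prod_(i < n) (b ord0 i - a ord0 i))%:E => //.
  exists (@BoxFamily R n [set k | k = 0%N] (fun=> a) (fun=> b) abF).
    by move=> x bx; exists 0%N.
  rewrite /bf_volume /= (_ : [set k | k = 0%N] = [set 0%N])// esum_set1//.
  by rewrite lee_fin prodr_ge0// => i _; rewrite subr_ge0.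
apply: le_ereal_inf_tmp => _ [F cF <-].
pose co (x : 'rV[R]_n) (i : nat) : R := if insub i is Some j then x ord0 j else 0%R.
have coE x (i : 'I_n) : co x i = x ord0 i.
  rewrite /co; case: insubP => [j _ ji|]; last by rewrite ltn_ord.
  by congr (x ord0 _); exact: val_inj.
pose w k : R := (k \in bf_index F)%:R.
pose al k := if k \in bf_index F then co (bf_low F k) else fun=> 0%R.
pose bl k := if k \in bf_index F then co (bf_high F k) else fun=> 0%R.
have := @weighted_cover_volume R n (co a) (co b) al bl w 1.
rewrite mul1r; under eq_bigr do rewrite !coE.
have -> : \sum_(k <oo) (w k * \prod_(i < n) (bl k i - al k i))%:E = bf_volume F.
  rewrite nneseries_esumT; last first.
    move=> k; rewrite lee_fin mulr_ge0// /al /bl; case: ifPn => [/set_mem Fk|_]; last first.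
      by apply: prodr_ge0 => i _; rewrite subrr.
    by apply: prodr_ge0 => i _; rewrite !coE subr_ge0 bf_le.
  rewrite /bf_volume [RHS]esum_mkcond; apply: eq_esum => k _.
  rewrite /w /al /bl; case: ifPn => [Fk|_]; last by rewrite mul0r.
  by rewrite mul1r; under eq_bigr do rewrite !coE.
apply.
- by move=> i ni; rewrite -[i]/(val (Ordinal ni)) !coE.
- move=> k i; rewrite /al /bl; case: ifPn => // /set_mem Fk; rewrite /co.
  by case: insubP => // j _ _; exact: bf_le.
- by move=> k; rewrite /w ler0n.
- exact: ler01.
move=> x abx; pose X : 'rV[R]_n := \row_i x i.
have /cF[k Fk bX] : box a b X.
  by move=> i; rewrite mxE -!coE; exact: abx.
apply: (@le_trans _ _ (w k * \prod_(i < n) (al k i <= x i <= bl k i)%R%:R)%:E).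
  rewrite /w /al /bl mem_set// mul1r big1//= => i _.
  by have := bX i; rewrite !coE mxE => ->.
rewrite nneseries_esumT; last by move=> j; rewrite lee_fin mulr_ge0// prodr_ge0.
rewrite -(@esum_set1 _ _ k (fun k => (w k * \prod_(i < n) (al k i <= x i <= bl k i)%R%:R)%:E));
  last by rewrite lee_fin mulr_ge0// prodr_ge0.
rewrite esum_mkcond; apply: le_esum => j _; case: ifPn => // _.
by rewrite lee_fin mulr_ge0// prodr_ge0.
Qed.

End box_measure.

(** * Cubes and the radial map on R^n *)

Section halfspaces.
Context (R : realType) (n : nat).

Lemma lebesgue_Rn_le (A B : set (Rn R n)) : A `<=` B ->
  lebesgue_Rn R n A <= lebesgue_Rn R n B.
Proof. exact: le_outer_measure. Qed.

(** Each box of a covering is cut by the hyperplane into at most two boxes, whose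
    volumes add up to that of the original box. *)
Lemma measurable_halfspace (i : 'I_n) (c : R) :
  measurable ([set x | (x ord0 i <= c)%R] : set (Rn R n)).
Proof.
apply: le_caratheodory_measurable => X; apply: le_ereal_inf_tmp => _ [F XF <-].
pose lo k := bf_low F k; pose hi k := bf_high F k.
pose K1 := [set k | bf_index F k /\ (lo k ord0 i <= c)%R].
pose K2 := [set k | bf_index F k /\ (c <= hi k ord0 i)%R].
pose hi1 k : 'rV[R]_n := \row_j (if j == i then Num.min (hi k ord0 i) c else hi k ord0 j).
pose lo2 k : 'rV[R]_n := \row_j (if j == i then Num.max (lo k ord0 i) c else lo k ord0 j).
have le1 k : K1 k -> forall j, (lo k ord0 j <= hi1 k ord0 j)%R.
  move=> [Fk kc] j; rewrite mxE; case: eqP => [->|_]; last exact: bf_le.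
  by rewrite le_min kc bf_le.
have le2 k : K2 k -> forall j, (lo2 k ord0 j <= hi k ord0 j)%R.
  move=> [Fk kc] j; rewrite mxE; case: eqP => [->|_]; last exact: bf_le.
  by rewrite ge_max kc bf_le.
pose F1 := BoxFamily le1; pose F2 := BoxFamily le2.
have cov1 : X `&` [set x | (x ord0 i <= c)%R] `<=` bf_cover F1.
  move=> x [/XF[k Fk bx] /= xc]; exists k.
    by split => //; apply: le_trans xc; case/andP: (bx i).
  move=> j; rewrite mxE; case: eqP => [->|_]; last exact: bx.
  by have /andP[-> xh] := bx i; rewrite le_min xh xc.
have cov2 : X `&` ~` [set x | (x ord0 i <= c)%R] `<=` bf_cover F2.
  move=> x [/XF[k Fk bx] /= /negP]; rewrite -ltNge => xc; exists k.
    by split => //; apply: le_trans (ltW xc) _; case/andP: (bx i).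
  move=> j; rewrite mxE; case: eqP => [->|_]; last exact: bx.
  by have /andP[xl ->] := bx i; rewrite ge_max xl (ltW xc).
have v1 : lebesgue_outer (X `&` [set x | (x ord0 i <= c)%R]) <= bf_volume F1.
  by apply: ereal_inf_lbound; exists F1.
have v2 : lebesgue_outer (X `&` ~` [set x | (x ord0 i <= c)%R]) <= bf_volume F2.
  by apply: ereal_inf_lbound; exists F2.
apply: le_trans (leeD v1 v2) _.
have ge0 (a b : 'rV[R]_n) : (forall j, (a ord0 j <= b ord0 j)%R) ->
    (0 <= \prod_(j < n) (b ord0 j - a ord0 j))%R.
  by move=> ab; apply: prodr_ge0 => j _; rewrite subr_ge0.
rewrite /bf_volume /=.
have -> : K1 = bf_index F `&` K1 by apply/seteqP; split => k; [move=> h; split => //; case: h|case].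
have -> : K2 = bf_index F `&` K2 by apply/seteqP; split => k; [move=> h; split => //; case: h|case].
rewrite !esum_mkcondr -esumD; last 2 first.
- by move=> k Fk; case: ifPn => // /set_mem/le1/ge0; rewrite lee_fin.
- by move=> k Fk; case: ifPn => // /set_mem/le2/ge0; rewrite lee_fin.
apply: le_esum => k Fk; rewrite -/(lo k) -/(hi k).
have P0 : (0 <= \prod_(j < n | j != i) (hi k ord0 j - lo k ord0 j))%R.
  by apply: prodr_ge0 => j _; rewrite subr_ge0 bf_le.
have D (a b : 'rV[R]_n) : (\prod_(j < n) (b ord0 j - a ord0 j) =
    (b ord0 i - a ord0 i) * \prod_(j < n | j != i) (b ord0 j - a ord0 j))%R.
  exact: bigD1.
rewrite !D !mxE eqxx.
have e1 : (\prod_(j < n | j != i) (hi1 k ord0 j - lo k ord0 j) =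
    \prod_(j < n | j != i) (hi k ord0 j - lo k ord0 j))%R.
  by apply: eq_bigr => j /negbTE ji; rewrite mxE ji.
have e2 : (\prod_(j < n | j != i) (hi k ord0 j - lo2 k ord0 j) =
    \prod_(j < n | j != i) (hi k ord0 j - lo k ord0 j))%R.
  by apply: eq_bigr => j /negbTE ji; rewrite mxE ji.
rewrite e1 e2; set P := (\prod_(j < n | _) _)%R in P0 *.
have lh : (lo k ord0 i <= hi k ord0 i)%R by exact: bf_le.
case: ifPn => [/set_mem[_ lc]|nK1]; case: ifPn => [/set_mem[_ ch]|nK2].
- rewrite -EFinD lee_fin min_r// max_r// -mulrDl.
  by apply: ler_wpM2r => //; rewrite addrC addrA subrK.
- rewrite adde0 lee_fin; apply: ler_wpM2r => //; rewrite lerD2r.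
  by rewrite ge_min lexx.
- rewrite add0e lee_fin; apply: ler_wpM2r => //; rewrite lerD2l lerN2.
  by rewrite le_max lexx.
- by rewrite adde0 lee_fin mulr_ge0// subr_ge0.
Qed.

Lemma measurable_coord (i : 'I_n) :
  measurable_fun setT (fun x : Rn R n => (x : 'rV[R]_n) ord0 i : measurableTypeR R).
Proof.
apply: (measurability _ (RGenOInfty.measurableE R)) => _ [_ [c ->] <-].
rewrite setTI; have -> : (fun x : Rn R n => (x : 'rV[R]_n) ord0 i) @^-1` `]c, +oo[ =
    ~` ([set x | (x ord0 i <= c)%R] : set (Rn R n)).
  by apply/seteqP; split => x /=; rewrite in_itv/= andbT ltNge => /negP.
by apply: measurableC; exact: measurable_halfspace.
Qed.

Lemma measurable_box (a b : 'rV[R]_n) : measurable (box a b : set (Rn R n)).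
Proof.
have -> : box a b = \bigcap_(i in [set: 'I_n])
    ((fun x : Rn R n => (x : 'rV[R]_n) ord0 i) @^-1` `[a ord0 i, b ord0 i]).
  apply/seteqP; split => x /= h i; first by move=> _ /=; rewrite in_itv/=; exact: h.
  by have := h i I; rewrite /= in_itv.
apply: fin_bigcap_measurable; first exact: finite_finset.
move=> i _; rewrite -[X in measurable X]setTI.
by apply: measurable_coord => //; exact: measurable_itv.
Qed.

End halfspaces.

Section radial.
Context (R : realType) (n : nat).
Hypothesis n0 : (0 < n)%N.

Definition supnorm (x : Rn R n) : R := \big[Num.max/0%R]_(i < n) `|(x : 'rV[R]_n) ord0 i|%R.

Definition centered_cube (r : R) : set (Rn R n) :=
  box (const_mx (- r)%R : 'rV[R]_n) (const_mx r).

Lemma supnorm_ge0 x : (0 <= supnorm x)%R.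
Proof. by rewrite /supnorm; elim/big_ind: _ => // a b a0 b0; rewrite le_max a0. Qed.

Lemma supnorm_le x (r : R) : (0 <= r)%R -> centered_cube r x <-> (supnorm x <= r)%R.
Proof.
move=> r0; split => [h|h i].
  by apply: bigmax_le => // i _; have := h i; rewrite !mxE -ler_norml.
rewrite !mxE -ler_norml; apply: le_trans h.
by rewrite /supnorm; exact: (le_bigmax _ (fun i => `|(x : 'rV[R]_n) ord0 i|%R) i).
Qed.

Lemma measurable_centered_cube r : measurable (centered_cube r).
Proof. exact: measurable_box. Qed.

Lemma lebesgue_cube (a : 'rV[R]_n) (l : R) : (0 <= l)%R ->
  lebesgue_Rn R n (box a (a + const_mx l)%R) = (l ^+ n)%:E.
Proof.
move=> l0; rewrite lebesgue_box => [|i]; last by rewrite !mxE lerDl.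
under eq_bigr do rewrite !mxE addrAC subrr add0r.
by rewrite prodr_const card_ord.
Qed.

Lemma lebesgue_centered_cube r : (0 <= r)%R ->
  lebesgue_Rn R n (centered_cube r) = ((2 * r) ^+ n)%:E.
Proof.
move=> r0; have -> : centered_cube r =
    box (const_mx (- r)%R) (const_mx (- r)%R + const_mx (2 * r) : 'rV[R]_n)%R.
  by congr box; apply/rowP => i; rewrite !mxE mulr_natl mulr2n addrA addNr add0r.
by rewrite lebesgue_cube// mulr_ge0.
Qed.

(** Measure of the cube centred at the origin with x on its boundary; the value
    1 at the origin keeps the function positive. *)
Definition radial (x : Rn R n) : R :=
  if supnorm x == 0%R then 1%R else ((2 * supnorm x) ^+ n)%R.

(** Half the side length of a cube of volume v. *)
Definition radius (v : R) : R := (v `^ n%:R^-1 / 2)%R.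
Local Notation rad := radius.

Lemma radius_ge0 v : (0 <= rad v)%R.
Proof. by rewrite divr_ge0 ?powR_ge0. Qed.

Lemma radiusK v : (0 <= v)%R -> ((2 * rad v) ^+ n = v)%R.
Proof.
move=> v0; rewrite /radius mulrC divfK ?pnatr_eq0//.
by rewrite -powR_mulrn ?powR_ge0// -powRrM mulVf ?powRr1// pnatr_eq0 -lt0n.
Qed.

Lemma supnorm_lt_radius x (v : R) : (0 <= v)%R -> ((2 * supnorm x) ^+ n < v)%R = (supnorm x < rad v)%R.
Proof.
move=> v0; have p2 : (0 < 2 :> R)%R by [].
have x0 : (0 <= 2 * supnorm x)%R by rewrite mulr_ge0 ?supnorm_ge0.
have r0 : (0 <= 2 * rad v)%R by rewrite mulr_ge0 ?radius_ge0.
by rewrite -[in LHS](radiusK v0) (ltr_pXn2r n0 x0 r0) (ltr_pM2l p2).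
Qed.

Lemma measurable_supnorm : measurable_fun setT (supnorm : Rn R n -> measurableTypeR R).
Proof.
apply: (measurability _ (RGenOInfty.measurableE R)) => _ [_ [c ->] <-].
rewrite setTI; have [c0|c0] := leP 0%R c; last first.
  rewrite (_ : _ @^-1` _ = setT); first exact: measurableT.
  by apply/seteqP; split => x //= _; rewrite in_itv/= andbT (lt_le_trans c0) ?supnorm_ge0.
have -> : supnorm @^-1` `]c, +oo[ = ~` centered_cube c.
  apply/seteqP; split => x /=; rewrite in_itv/= andbT.
    by move=> cx /(supnorm_le _ c0); rewrite leNgt cx.
  by move=> h; rewrite ltNge; apply/negP => /(supnorm_le _ c0).
by apply: measurableC; exact: measurable_centered_cube.
Qed.

Lemma measurable_radial : measurable_fun setT (radial : Rn R n -> measurableTypeR R).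
Proof.
apply: measurable_fun_ifT.
- apply: measurable_fun_eqr; first exact: measurable_supnorm.
  exact: measurable_cst.
- exact: measurable_cst.
- apply: measurable_funX; apply: measurable_funM; first exact: measurable_cst.
  exact: measurable_supnorm.
Qed.

Lemma radial_gt0 x : (0 < radial x)%R.
Proof.
rewrite /radial; case: eqP => // /eqP x0; rewrite exprn_gt0// mulr_gt0//.
by rewrite lt_neqAle eq_sym x0 supnorm_ge0.
Qed.

Lemma lebesgue_supnorm_eq0 : lebesgue_Rn R n (centered_cube 0) = 0.
Proof. by rewrite lebesgue_centered_cube// mulr0 expr0n eqn0Ngt n0. Qed.

Let lebesgue_open_cube (v : R) : (0 < v)%R ->
  lebesgue_Rn R n [set x | (supnorm x < rad v)%R] = v%:E.
Proof.
move=> v0; apply/eqP; rewrite eq_le; apply/andP; split.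
  have <- : lebesgue_Rn R n (centered_cube (rad v)) = v%:E.
    by rewrite lebesgue_centered_cube ?radius_ge0// radiusK// ltW.
  apply: lebesgue_Rn_le => x /= xv; apply/supnorm_le; first exact: radius_ge0.
  exact: ltW.
apply/lee_addgt0Pr => e e0.
have [ve|ev] := leP v e.
  by rewrite (le_trans _ (leeDr _ _))// ?lee_fin// measure_ge0.
have w0 : (0 <= v - e)%R by rewrite subr_ge0 ltW.
apply: (@le_trans _ _ (lebesgue_Rn R n (centered_cube (rad (v - e))) + e%:E)).
  by rewrite lebesgue_centered_cube ?radius_ge0// radiusK// -EFinD subrK.
rewrite leeD2r//; apply: lebesgue_Rn_le => x /supnorm_le => /(_ (radius_ge0 _)) /= xv.
apply: le_lt_trans xv _; rewrite /radius ltr_pM2r// gt0_ltr_powR// ?nnegrE// ?ltW//.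
  by rewrite invr_gt0 ltr0n.
by rewrite gtrDl oppr_lt0.
Qed.

Lemma lebesgue_radial_below (v : R) : (0 < v)%R ->
  lebesgue_Rn R n [set x | (radial x < v)%R] = v%:E.
Proof.
move=> v0; have Z x : (supnorm x == 0%R) = (x \in centered_cube 0).
  apply/idP/idP => [/eqP x0|/set_mem/(supnorm_le _ (lexx _)) x0].
    by apply/mem_set/supnorm_le => //; rewrite x0.
  by rewrite eq_le x0 supnorm_ge0.
have mr : measurable ([set x | (radial x < v)%R] : set (Rn R n)).
  have -> : [set x | (radial x < v)%R] = setT `&` radial @^-1` `]-oo, v[.
    by apply/seteqP; split => x /=; rewrite in_itv//= => -[].
  by apply: measurable_radial => //; exact: measurable_itv.
have rE x : x \notin centered_cube 0 -> (radial x < v)%R = (supnorm x < rad v)%R.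
  by rewrite -Z /radial => /negbTE ->; rewrite supnorm_lt_radius// ltW.
apply/eqP; rewrite eq_le; apply/andP; split.
  rewrite -(lebesgue_open_cube v0); apply: lebesgue_Rn_le => x /=.
  have [xZ _|/rE ->//] := boolP (x \in centered_cube 0).
  move: xZ; rewrite -Z => /eqP ->; rewrite divr_gt0// powR_gt0//.
rewrite -[leRHS]adde0 -lebesgue_supnorm_eq0 -(lebesgue_open_cube v0).
apply: (@le_trans _ _ (lebesgue_Rn R n ([set x | (radial x < v)%R] `|` centered_cube 0))).
  apply: lebesgue_Rn_le => x /= xv.
  have [xZ|/rE xr] := boolP (x \in centered_cube 0); first by right; exact: set_mem.
  by left; rewrite /= xr.
by apply: measureU2 => //; exact: measurable_centered_cube.
Qed.

Lemma radial_in_cube (v : R) x : (0 < v)%R -> (radial x <= v)%R ->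
  centered_cube (radius v) x.
Proof.
move=> v0; rewrite /radial => h; apply/supnorm_le; first exact: radius_ge0.
move: h; case: eqP => [-> _|_]; first exact: radius_ge0.
rewrite leNgt => /negP h; rewrite leNgt; apply/negP => vx; apply: h.
have r0 : (0 <= 2 * rad v)%R by rewrite mulr_ge0 ?radius_ge0.
have x0 : (0 <= 2 * supnorm x)%R by rewrite mulr_ge0 ?supnorm_ge0.
by rewrite -[ltLHS](radiusK (ltW v0)) (ltr_pXn2r n0 r0 x0) ltr_pM2l.
Qed.

Lemma uniformizes_radial : uniformizes (lebesgue_Rn R n) setT radial.
Proof.
split; first exact: measurable_radial.
- by move=> x _; exact: radial_gt0.
- by move=> v v0; rewrite setTI; exact: lebesgue_radial_below.
Qed.

End radial.

Lemma lebesgue_Rn_sigma_finite (R : realType) (n : nat) : sigma_finite setT (lebesgue_Rn R n).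
Proof.
exists (fun k : nat => centered_cube k%:R : set (Rn R n)).
  apply/seteqP; split => x // _; exists (Num.bound (supnorm x)) => //.
  by apply/supnorm_le; [exact: ler0n|rewrite ltW// archi_boundP// supnorm_ge0].
move=> k; split; first exact: measurable_centered_cube.
by rewrite lebesgue_centered_cube// ltry.
Qed.

HB.instance Definition _ (R : realType) (n : nat) :=
  Measure_isSigmaFinite.Build _ _ _ (lebesgue_Rn R n) (@lebesgue_Rn_sigma_finite R n).

(** * The fractional maximal function *)

Section vitali_cubes.
Context (R : realType) (n : nat).
Implicit Types p q : 'rV[R]_n * R.

Definition cube p : set (Rn R n) := box p.1 (p.1 + const_mx p.2)%R.

Definition triple_cube p : set (Rn R n) :=
  box (p.1 - const_mx p.2)%R (p.1 + const_mx (2 * p.2))%R.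

Lemma cubeP p x : cube p x <-> forall i, (p.1 ord0 i <= (x : 'rV[R]_n) ord0 i <= p.1 ord0 i + p.2)%R.
Proof. by split => h i; have := h i; rewrite !mxE. Qed.

Lemma measurable_cube p : measurable (cube p).
Proof. exact: measurable_box. Qed.

Lemma lebesgue_Rn_cube p : (0 <= p.2)%R -> lebesgue_Rn R n (cube p) = (p.2 ^+ n)%:E.
Proof. exact: lebesgue_cube. Qed.

Lemma lebesgue_triple_cube p : (0 <= p.2)%R ->
  lebesgue_Rn R n (triple_cube p) = ((3 * p.2) ^+ n)%:E.
Proof.
move=> p0; have p3 : (0 <= 3 * p.2)%R by rewrite mulr_ge0.
rewrite -(lebesgue_cube (p.1 - const_mx p.2)%R p3); congr (lebesgue_Rn R n (box _ _)).
by apply/rowP => i; rewrite !mxE; ring.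
Qed.

(** Greedy selection: keep a largest cube, discard the cubes that meet it, which
    are contained in its triple, and repeat. *)
Lemma vitali_cubes (s : seq ('rV[R]_n * R)) : (forall p, p \in s -> 0 <= p.2)%R ->
  exists s', [/\ uniq s', {subset s' <= s}, trivIset [set` s'] cube &
    forall x p, p \in s -> cube p x -> exists2 q, q \in s' & triple_cube q x].
Proof.
have [m] := ubnP (size s); elim: m s => // m IH s sm s0.
have [s_nil|[p0 p0s]] : s = [::] \/ exists p, p \in s.
  by case: s {sm s0} => [|p s]; [left|right; exists p; rewrite mem_head].
  by exists [::]; split => //= x p; rewrite s_nil.
have [p ps pmax] : exists2 p, p \in s & forall q, q \in s -> (q.2 <= p.2)%R.
  clear -p0s; elim: s p0 p0s => // a s IHs p0 _.
  case: s IHs => [_|b s IHs]; first by exists a; rewrite ?mem_head// => q; rewrite inE => /eqP ->.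
  have [p ps pm] := IHs b (mem_head _ _).
  have [ap|pa] := leP a.2 p.2.
    exists p; first by rewrite in_cons ps orbT.
    by move=> q; rewrite in_cons => /orP[/eqP ->//|/pm].
  exists a; rewrite ?mem_head// => q; rewrite in_cons => /orP[/eqP ->//|/pm qp].
  exact: le_trans qp (ltW pa).
pose s1 := [seq q <- s | `[< cube p `&` cube q = set0 >]].
have ps1 : p \notin s1.
  rewrite mem_filter negb_and; apply/orP; left; apply/asboolPn => /seteqP[+ _].
  move=> /(_ p.1); apply; split; apply/cubeP => i;
    by rewrite lexx lerDl s0.
have [s' [us' ss' ts' cs']] : exists s', [/\ uniq s', {subset s' <= s1}, trivIset [set` s'] cube &
    forall x q, q \in s1 -> cube q x -> exists2 q', q' \in s' & triple_cube q' x].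
  apply: IH => [|q]; last by rewrite mem_filter => /andP[_ /s0].
  rewrite size_filter -ltnS; apply: leq_trans sm; rewrite ltnS ltn_neqAle count_size andbT.
  apply/negP => /eqP cs; have : all (fun q => `[< cube p `&` cube q = set0 >]) s by rewrite all_count cs.
  by move/allP => /(_ p ps) h; move: ps1; rewrite mem_filter h ps.
exists (p :: s'); split.
- by rewrite /= us' andbT; apply/negP => /ss'; exact/negP.
- by move=> q; rewrite in_cons => /orP[/eqP ->//|/ss']; rewrite mem_filter => /andP[].
- move=> q q' /=; rewrite !in_cons.
  have disj r : r \in s' -> cube p `&` cube r = set0.
    by move=> /ss'; rewrite mem_filter => /andP[/asboolP].
  move=> /orP[/eqP ->|qs'] /orP[/eqP ->|q's'] //.
  + by rewrite disj// => -[].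
  + by rewrite setIC disj// => -[].
  + exact: ts'.
move=> x q qs qx; have [qs1|] := boolP (q \in s1).
  by have [q' q's' q'x] := cs' x q qs1 qx; exists q' => //; rewrite in_cons q's' orbT.
rewrite mem_filter qs andbT => /asboolPn/eqP/set0P[z [zp zq]].
exists p; first exact: mem_head.
move=> i; have := pmax q qs; have := (cubeP _ _).1 zp i.
have := (cubeP _ _).1 zq i; have := (cubeP _ _).1 qx i; rewrite !mxE.
by move=> /andP[a1 a2] /andP[a3 a4] /andP[a5 a6] a7; apply/andP; split; lra.
Qed.

End vitali_cubes.

Section fractional_maximal.
Context (R : realType) (n : nat) (gamma : R).
Hypotheses (gamma_gt0 : (0 < gamma)%R) (gamma_lt : (gamma < n%:R)%R).
Local Notation mu := (lebesgue_Rn R n).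
Local Notation al := (gamma / n%:R)%R.
Implicit Types f : Rn R n -> \bar R.

Let n0 : (0 < n)%N.
Proof. by rewrite -(ltr0n R); exact: lt_trans gamma_lt. Qed.

Lemma exponent_gt0 : (0 < al)%R.
Proof. by rewrite divr_gt0// ltr0n. Qed.

Lemma exponent_lt1 : (al < 1)%R.
Proof. by rewrite ltr_pdivrMr ?mul1r// ltr0n. Qed.

Definition frac_avg f (p : 'rV[R]_n * R) : \bar R :=
  (((p.2 ^+ n) `^ (1 - al))^-1)%:E * \int[mu]_(y in cube p) `|f y|.

Lemma frac_maxE f x : frac_max gamma f x =
  ereal_sup [set frac_avg f p | p in [set p | (0 < p.2)%R /\ cube p x]].
Proof.
rewrite /frac_max; congr ereal_sup; apply/seteqP; split => z /=.
  move=> [Q [[a [l [l0 QE]]] ax] <-]; move: ax; rewrite QE => ax; exists (a, l) => //.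
  by rewrite /frac_avg/= lebesgue_cube// ltW.
move=> [[a l] /= [l0 ax] <-]; exists (cube (a, l)).
  by split => //; exists a, l.
by rewrite /frac_avg/= lebesgue_Rn_cube//= ltW.
Qed.

Lemma frac_avg_ge0 f p : 0 <= frac_avg f p.
Proof.
by rewrite mule_ge0 ?lee_fin ?invr_ge0 ?powR_ge0//; apply: integral_ge0 => y _.
Qed.

Lemma frac_max_ge0 f x : 0 <= frac_max gamma f x.
Proof.
rewrite frac_maxE; apply: le_trans (frac_avg_ge0 f (x : 'rV[R]_n, 1%R)) _.
apply: ereal_sup_ubound; exists (x : 'rV[R]_n, 1%R) => //.
split; first exact: ltr01.
by apply/cubeP => i; rewrite lexx lerDl ler01.
Qed.

Let avg_gtP f p (l : R) : (0 < p.2)%R ->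
  l%:E < frac_avg f p <-> (l * (p.2 ^+ n) `^ (1 - al))%:E < \int[mu]_(y in cube p) `|f y|.
Proof.
move=> p0; have h : (0 < (p.2 ^+ n) `^ (1 - al))%R by rewrite powR_gt0// exprn_gt0.
by rewrite /frac_avg lte_pdivlMl// -EFinM mulrC; split.
Qed.

(** A cube with large average remains so when slightly enlarged. *)
Let enlarge f p (l : R) : Mfun setT f -> (0 <= l)%R -> (0 < p.2)%R -> l%:E < frac_avg f p ->
  exists2 b : R, (p.2 < b)%R & forall q, (p.2 < q.2 < b)%R -> cube p `<=` cube q ->
    l%:E < frac_avg f q.
Proof.
move=> mf l0 p0 /(avg_gtP _ _ p0) pI; set I := \int[mu]_(y in _) _ in pI.
have I0 : 0 <= I by apply: integral_ge0 => y _; exact: abse_ge0.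
have Iq q : cube p `<=` cube q -> I <= \int[mu]_(y in cube q) `|f y|.
  move=> pq; apply: ge0_subset_integral.
  - exact: measurable_cube.
  - exact: measurable_cube.
  - by apply: measurableT_comp; [exact: abse_measurable|exact: measurable_funTS].
  - by move=> y _; exact: abse_ge0.
  - exact: pq.
move: I I0 pI Iq => I I0 pI Iq.
have [b pb bP] : exists2 b : R, (p.2 < b)%R &
    forall r, (p.2 < r < b)%R -> (l * (r ^+ n) `^ (1 - al))%:E < I.
  have be0 : (0 < 1 - al)%R by rewrite subr_gt0 exponent_lt1.
  move: l0; rewrite le_eqVlt => /orP[/eqP l0|l0].
    by exists (p.2 + 1)%R; rewrite ?ltrDl// => r _; move: pI; rewrite -l0 !mul0r.
  case: I I0 pI {Iq} => [I| |] // I0 pI; last by exists (p.2 + 1)%R; rewrite ?ltrDl// => r _; rewrite ltry.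
  rewrite lte_fin mulrC -ltr_pdivlMr// in pI.
  pose c := ((I / l) `^ (1 - al)^-1)%R.
  have c0 : (0 < c)%R.
    rewrite powR_gt0//; apply: lt_trans pI; by rewrite powR_gt0// exprn_gt0.
  have cE : (c `^ (1 - al) = I / l)%R.
    rewrite -powRrM mulVf ?gt_eqF// powRr1// divr_ge0// ltW//.
  exists (c `^ n%:R^-1)%R.
    have p2 : (p.2 = (p.2 ^+ n) `^ n%:R^-1)%R.
      by rewrite -powR_mulrn ?ltW// -powRrM mulfV ?powRr1 ?ltW// pnatr_eq0 -lt0n.
    rewrite p2; apply: gt0_ltr_powR; rewrite ?invr_gt0 ?ltr0n// ?nnegrE ?exprn_ge0 ?ltW//.
    rewrite ltNge; apply/negP => cp; move: pI; rewrite ltNge => /negP; apply.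
    by rewrite -cE; apply: ge0_ler_powR; rewrite ?nnegrE ?exprn_ge0 ?(ltW c0) ?(ltW be0) ?(ltW p0).
  move=> r /andP[pr rc]; have r0 := lt_trans p0 pr.
  rewrite lte_fin mulrC -ltr_pdivlMr// -cE; apply: gt0_ltr_powR; rewrite ?nnegrE ?exprn_ge0 ?(ltW c0) ?(ltW r0)//.
  have cn : (c = (c `^ n%:R^-1) ^+ n)%R.
    by rewrite -powR_mulrn ?powR_ge0// -powRrM mulVf ?powRr1 ?(ltW c0)// pnatr_eq0 -lt0n.
  by rewrite cn ltr_pXn2r// ?nnegrE ?powR_ge0 ?(ltW r0).
exists b => // q qb pq; have /andP[/(lt_trans p0) q0 _] := qb.
apply/(avg_gtP _ _ q0); apply: lt_le_trans (Iq _ pq); exact: bP.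
Qed.

Definition rat_cube (z : 'rV[rat]_n * rat) : 'rV[R]_n * R := (map_mx ratr z.1, ratr z.2).

(** Countably many cubes suffice, hence M_gamma f is measurable. *)
Lemma superlevel_frac_max f (l : R) : Mfun setT f -> (0 <= l)%R ->
  [set x | l%:E < frac_max gamma f x] =
  \bigcup_(z in [set z | (0 < (rat_cube z).2)%R /\ l%:E < frac_avg f (rat_cube z)])
     cube (rat_cube z).
Proof.
move=> mf l0; apply/seteqP; split => x /=.
  rewrite frac_maxE => /ereal_sup_gt[_ [p [p0 px] <-] lp].
  have [b pb bP] := enlarge mf l0 p0 lp.
  pose e := ((b - p.2) / 2)%R; have e0 : (0 < e)%R by rewrite divr_gt0// subr_gt0.
  have ha i : exists q : rat, (p.1 ord0 i - e < ratr q < p.1 ord0 i)%R.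
    have [|q] := @rat_in_itvoo R (p.1 ord0 i - e) (p.1 ord0 i); first by rewrite gtrDl oppr_lt0.
    by rewrite in_itv/=; exists q.
  have [a aP] := choice ha.
  have [q] : exists q : rat, (p.2 + e < ratr q < b)%R.
    have [|q] := @rat_in_itvoo R (p.2 + e) b; first by rewrite /e; lra.
    by rewrite in_itv/=; exists q.
  move=> /andP[q1 q2].
  have pq : (p.2 < ratr q)%R by apply: lt_trans q1; rewrite ltrDl.
  have sub : cube p `<=` cube (rat_cube (\row_i a i, q)).
    move=> y /cubeP py; apply/cubeP => i; have := py i; have := aP i; rewrite /= !mxE.
    by move=> /andP[a1 a2] /andP[y1 y2]; apply/andP; split; lra.
  exists (\row_i a i, q); last exact: sub.
  split; first by rewrite /=; exact: lt_trans pq.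
  by apply: bP => //=; rewrite pq q2.
move=> [z [z0 lz] zx]; rewrite frac_maxE; apply: lt_le_trans lz _.
by apply: ereal_sup_ubound; exists (rat_cube z).
Qed.

Lemma measurable_frac_max f : Mfun setT f -> Mfun setT (frac_max gamma f).
Proof.
move=> mf; apply: (measurability _ (ErealGenOInfty.measurableE R)) => _ [_ [l ->] <-].
rewrite setTI; have -> : frac_max gamma f @^-1` `]l%:E, +oo[ = [set x | l%:E < frac_max gamma f x].
  by apply/seteqP; split => x /=; rewrite in_itv/= andbT.
have [l0|l0] := leP 0%R l; last first.
  rewrite (_ : [set x | _] = setT); first exact: measurableT.
  by apply/seteqP; split => x //= _; apply: lt_le_trans (frac_max_ge0 f x); rewrite lte_fin.
rewrite superlevel_frac_max// bigcup_mkcond; apply: countable_bigcupT_measurable.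
  exact: countableP.
by move=> z; case: ifPn => // _; exact: measurable_cube.
Qed.

End fractional_maximal.

(** * Rearrangement bounds for the fractional maximal function *)

Lemma le_measure_bigsetU (R : realType) (d : measure_display) (T : measurableType d)
    (mu : {measure set T -> \bar R}) (I : eqType) (s : seq I) (F : I -> set T) :
  (forall i, measurable (F i)) ->
  mu (\big[setU/set0]_(i <- s) F i) <= \sum_(i <- s) mu (F i).
Proof.
move=> mF; elim: s => [|i s IH]; first by rewrite !big_nil measure0.
rewrite !big_cons; apply: (@le_trans _ _ (mu (F i) + mu (\big[setU/set0]_(i <- s) F i))).
  by apply: measureU2 => //; exact: bigsetU_measurable.
by rewrite leeD2l.
Qed.

Lemma rearr_abse (R : realType) (d : measure_display) (T : measurableType d)
    (mu : {measure set T -> \bar R}) (D : set T) f (t : R) :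
  rearr mu D (fun x => `|f x|) t = rearr mu D f t.
Proof.
rewrite /rearr; congr ereal_inf; congr image; apply/funext => l /=.
by under eq_fun do rewrite abse_id.
Qed.

(** Concavity of the power function, in the form of subadditivity. *)
Lemma powR_sum_le (R : realType) (I : eqType) (s : seq I) (x : I -> R) (a : R) :
  (0 < a)%R -> (a < 1)%R -> (forall i, i \in s -> 0 < x i)%R ->
  ((\sum_(i <- s) x i) `^ (1 - a) <= \sum_(i <- s) (x i) `^ (1 - a))%R.
Proof.
move=> a0 a1 x0; set S := (\sum_(i <- s) x i)%R.
have xS i : i \in s -> (x i <= S)%R.
  move=> si; rewrite /S (big_rem i)//= lerDl; rewrite big_seq; apply: sumr_ge0 => j /mem_rem/x0.
  exact: ltW.
have powS y : (0 < y)%R -> (y `^ (1 - a) = y * y `^ (- a))%R.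
  by move=> y0; rewrite powRD ?powRr1 ?(ltW y0)// (gt_eqF y0) implybT.
have [S0|S0] := leP S 0%R.
  have -> : S = 0%R.
    apply/eqP; rewrite eq_le S0 /S big_seq sumr_ge0// => i /x0; exact: ltW.
  rewrite powR0; last by rewrite subr_eq0 eq_sym lt_eqF.
  by apply: sumr_ge0 => i _; exact: powR_ge0.
rewrite powS// {1}/S mulr_suml big_seq [leRHS]big_seq; apply: ler_sum => i si.
have xi := x0 i si.
rewrite powS// ler_pM2l// !powRN lef_pV2 ?posrE ?powR_gt0//.
by apply: ge0_ler_powR; rewrite ?nnegrE ?(ltW a0) ?(ltW xi) ?(ltW S0)// xS.
Qed.

Section fractional_maximal_bounds.
Context (R : realType) (n : nat) (gamma : R).
Hypotheses (gamma_gt0 : (0 < gamma)%R) (gamma_lt : (gamma < n%:R)%R).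
Local Notation mu := (lebesgue_Rn R n).
Local Notation al := (gamma / n%:R)%R.
Local Notation H := (halfline R).
Implicit Types f : Rn R n -> \bar R.

Let n0 : (0 < n)%N.
Proof. by rewrite -(ltr0n R); exact: lt_trans gamma_lt. Qed.

(** Finitely many cubes with large averages nearly exhaust the level set; a
    disjoint subfamily still has total volume S comparable to its measure. *)
Lemma frac_max_weak f (t l : R) : Mfun setT f -> (0 <= l)%R -> (0 < t)%R ->
  t%:E < mu [set x | l%:E < frac_max gamma f x] ->
  exists S : R, [/\ (0 < S)%R, (t <= 3 ^+ n * S)%R &
    (l * S `^ (1 - al))%:E <=
      \int[lebesgue_line R]_(s in H `&` [set s : line R | (s : R)%:E < S%:E]) rearr_Rn f s].
Proof.
move=> mf l0 t0; rewrite (superlevel_frac_max gamma_gt0 gamma_lt)//.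
set good := [set z | _].
pose B k : set (Rn R n) := if unpickle k is Some z then
  (if z \in good then cube (rat_cube R z) else set0) else set0.
have mB k : measurable (B k).
  by rewrite /B; case: unpickle => // z; case: ifP => // _; exact: measurable_cube.
have -> : \bigcup_(z in good) cube (rat_cube R z) = \bigcup_N \big[setU/set0]_(k < N.+1) B k.
  rewrite bigcup_bigsetU_bigcup; apply/seteqP; split => x.
    by move=> [z gz zx]; exists (pickle z) => //; rewrite /B pickleK mem_set.
  move=> [k _]; rewrite /B; case: unpickle => // z; case: ifPn => // /set_mem gz zx.
  by exists z.
have mUB N : measurable (\big[setU/set0]_(k < N.+1) B k) by exact: bigsetU_measurable.
move=> tU; have [N tN] : exists N, t%:E < mu (\big[setU/set0]_(k < N.+1) B k).
  apply: contrapT => /forallNP h; move: tU; apply/negP; rewrite -leNgt.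
  have cvgU : mu (\big[setU/set0]_(k < N.+1) B k) @[N --> \oo] -->
      mu (\bigcup_N \big[setU/set0]_(k < N.+1) B k).
    apply: nondecreasing_cvg_mu => //; first exact: bigcupT_measurable.
    by move=> i j ij; apply/subsetPset; exact: subset_bigsetU.
  rewrite -(cvg_lim _ cvgU)//; apply: lime_le.
    by apply/cvg_ex; exists (mu (\bigcup_N \big[setU/set0]_(k < N.+1) B k)).
  by apply: nearW => k; rewrite leNgt; apply/negP; exact: h.
pose s := pmap (fun k => obind (fun z => if z \in good then Some (rat_cube R z) else None)
  (unpickle k)) (iota 0 N.+1).
have sgood p : p \in s -> (0 < p.2)%R /\ l%:E < frac_avg gamma f p.
  rewrite mem_pmap => /mapP[k _]; case: unpickle => //= z.
  by case: ifPn => // /set_mem[z0 lz] [->].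
have sU x : (\big[setU/set0]_(k < N.+1) B k) x -> exists2 p, p \in s & cube p x.
  rewrite -bigcup_mkord => -[k /= kN]; rewrite /B; case zk : unpickle => [z|//].
  case: ifPn => // gz zx; exists (rat_cube R z) => //.
  rewrite mem_pmap; apply/mapP; exists k; first by rewrite mem_iota.
  by rewrite zk /= gz.
have [s' [us' ss' ts' cs']] := vitali_cubes (fun p ps => ltW (sgood p ps).1).
have s'0 p : p \in s' -> (0 < p.2)%R by move=> /ss'/sgood[].
pose S := (\sum_(p <- s') p.2 ^+ n)%R.
have tS : (t <= 3 ^+ n * S)%R.
  rewrite -lee_fin; apply: le_trans (ltW tN) _.
  apply: (@le_trans _ _ (mu (\big[setU/set0]_(p <- s') triple_cube p))).
    apply: lebesgue_Rn_le => x /sU[p ps px]; have [q qs' qx] := cs' x p ps px.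
    by rewrite -bigcup_seq; exists q.
  apply: le_trans (le_measure_bigsetU _ _ _) _; first by move=> p; exact: measurable_box.
  rewrite /S mulr_sumr -sumEFin !big_seq; apply: lee_sum => p ps'.
  rewrite -exprMn -(lebesgue_triple_cube (ltW (s'0 _ ps'))); exact: lexx.
have S0 : (0 < S)%R.
  by rewrite -(pmulr_rgt0 _ (x := 3 ^+ n)) ?exprn_gt0//; exact: lt_le_trans tS.
exists S; split => //.
pose E := \big[setU/set0]_(p <- s') cube p.
have mE : measurable E by apply: bigsetU_measurable => p _; exact: measurable_cube.
have muES : mu E <= S%:E.
  apply: le_trans (le_measure_bigsetU _ _ _) _; first by move=> p; exact: measurable_cube.
  rewrite /S -sumEFin !big_seq; apply: lee_sum => p ps'.
  rewrite -(lebesgue_Rn_cube (ltW (s'0 _ ps'))); exact: lexx.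
have mr : measurable_fun H (rearr_Rn f) by exact: measurable_rearr.
apply: (@le_trans _ _ (\int[lebesgue_line R]_(s in H `&` [set s : line R | (s : R)%:E < mu E])
    rearr_Rn f s)); last first.
  apply: ge0_subset_integral.
  - exact: measurable_line_belowe.
  - exact: measurable_line_belowe.
  - by apply: measurable_funS mr => [|? []//]; exact: measurable_halfline.
  - by move=> x _; exact: rearr_ge0.
  - by move=> x [Hx /= xE]; split => //=; exact: lt_le_trans muES.
have ma : measurable_fun setT (fun x => `|f x|) by exact: measurableT_comp.
have := hardy_littlewood_set mu measurableT ma (fun x _ => abse_ge0 (f x)) mE (@subsetT _ E).
under [X in _ <= X -> _]eq_integral do rewrite rearr_abse.
apply: le_trans.
rewrite /E ge0_integral_bigsetU; first last.
- by move=> y _; exact: abse_ge0.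
- exact: measurable_funTS.
- exact: ts'.
- exact: us'.
- by move=> p; exact: measurable_cube.
apply: (@le_trans _ _ (\sum_(p <- s') (l * (p.2 ^+ n) `^ (1 - al))%:E)); last first.
  rewrite !big_seq; apply: lee_sum => p /[dup] /s'0 p0 /ss'/sgood[_].
  rewrite /frac_avg lte_pdivlMl ?powR_gt0 ?exprn_gt0// -EFinM mulrC; exact: ltW.
rewrite sumEFin lee_fin -mulr_sumr; apply: ler_wpM2l => //; apply: powR_sum_le.
- exact: exponent_gt0.
- exact: exponent_lt1.
- by move=> p /s'0 p0; rewrite exprn_gt0.
Qed.

(** The centred cube {V <= V x} contains x and has volume V x, and over it u o V has the
    same integral as u over (0, V x). *)
Lemma frac_max_radial (u : R -> \bar R) (x : Rn R n) : nonincreasing_on_pos u ->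
  (forall s, (0 < s)%R -> 0 <= u s) ->
  (radial x `^ (al - 1))%:E *
    \int[lebesgue_line R]_(y in H `&` [set y : line R | (y : R)%:E < (radial x)%:E]) u y
  <= frac_max gamma (u \o @radial R n) x.
Proof.
move=> nu u0; set s := radial x; have s0 : (0 < s)%R by exact: radial_gt0.
pose p : 'rV[R]_n * R := (const_mx (- radius n s)%R, (2 * radius n s)%R).
have cE : cube p = centered_cube (radius n s).
  rewrite /cube /centered_cube /=; congr box; apply/rowP => i; rewrite !mxE; ring.
have ps : (p.2 ^+ n = s)%R by rewrite /= radiusK// ltW.
have p0 : (0 < p.2)%R.
  rewrite lt_neqAle eq_sym; apply/andP; split; last by rewrite mulr_ge0// radius_ge0.
  by apply/eqP => p0; move: s0; rewrite -ps p0 expr0n eqn0Ngt n0 ltxx.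
have mu_ := measurable_nonincreasing_comp measurableT (uniformizes_radial R n0) nu.
have mu' : measurable_fun H (u : line R -> \bar R) by exact: measurable_nonincreasing_line.
have mc : measurable (cube p) by exact: measurable_cube.
have px : cube p x by rewrite cE; apply: radial_in_cube.
rewrite frac_maxE; apply: (@le_trans _ _ (frac_avg gamma (u \o @radial R n) p)); last first.
  by apply: ereal_sup_ubound; exists p.
rewrite /frac_avg ps -powRN opprB; apply: lee_wpmul2l; first by rewrite lee_fin powR_ge0.
have mau : measurable_fun (cube p) (fun y => `|(u \o @radial R n) y|).
  by apply: measurableT_comp; [exact: abse_measurable|exact: measurable_funTS].
apply: le_integral_distrib.
- exact: measurable_line_belowe.
- exact: mc.
- by apply: measurable_funS mu' => [|? []//]; exact: measurable_halfline.
- by move=> y [/halflineP/u0].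
- exact: mau.
- by move=> y _; exact: abse_ge0.
move=> l l0; pose v y : \bar R := if (y < s)%R then u y else 0.
have nv : nonincreasing_on_pos v.
  move=> y z y0 yz; rewrite /v; case: ifPn => zs.
    by rewrite (le_lt_trans yz zs); exact: nu.
  by case: ifPn => // _; exact: u0.
have v0 y : (0 < y)%R -> 0 <= v y by move=> y0; rewrite /v; case: ifP => // _; exact: u0.
have mH := @measurable_halfline R.
apply: (@le_trans _ _ (distrib (lebesgue_line R) H v l)).
  apply: le_measure; rewrite ?inE.
  - apply: measurable_superlevel; first exact: measurable_line_belowe.
    by apply: measurable_funS mu' => [|? []//]; exact: measurable_halfline.
  - by apply: measurable_superlevel => //; exact: measurable_nonincreasing_line.
  - by move=> y [[Hy /= ys] ly]; split => //=; rewrite /v -lte_fin ys.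
apply: le_trans (le_distrib_comp mH (@uniformizes_line R) measurableT (uniformizes_radial R n0) nv v0 (ltW l0)) _.
apply: le_measure; rewrite ?inE.
- apply: measurable_superlevel; first exact: measurableT.
  exact: (measurable_nonincreasing_comp measurableT (uniformizes_radial R n0) nv).
- apply: measurable_superlevel; [exact: mc|exact: mau].
move=> y [_ /=]; rewrite /v; case: ifPn => ys; last by rewrite abse0 lte_fin ltNge ltW.
by move=> ly; split; [rewrite cE; apply: radial_in_cube => //; exact: ltW|rewrite /= abse_id].
Qed.

End fractional_maximal_bounds.

(** * The supremum operator and its weights *)

Section scaling.
Context (R : realType).
Local Notation H := (halfline R).
Local Notation below s := (H `&` [set y : line R | (y : R)%:E < (s : R)%:E]).

Lemma itv_below (s : R) : (`]0%R, s[%classic : set (line R)) = below s.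
Proof.
apply/seteqP; split => y /=; rewrite in_itv/= lte_fin.
  by move=> /andP[y0 ys]; split => //; apply/halflineP.
by move=> [/halflineP -> ->].
Qed.

Lemma integral_below (u : R -> \bar R) (s : R) :
  \int[lebesgue_line R]_(y in below s) u y =
  \int[lebesgue_line R]_(y in H) (if ((y : R) < s)%R then u y else 0).
Proof.
rewrite integral_mkcondr; apply: eq_integral => y Hy.
rewrite patchE; case: ifPn => [/set_mem /=|]; first by rewrite lte_fin => ->.
by rewrite notin_setE /= lte_fin => /negP/negbTE ->.
Qed.

Lemma nonincreasing_below (u : R -> \bar R) (s : R) : nonincreasing_on_pos u ->
  (forall y, (0 < y)%R -> 0 <= u y) ->
  nonincreasing_on_pos (fun y => if (y < s)%R then u y else 0).
Proof.
move=> nu u0 y z y0 yz; case: ifPn => zs; first by rewrite (le_lt_trans yz zs); exact: nu.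
by case: ifPn => // _; exact: u0.
Qed.

(** Multiplication by c transports c times Lebesgue measure to Lebesgue measure. *)
Lemma integral_scale (u : R -> \bar R) (c : R) : (0 < c)%R -> nonincreasing_on_pos u ->
  (forall y, (0 < y)%R -> 0 <= u y) ->
  \int[lebesgue_line R]_(y in H) u y =
  c%:E * \int[lebesgue_line R]_(x in H) u (c * (x : R))%R.
Proof.
move=> c0 nu u0.
have mH := @measurable_halfline R.
pose nu_ := mscale (NngNum (ltW c0)) (lebesgue_line R).
have UV : uniformizes nu_ H (fun x : line R => c * (x : R))%R.
  split.
  - apply: measurable_funM; first exact: measurable_cst.
    exact: measurable_fun_line.
  - by move=> x /halflineP x0; rewrite mulr_gt0.
  - move=> v v0; rewrite /nu_ /mscale /=.
    have -> : H `&` [set x : line R | (c * (x : R) < v)%R] = below (v / c).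
      by congr (_ `&` _); apply/seteqP; split => x /=; rewrite lte_fin ltr_pdivlMr// mulrC.
    transitivity (c%:E * (v / c)%:E); last by rewrite -EFinM mulrC divfK// gt_eqF.
    by congr (_ * _); apply: lebesgue_line_below; rewrite lee_fin divr_ge0// ltW.
have nuc : nonincreasing_on_pos (fun x => u (c * x)%R).
  by move=> s t s0 st; apply: nu; [rewrite mulr_gt0|rewrite ler_pM2l].
have uc0 y : (0 < y)%R -> 0 <= u (c * y)%R by move=> y0; apply: u0; rewrite mulr_gt0.
have mu_ := measurable_nonincreasing_line nu; have muc := measurable_nonincreasing_line nuc.
rewrite (integral_distrib _ mH mu_); last by move=> y /halflineP/u0.
rewrite (integral_distrib _ mH muc); last by move=> y /halflineP/uc0.
rewrite -ge0_integralZl_EFin//; last 2 first.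
- by apply: measurable_nonincreasing_line => s t _; exact: le_distrib.
- exact: ltW.
apply: eq_integral => l /set_mem/halflineP/ltW l0.
transitivity (distrib nu_ H (fun x : line R => u (c * (x : R))%R) l); last by [].
apply/eqP; rewrite eq_le; apply/andP; split.
  exact: (le_distrib_comp mH (@uniformizes_line R) mH UV nu u0 l0).
exact: (le_distrib_comp mH UV mH (@uniformizes_line R) nu u0 l0).
Qed.

Lemma integral_below_scale (u : R -> \bar R) (s : R) : (0 < s)%R -> nonincreasing_on_pos u ->
  (forall y, (0 < y)%R -> 0 <= u y) ->
  \int[lebesgue_line R]_(y in below s) u y =
  s%:E * \int[lebesgue_line R]_(x in below 1) u (s * (x : R))%R.
Proof.
move=> s0 nu u0; rewrite !integral_below (integral_scale s0).
- congr (_ * _); apply: eq_integral => x _ /=.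
  by rewrite -[X in (_ < X)%R](mulr1 s) ltr_pM2l.
- exact: nonincreasing_below.
- by move=> y y0; case: ifP => // _; exact: u0.
Qed.

End scaling.

Lemma nonincreasing_powRN (R : realType) (a : R) : (0 <= a)%R ->
  nonincreasing_on_pos (fun y : R => (y `^ (- a))%:E).
Proof.
move=> a0 s t s0 st; have t0 := lt_le_trans s0 st.
rewrite lee_fin !powRN lef_pV2 ?posrE ?powR_gt0//.
by apply: ge0_ler_powR; rewrite ?nnegrE ?(ltW s0) ?(ltW t0).
Qed.

Section sup_operator.
Context (R : realType) (al : R).
Hypotheses (al0 : (0 < al)%R) (al1 : (al < 1)%R).
Local Notation H := (halfline R).
Local Notation below s := (H `&` [set y : line R | (y : R)%:E < (s : R)%:E]).
Implicit Types h : line R -> \bar R.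

Definition sup_part h (t : R) : \bar R :=
  ereal_sup [set (s `^ al)%:E * rearr_halfline h s | s in `[t, +oo[].

Lemma sup_part_ge h (t s : R) : (t <= s)%R ->
  (s `^ al)%:E * rearr_halfline h s <= sup_part h t.
Proof. by move=> ts; apply: ereal_sup_ubound; exists s => //=; rewrite in_itv/= ts. Qed.

Lemma sup_part_ge0 h t : 0 <= sup_part h t.
Proof.
apply: le_trans (sup_part_ge h (lexx t)).
by rewrite mule_ge0 ?lee_fin ?powR_ge0// rearr_ge0.
Qed.

Lemma sup_part_nonincreasing h (s t : R) : (s <= t)%R -> sup_part h t <= sup_part h s.
Proof.
move=> st; apply: ge_ereal_sup => z [r /=]; rewrite in_itv/= andbT => tr <-.
exact/sup_part_ge/(le_trans st tr).
Qed.

Lemma sup_opE h (t : R) : sup_op al h t = (t `^ (- al))%:E * sup_part h t.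
Proof. by []. Qed.

Lemma sup_op_ge0 h t : 0 <= sup_op al h t.
Proof. by rewrite sup_opE mule_ge0 ?lee_fin ?powR_ge0// sup_part_ge0. Qed.

Lemma nonincreasing_sup_op h : nonincreasing_on_pos (sup_op al h : R -> \bar R).
Proof.
move=> s t s0 st; rewrite !sup_opE.
apply: (@le_trans _ _ ((t `^ (- al))%:E * sup_part h s)).
  by apply: lee_wpmul2l; [rewrite lee_fin powR_ge0|exact: sup_part_nonincreasing].
by apply: lee_wpmul2r; [exact: sup_part_ge0|apply: nonincreasing_powRN => //; exact: ltW].
Qed.

Lemma measurable_sup_op h : measurable_fun H (sup_op al h).
Proof. exact/measurable_nonincreasing_line/nonincreasing_sup_op. Qed.

Lemma rearr_le_sup_op h (t : R) : (0 < t)%R -> rearr_halfline h t <= sup_op al h t.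
Proof.
move=> t0; rewrite sup_opE; apply: (@le_trans _ _ ((t `^ (- al))%:E * ((t `^ al)%:E * rearr_halfline h t))).
  by rewrite muleA -EFinM -powRD ?addNr ?powRr0 ?mul1e// eqxx (gt_eqF t0).
by apply: lee_wpmul2l; [rewrite lee_fin powR_ge0|exact: sup_part_ge].
Qed.

(** The kernel s^al (P T_al h)(s) against which tau integrates f^*. *)
Definition weight h (s : R) : \bar R := hardy_op (sup_op al h) s * (s `^ al)%:E.

Lemma weightE h (s : R) : (0 < s)%R ->
  weight h s = (s `^ (al - 1))%:E * \int[lebesgue_line R]_(y in below s) sup_op al h y.
Proof.
move=> s0; rewrite /weight /hardy_op itv_below muleAC -EFinM; congr (_%:E * _).
by rewrite -powR_inv1 ?ltW// -powRD 1?addrC// (gt_eqF s0) implybT.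
Qed.

(** Substituting y = s x makes the kernel an integral of the nonincreasing
    functions s |-> x^-al F(s x), where F is [sup_part al h]. *)
Lemma weight_scaled h (s : R) : (0 < s)%R ->
  weight h s = \int[lebesgue_line R]_(x in below 1)
     (((x : R) `^ (- al))%:E * sup_part h (s * (x : R))).
Proof.
move=> s0; rewrite weightE// (integral_below_scale s0); last 2 first.
- exact: nonincreasing_sup_op.
- by move=> y _; exact: sup_op_ge0.
rewrite muleA -EFinM -ge0_integralZl_EFin; first last.
- by rewrite mulr_ge0 ?powR_ge0 ?ltW.
- have nu : nonincreasing_on_pos (fun x => sup_op al h (s * x)%R).
    by move=> x y x0 xy; apply: nonincreasing_sup_op; [rewrite mulr_gt0|rewrite ler_pM2l].
  have mu_ := measurable_nonincreasing_line nu.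
  by apply: measurable_funS mu_ => [|? []//]; exact: measurable_halfline.
- by move=> x _; exact: sup_op_ge0.
- exact: measurable_line_belowe.
apply: eq_integral => x /set_mem[/halflineP x0 _]; rewrite sup_opE muleA -EFinM; congr (_%:E * _).
rewrite powRM ?(ltW s0) ?(ltW x0)// mulrA.
have -> : (s `^ (al - 1) * s * s `^ (- al) = 1)%R.
  rewrite -{2}(powRr1 (ltW s0)) -!powRD ?(gt_eqF s0) ?implybT//.
  by rewrite subrK subrr powRr0.
by rewrite mul1r.
Qed.

Lemma weight_ge0 h s : (0 < s)%R -> 0 <= weight h s.
Proof.
move=> s0; rewrite weightE// mule_ge0 ?lee_fin ?powR_ge0//.
by apply: integral_ge0 => y _; exact: sup_op_ge0.
Qed.

Lemma nonincreasing_weight h : nonincreasing_on_pos (weight h).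
Proof.
move=> s t s0 st; have t0 := lt_le_trans s0 st; rewrite !weight_scaled//.
have nF r : (0 < r)%R -> nonincreasing_on_pos (fun x => (x `^ (- al))%:E * sup_part h (r * x)%R).
  move=> r0 x y x0 xy; apply: (@le_trans _ _ ((y `^ (- al))%:E * sup_part h (r * x)%R)).
    by apply: lee_wpmul2l; [rewrite lee_fin powR_ge0|apply: sup_part_nonincreasing; rewrite ler_pM2l].
  by apply: lee_wpmul2r; [exact: sup_part_ge0|apply: nonincreasing_powRN => //; exact: ltW].
have mF r (r0 : (0 < r)%R) := measurable_nonincreasing_line (nF r r0).
apply: ge0_le_integral.
- exact: measurable_line_belowe.
- by move=> x _; rewrite mule_ge0 ?lee_fin ?powR_ge0 ?sup_part_ge0.
- by apply: measurable_funS (mF t t0) => [|? []//]; exact: measurable_halfline.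
- by apply: measurable_funS (mF s s0) => [|? []//]; exact: measurable_halfline.
- move=> x [/halflineP x0 _]; apply: lee_wpmul2l; first by rewrite lee_fin powR_ge0.
  by apply: sup_part_nonincreasing; rewrite ler_pM2r.
Qed.

Lemma measurable_weight h : measurable_fun H (weight h : line R -> \bar R).
Proof. exact/measurable_nonincreasing_line/nonincreasing_weight. Qed.

Lemma rearr_le_weight h (s : R) : (0 < s)%R ->
  (s `^ (al - 1))%:E * \int[lebesgue_line R]_(y in below s) rearr_halfline h y <= weight h s.
Proof.
move=> s0; rewrite weightE//; apply: lee_wpmul2l; first by rewrite lee_fin powR_ge0.
have mr : measurable_fun H (rearr_halfline h) by exact: measurable_rearr.
have mS := measurable_sup_op h.
apply: ge0_le_integral.
- exact: measurable_line_belowe.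
- by move=> x _; exact: rearr_ge0.
- by apply: measurable_funS mr => [|? []//]; exact: measurable_halfline.
- by apply: measurable_funS mS => [|? []//]; exact: measurable_halfline.
- by move=> x [/halflineP x0 _]; exact: rearr_le_sup_op.
Qed.

Lemma sup_opZ h h' (c : R) : (0 < c)%R ->
  (forall t, (0 < t)%R -> rearr_halfline h' t = c%:E * rearr_halfline h t) ->
  forall t, (0 < t)%R -> sup_op al h' t = c%:E * sup_op al h t.
Proof.
move=> c0 hh' t t0; rewrite !sup_opE muleCA; congr (_ * _).
rewrite /sup_part -ereal_sup_pZl//; congr ereal_sup; apply/seteqP; split => y /=.
  move=> [s]; rewrite in_itv/= andbT => ts <-.
  exists ((s `^ al)%:E * rearr_halfline h s); first by exists s => //; rewrite /= in_itv/= ts.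
  by rewrite hh' 1?muleCA// (lt_le_trans t0).
move=> [z [s]]; rewrite /= in_itv/= andbT => ts <- <-; exists s; first by rewrite /= in_itv/= ts.
by rewrite hh' 1?muleCA// (lt_le_trans t0).
Qed.

Lemma weightZ h h' (c : R) : (0 < c)%R ->
  (forall t, (0 < t)%R -> rearr_halfline h' t = c%:E * rearr_halfline h t) ->
  forall t, (0 < t)%R -> weight h' t = c%:E * weight h t.
Proof.
move=> c0 hh' t t0; rewrite !weightE// muleCA; congr (_ * _).
have mS : measurable_fun (below t) (sup_op al h).
  by apply: measurable_funS (measurable_sup_op h) => [|? []//]; exact: measurable_halfline.
rewrite -ge0_integralZl_EFin ?(ltW c0)//.
- by apply: eq_integral => y /set_mem[/halflineP y0 _]; exact: sup_opZ.
- exact: measurable_line_belowe.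
- by move=> y _; exact: sup_op_ge0.
Qed.

(** The integral I of the truncated power satisfies I <= 2^-al I + const by
    halving the interval, uniformly in the truncation. *)
Lemma integral_powR_fin (a : R) : (0 < a)%R ->
  \int[lebesgue_line R]_(y in below a) ((y : R) `^ (al - 1))%:E < +oo.
Proof.
move=> a0; have mH := @measurable_halfline R.
have al2 : (2 `^ (- al) < 1 :> R)%R.
  have : (1 `^ al < 2 `^ al :> R)%R by apply: gt0_ltr_powR; rewrite ?nnegrE ?ler01 ?ler0n ?ltr1n.
  by rewrite powR1 powRN invf_lt1 ?powR_gt0.
pose q : R := (2 `^ (- al))%R; have q0 : (0 <= q)%R by exact: powR_ge0.
have qE : (2 `^ (1 - al) = 2 * q :> R)%R by rewrite powRD ?powRr1// pnatr_eq0 implybT.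
pose c : R := ((a / 2) `^ (al - 1))%R; have c0 : (0 <= c)%R by exact: powR_ge0.
have a2 : (0 < a / 2)%R by rewrite divr_gt0.
have np : nonincreasing_on_pos (fun y : R => (y `^ (al - 1))%:E).
  by rewrite -(opprB 1 al); apply: nonincreasing_powRN; rewrite subr_ge0 ltW.
have pw (x y : R) : (0 < x)%R -> (x <= y)%R -> (y `^ (al - 1) <= x `^ (al - 1))%R.
  by move=> x0 xy; rewrite -lee_fin; exact: np.
pose u (k : nat) (y : R) : \bar R := (Num.min (y `^ (al - 1)) k%:R)%:E.
have nu k : nonincreasing_on_pos (u k).
  by move=> x y x0 xy; rewrite lee_fin le_min !ge_min pw//= lexx orbT.
have u0 k y : (0 < y)%R -> 0 <= u k y.
  by move=> y0; rewrite lee_fin le_min powR_ge0/=.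
have mu_ k := measurable_nonincreasing_line (nu k).
pose cut (s : R) (v : R -> \bar R) (y : R) : \bar R := if (y < s)%R then v y else 0.
have ncut s k : nonincreasing_on_pos (cut s (u k)).
  by apply: nonincreasing_below => //; exact: u0.
have cut0 s k y : (0 < y)%R -> 0 <= cut s (u k) y.
  by move=> y0; rewrite /cut; case: ifP => // _; exact: u0.
have nc s : nonincreasing_on_pos (cut s (fun=> c%:E)).
  by apply: nonincreasing_below => // y _; rewrite lee_fin.
have cc0 s y : 0 <= cut s (fun=> c%:E) y by rewrite /cut; case: ifP => // _; rewrite lee_fin.
pose J k := \int[lebesgue_line R]_(y in H) cut a (u k) y.
have cstint (r : R) : (0 <= r)%R -> \int[lebesgue_line R]_(y in below a) r%:E = (r * a)%:E.
  move=> r0; rewrite integral_cst; last exact: measurable_line_belowe.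
  rewrite EFinM; congr (_ * _); apply: lebesgue_line_below; by rewrite lee_fin ltW.
have Jfin k : J k <= (k%:R * a)%:E.
  rewrite -cstint// /J -integral_below; apply: ge0_le_integral.
  - exact: measurable_line_belowe.
  - by move=> y [/halflineP/u0].
  - by apply: measurable_funS (mu_ k) => [|? []//].
  - exact: measurable_cst.
  - by move=> y _; rewrite lee_fin ge_min lexx orbT.
have half k : \int[lebesgue_line R]_(y in H) cut (a / 2)%R (u k) y <= q%:E * J k.
  have h0 : (0 < 2^-1 :> R)%R by [].
  rewrite (integral_scale h0 (ncut _ k) (cut0 _ k)).
  have -> : q%:E * J k = 2^-1%:E * ((2 * q)%:E * J k).
    by rewrite muleA -EFinM mulrA mulVf ?mul1r// pnatr_eq0.
  apply: lee_wpmul2l; first by rewrite lee_fin ltW.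
  rewrite /J -ge0_integralZl_EFin//; first last.
  - by rewrite mulr_ge0.
  - exact: measurable_nonincreasing_line (ncut a k).
  - by move=> y /halflineP/cut0.
  apply: (@le_integral_halfline R (fun x => cut (a / 2)%R (u k) (2^-1 * x)%R)
     (fun x => (2 * q)%:E * cut a (u k) x)).
  - apply: measurable_nonincreasing_line => x y x0 xy; apply: ncut; first by rewrite mulr_gt0.
    by rewrite ler_pM2l.
  - apply: emeasurable_funM => //; exact: measurable_nonincreasing_line (ncut a k).
  - by move=> y y0; apply: cut0; rewrite mulr_gt0.
  - move=> y y0; rewrite /cut mulrC ltr_pM2r//; case: ifP => _; last by rewrite mule0.
    rewrite -EFinM lee_fin -qE.
    have q1 : (1 <= 2 `^ (1 - al) :> R)%R.
      rewrite -[leLHS](powRr0 2); apply: ler_powR; first by rewrite ler1n.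
      by rewrite subr_ge0 ltW.
    have -> : ((y * 2^-1) `^ (al - 1) = 2 `^ (1 - al) * y `^ (al - 1))%R.
      rewrite powRM ?(ltW y0)// mulrC; congr (_ * _)%R.
      by rewrite -powR_inv1// -powRrM mulN1r opprB.
    have y1 : (0 <= y `^ (al - 1))%R by exact: powR_ge0.
    rewrite minr_pMr ?(le_trans _ q1)// le_min !ge_min lexx/=.
    by apply/orP; right; rewrite ler_peMl.
have bound k : J k <= (c * a / (1 - q))%:E.
  have J0 : 0 <= J k by apply: integral_ge0 => y /halflineP/cut0.
  have jfin : J k \is a fin_num by rewrite ge0_fin_numE// (le_lt_trans (Jfin k)) ?ltry.
  have : J k <= q%:E * J k + (c * a)%:E.
    apply: (@le_trans _ _ (\int[lebesgue_line R]_(y in H)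
       (cut (a / 2)%R (u k) y + cut a (fun=> c%:E) y))).
      apply: (@le_integral_halfline R (cut a (u k))
        (fun y => cut (a / 2)%R (u k) y + cut a (fun=> c%:E) y)).
      - exact: measurable_nonincreasing_line (ncut a k).
      - by apply: emeasurable_funD; [exact: measurable_nonincreasing_line (ncut _ k)|
          exact: measurable_nonincreasing_line (nc a)].
      - exact: cut0.
      - move=> y y0; rewrite /cut; case: (ltP y a) => ya.
          case: ltP => y2; first by rewrite leeDl// lee_fin.
          by rewrite add0e lee_fin ge_min pw.
        by rewrite adde0; case: ifP => // _; exact: u0.
    rewrite ge0_integralD//; first last.
    - exact: measurable_nonincreasing_line (nc a).
    - exact: measurable_nonincreasing_line (ncut _ k).
    - by move=> y /halflineP/cut0.
    by apply: leeD => //; rewrite -cstint// integral_below.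
  rewrite -(fineK jfin) -EFinM -EFinD !lee_fin => h.
  by rewrite ler_pdivlMr ?subr_gt0// mulrBr mulr1; lra.
apply: le_lt_trans (ltry (c * a / (1 - q))).
apply: (@integral_eventually_above_le _ _ _ (lebesgue_line R) (below a) _ _ (fun k y => u k y)).
- exact: measurable_line_belowe.
- by apply: measurable_funS (measurable_nonincreasing_line np) => [|? []//].
- by move=> k; apply: measurable_funS (mu_ k) => [|? []//].
- by move=> y _; rewrite lee_fin powR_ge0.
- by move=> k y [/halflineP/u0].
- apply: aeW => x Hx y y0 xy; exists (Num.bound y).+1 => j nj.
  rewrite lte_fin lt_min -lte_fin xy/=.
  by apply: lt_le_trans (archi_boundP y0) _; rewrite ler_nat ltnW.
- by move=> k; rewrite integral_below; exact: bound.
Qed.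

End sup_operator.

(** * Suprema of Lorentz functionals *)

Lemma rearrZ (R : realType) (d : measure_display) (T : measurableType d)
    (mu : {measure set T -> \bar R}) (D : set T) f (c t : R) : (0 < c)%R ->
  rearr mu D (fun x => c%:E * f x) t = c%:E * rearr mu D f t.
Proof.
move=> c0; rewrite /rearr -ereal_inf_pZl//; congr ereal_inf.
have E (l : R) : [set x : T | (c * l)%:E < `|c%:E * f x| ] = [set x | l%:E < `|f x| ].
  have cE x : `|c%:E * f x| = c%:E * `|f x| by rewrite abseM gee0_abs// lee_fin ltW.
  by apply/seteqP; split => x /=; rewrite cE EFinM lte_pmul2l// lte_fin.
apply/seteqP; split => y /=.
  move=> [l [l0 hl] <-]; exists (l / c)%:E; last by rewrite -EFinM mulrC divfK ?gt_eqF.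
  by exists (l / c)%R => //; split; [rewrite divr_gt0|rewrite -E mulrC divfK ?gt_eqF].
by move=> [_ [l [l0 hl] <-] <-]; exists (c * l)%R => //; split; [rewrite mulr_gt0|rewrite E].
Qed.

Section lorentz_sup.
Context (R : realType) (d : measure_display) (T : measurableType d).
Variables (mu : {sigma_finite_measure set T -> \bar R}) (D : set T) (V : T -> R).
Hypotheses (mD : measurable D) (UV : uniformizes mu D V).
Local Notation H := (halfline R).
Local Notation below s := (H `&` [set y : line R | (y : R)%:E < (s : R)%:E]).
Variable W : set (R -> \bar R).
Hypothesis nW : forall w, W w -> nonincreasing_on_pos w.
Hypothesis W0 : forall w, W w -> forall s, (0 < s)%R -> 0 <= w s.
Hypothesis W_bounded : forall a : R, (0 < a)%R ->
  exists C : R, forall w, W w -> \int[lebesgue_line R]_(s in below a) w s <= C%:E.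
Hypothesis W_below : forall a : R, (0 < a)%R -> exists c : R, (0 < c)%R /\
  exists2 w, W w & forall s, (0 < s)%R -> (s < a)%R -> c%:E <= w s.
Implicit Types f g : T -> \bar R.

Definition lorentz_sup f : \bar R :=
  ereal_sup [set \int[lebesgue_line R]_(s in H) (rearr mu D f s * w (s : R)) | w in W].

Let mW w : W w -> measurable_fun H (w : line R -> \bar R).
Proof. by move=> Ww; apply/measurable_nonincreasing_line/nW. Qed.

Let mrW f w : W w -> measurable_fun H (fun s : line R => rearr mu D f s * w (s : R)).
Proof. by move=> Ww; apply: emeasurable_funM; [exact: measurable_rearr|exact: mW]. Qed.

Let rW0 f w : W w -> forall s, (0 < s)%R -> 0 <= rearr mu D f s * w s.
Proof. by move=> Ww s s0; rewrite mule_ge0 ?rearr_ge0// W0. Qed.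

Lemma lorentz_sup_ge f w : W w ->
  \int[lebesgue_line R]_(s in H) (rearr mu D f s * w (s : R)) <= lorentz_sup f.
Proof. by move=> Ww; apply: ereal_sup_ubound; exists w. Qed.

Lemma lorentz_sup_ge0 f : 0 <= lorentz_sup f.
Proof.
have [c [_ [w Ww _]]] := W_below ltr01.
apply: le_trans (lorentz_sup_ge f Ww).
by apply: integral_ge0 => s /halflineP; exact: rW0.
Qed.

Lemma le_lorentz_sup f g : (forall t, (0 < t)%R -> rearr mu D f t <= rearr mu D g t) ->
  lorentz_sup f <= lorentz_sup g.
Proof.
move=> fg; apply: ge_ereal_sup => _ [w Ww <-].
apply: le_trans (lorentz_sup_ge g Ww).
apply: (@le_integral_halfline R (fun s => rearr mu D f s * w s)
  (fun s => rearr mu D g s * w s)); [exact: mrW|exact: mrW|exact: rW0|].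
by move=> s s0; apply: lee_wpmul2r; [exact: W0|exact: fg].
Qed.

Lemma lorentz_sup_le f g : Mplus D f -> Mplus D g ->
  {ae mu, forall x, D x -> f x <= g x} -> lorentz_sup f <= lorentz_sup g.
Proof.
move=> [mf f0] [mg g0] fg; apply: le_lorentz_sup => t t0; apply: le_rearr => // l l0.
apply: ae_le_distrib => //; apply: filterS fg => x h Dx.
by rewrite !gee0_abs ?f0 ?g0// h.
Qed.

(** Hardy-Littlewood on E, and a weight bounded below on (0, mu E). *)
Lemma lorentz_sup_integral (E : set T) : measurable E -> E `<=` D -> mu E < +oo ->
  exists C : R, (0 < C)%R /\
    forall f, Mplus D f -> \int[mu]_(x in E) f x <= C%:E * lorentz_sup f.
Proof.
move=> mE ED muE.
have Efin : mu E \is a fin_num by rewrite ge0_fin_numE.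
pose a := (fine (mu E) + 1)%R.
have a0 : (0 < a)%R by rewrite ltr_wpDl// fine_ge0.
have [c [c0 [w Ww cw]]] := W_below a0.
exists c^-1%R; split; first by rewrite invr_gt0.
move=> f [mf f0]; rewrite lee_pdivlMl//.
apply: (@le_trans _ _ (c%:E * \int[lebesgue_line R]_(s in below a) rearr mu D f s)).
  apply: lee_wpmul2l; first by rewrite lee_fin ltW.
  apply: le_trans (hardy_littlewood_set mu mD mf f0 mE ED) _.
  apply: ge0_subset_integral.
  - exact: measurable_line_belowe.
  - exact: measurable_line_belowe.
  - by apply: measurable_funS (measurable_rearr mu D f) => [|? []//]; exact: measurable_halfline.
  - by move=> s _; exact: rearr_ge0.
  - move=> s [Hs /= sE]; split => //=; apply: lt_trans sE _.
    by rewrite -(fineK Efin) lte_fin ltrDl.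
apply: le_trans (lorentz_sup_ge f Ww).
have nr := @nonincreasing_rearr R d T mu D f.
rewrite integral_below -ge0_integralZl_EFin; first last.
- exact: ltW.
- by apply: measurable_nonincreasing_line; apply: nonincreasing_below => // s _; exact: rearr_ge0.
- by move=> s _; case: ifP => // _; exact: rearr_ge0.
- exact: measurable_halfline.
apply: (@le_integral_halfline R (fun s => c%:E * (if (s < a)%R then rearr mu D f s else 0))
  (fun s => rearr mu D f s * w s)).
- apply: emeasurable_funM; first exact: measurable_cst.
  apply: measurable_nonincreasing_line.
  by apply: nonincreasing_below => // s _; exact: rearr_ge0.
- exact: mrW.
- by move=> s _; rewrite mule_ge0 ?lee_fin ?(ltW c0)//; case: ifP => // _; exact: rearr_ge0.
- move=> s s0; case: ifP => sa; last by rewrite mule0 rW0.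
  by rewrite muleC; apply: lee_wpmul2l; [exact: rearr_ge0|exact: cw].
Qed.

Lemma lorentz_sup_eq0 f : Mplus D f ->
  lorentz_sup f = 0 <-> {ae mu, forall x, D x -> f x = 0}.
Proof.
move=> Mf; have [mf f0] := Mf; split => [rf|f_0]; last first.
  apply/eqP; rewrite eq_le lorentz_sup_ge0 andbT; apply: ge_ereal_sup => _ [w Ww <-].
  have r0 (s : R) : (0 < s)%R -> rearr mu D f s = 0.
    move=> s0; apply/eqP; rewrite eq_le rearr_ge0 andbT; apply/rearr_leP => //.
    apply: (@le_trans _ _ (distrib mu D (cst 0) 0)).
      apply: ae_le_distrib => //; apply: filterS f_0 => x h Dx.
      by rewrite h.
    rewrite /distrib (_ : _ `&` _ = set0) ?measure0 ?lee_fin ?ltW//.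
    by apply/seteqP; split => x //= [_]; rewrite normr0 ltxx.
  rewrite integral0_eq// => s /halflineP s0.
  by rewrite r0 ?mul0e.
apply: (ae_exhaust (unif_exhaust UV)) => j.
set E := D `&` _; have mE : measurable E by exact: (measurable_unif_belowe mD UV).
have ED : E `<=` D by move=> x [].
have muE : mu E < +oo by rewrite (unif_belowe mD UV) ?lee_fin// ltry.
have [C [C0 hC]] := lorentz_sup_integral mE ED muE.
apply: ge0_integral_eq0 => //; first exact: measurable_funS mf.
  by move=> x /ED/f0.
apply/eqP; rewrite eq_le; apply/andP; split.
  by have := hC _ Mf; rewrite rf mule0.
by apply: integral_ge0 => x /ED/f0.
Qed.

Lemma lorentz_sup_homogeneous (l : R) f : (0 <= l)%R -> Mplus D f ->
  lorentz_sup (fun x => l%:E * f x) = l%:E * lorentz_sup f.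
Proof.
move=> l0 Mf; move: l0; rewrite le_eqVlt => /orP[/eqP <-|l0].
  rewrite mul0e; apply/(lorentz_sup_eq0 (MplusZ (lexx _) Mf)); apply: aeW => x _.
  by rewrite mul0e.
have key w : W w -> \int[lebesgue_line R]_(s in H) (rearr mu D (fun x => l%:E * f x) s * w (s : R)) =
    l%:E * \int[lebesgue_line R]_(s in H) (rearr mu D f s * w (s : R)).
  move=> Ww; rewrite -ge0_integralZl_EFin; first last.
  - exact: ltW.
  - exact: mrW.
  - by move=> s /halflineP; exact: rW0.
  - exact: measurable_halfline.
  by apply: eq_integral => s _; rewrite rearrZ// muleA.
rewrite /lorentz_sup -ereal_sup_pZl//; congr ereal_sup; apply/seteqP; split => y.
  by move=> [w Ww <-]; rewrite key//; eexists; [exists w|].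
by move=> [_ [w Ww <-] <-]; exists w; rewrite ?key.
Qed.

(** By the Hardy-Littlewood inequality, the integral of f^* w is the supremum of
    the integrals of k f over k^* <= w, which is subadditive in f. *)
Lemma lorentz_sup_triangle f g : Mplus D f -> Mplus D g ->
  lorentz_sup (fun x => f x + g x) <= lorentz_sup f + lorentz_sup g.
Proof.
move=> Mf Mg; apply: ge_ereal_sup => _ [w Ww <-].
under eq_integral do rewrite muleC.
apply: (integral_rearr_le_sup mD UV (nW Ww) (W0 Ww) (MplusD Mf Mg)) => k Mk kw.
have [mkf kf0] := MplusM Mk Mf; have [mkg kg0] := MplusM Mk Mg.
have -> : \int[mu]_(x in D) (k x * (f x + g x)) =
    \int[mu]_(x in D) (k x * f x) + \int[mu]_(x in D) (k x * g x).
  rewrite -ge0_integralD//; apply: eq_integral => x /set_mem Dx.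
  by rewrite ge0_muleDr//; [case: Mf => _; exact|case: Mg => _; exact].
have key h : Mplus D h -> \int[mu]_(x in D) (k x * h x) <= lorentz_sup h.
  move=> [mh h0]; have [mk k0] := Mk; apply: le_trans (lorentz_sup_ge h Ww).
  apply: le_trans (hardy_littlewood mu mD mk mh k0 h0) _.
  apply: (@le_integral_halfline R (fun s => rearr mu D k s * rearr mu D h s)
    (fun s => rearr mu D h s * w s)).
  - by apply: emeasurable_funM; exact: measurable_rearr.
  - exact: mrW.
  - by move=> s _; rewrite mule_ge0 ?rearr_ge0.
  - by move=> s s0; rewrite muleC; apply: lee_wpmul2l; [exact: rearr_ge0|exact: kw].
by apply: leeD; exact: key.
Qed.

Lemma lorentz_sup_fatou (fj : nat -> T -> \bar R) f :
  (forall j, Mplus D (fj j)) -> Mplus D f ->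
  {ae mu, forall x, D x ->
      nondecreasing_seq (fun j => fj j x) /\ fj j x @[j --> \oo] --> f x} ->
  nondecreasing_seq (fun j => lorentz_sup (fj j)) /\
  lorentz_sup (fj j) @[j --> \oo] --> lorentz_sup f.
Proof.
move=> Mfj Mf /ae_nondecreasing_le[h1 [h2 h3]].
have nd : nondecreasing_seq (fun j => lorentz_sup (fj j)).
  by move=> i j ij; apply: lorentz_sup_le => //; exact: h1.
split; first exact: nd.
apply: nondecreasing_sup_cvg; first exact: nd.
  by move=> j; apply: lorentz_sup_le => //; exact: h2.
move=> c hc; apply: ge_ereal_sup => _ [w Ww <-].
apply: (@integral_eventually_above_le _ _ _ (lebesgue_line R) H _ _
  (fun j s => rearr mu D (fj j) s * w (s : R))).
- exact: measurable_halfline.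
- exact: mrW.
- by move=> j; exact: mrW.
- by move=> s /halflineP; exact: rW0.
- by move=> j s /halflineP; exact: rW0.
- apply: aeW => s /halflineP s0; rewrite muleC.
  under [X in eventually_above _ X]eq_fun do rewrite muleC.
  apply: eventually_above_mule; first exact: W0.
    by move=> j; exact: rearr_ge0.
  apply: rearr_eventually_above => //; [by case: Mf|by move=> j; case: (Mfj j)|].
  have pos j : {ae mu, forall x, D x -> `|fj j x| = fj j x}.
    by apply: aeW => x Dx; rewrite gee0_abs//; case: (Mfj j) => _; exact.
  have [_ f0] := Mf.
  apply: filterS h3 => x h Dx; rewrite gee0_abs ?f0// => y y0 yf.
  have [n hn] := h Dx y y0 yf; exists n => j nj.
  by rewrite gee0_abs ?hn//; case: (Mfj j) => _; exact.
- by move=> j; apply: le_trans (hc j); exact: lorentz_sup_ge.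
Qed.

(** The rearrangement of the indicator of E lives on (0, mu E), where the weights have
    uniformly bounded integrals. *)
Lemma lorentz_sup_finite (E : set T) : measurable E -> E `<=` D -> mu E < +oo ->
  lorentz_sup (fun x => (\1_E x)%:E) < +oo.
Proof.
move=> mE ED muE.
have Efin : mu E \is a fin_num by rewrite ge0_fin_numE.
pose a := (fine (mu E) + 1)%R.
have a0 : (0 < a)%R by rewrite ltr_wpDl// fine_ge0.
have [C hC] := W_bounded a0.
have [m1 _] := @Mplus_indic R d T D E mE.
have r1 s : (0 < s)%R ->
    rearr mu D (fun x => (\1_E x)%:E) s <= (if (s < a)%R then 1 else 0).
  move=> s_gt0; case: ifPn => [_|]; first last.
    rewrite -leNgt => as_; apply/rearr_leP => //.
    apply: (@le_trans _ _ (mu E)); last first.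
      by rewrite -(fineK Efin) lee_fin (le_trans _ as_)// lerDl.
    apply: le_measure; rewrite ?inE//; first exact: measurable_superlevel.
    move=> x /= [_]; rewrite lte_fin indicE.
    by case: (boolP (x \in E)) => [/set_mem//|_]; rewrite normr0 ltxx.
  apply/rearr_leP => //; rewrite /distrib (_ : _ `&` _ = set0) ?measure0 ?lee_fin ?ltW//.
  apply/seteqP; split => x //= [_]; rewrite lte_fin indicE.
  by case: (x \in E); rewrite /= ?normr1 ?normr0 ?ltxx ?ltr10.
apply: (@le_lt_trans _ _ C%:E); last exact: ltry.
apply: ge_ereal_sup => _ [w Ww <-]; apply: le_trans (hC w Ww).
rewrite integral_below; apply: (@le_integral_halfline R
  (fun s => rearr mu D (fun x => (\1_E x)%:E) s * w s)
  (fun s => if (s < a)%R then w s else 0)).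
- exact: mrW.
- by apply: measurable_nonincreasing_line; apply: nonincreasing_below; [exact: nW|exact: W0].
- exact: rW0.
- move=> s s_gt0; apply: (@le_trans _ _ ((if (s < a)%R then 1 else 0) * w s)).
    by apply: lee_wpmul2r; [exact: W0|exact: r1].
  by case: ifP => _; rewrite ?mul1e ?mul0e.
Qed.

Theorem lorentz_sup_ri_norm : is_ri_norm mu D lorentz_sup.
Proof.
split.
- by move=> f _; exact: lorentz_sup_ge0.
- exact: lorentz_sup_eq0.
- exact: lorentz_sup_homogeneous.
- exact: lorentz_sup_triangle.
- exact: lorentz_sup_le.
- exact: lorentz_sup_fatou.
- exact: lorentz_sup_finite.
- exact: lorentz_sup_integral.
- move=> f g Mf Mg fg; apply/eqP; rewrite eq_le; apply/andP; split;
    by apply: le_lorentz_sup => t t0; rewrite fg.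
Qed.

End lorentz_sup.

(** * The weights of the unit ball *)

Section weights.
Context (R : realType) (al C : R) (rhob : (line R -> \bar R) -> \bar R).
Hypotheses (al0 : (0 < al)%R) (al1 : (al < 1)%R) (C0 : (0 < C)%R).
Local Notation H := (halfline R).
Local Notation below s := (H `&` [set y : line R | (y : R)%:E < (s : R)%:E]).
Hypothesis rhob_ri : is_ri_norm (lebesgue_line R) H rhob.
Hypothesis sup_op_bounded : forall h, ri_space H rhob h ->
  ri_space H rhob (sup_op al h) /\ ri_norm rhob (sup_op al h) <= C%:E * ri_norm rhob h.

Definition unit_ball : set (line R -> \bar R) :=
  [set h | ri_space H rhob h /\ ri_norm rhob h <= 1].

Definition weights : set (R -> \bar R) := [set weight al h | h in unit_ball].

Lemma sup_op_unit_ball h : unit_ball h -> rhob (sup_op al h) <= C%:E.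
Proof.
move=> [hs h1]; have [_] := sup_op_bounded hs.
rewrite /ri_norm (_ : (fun x => `|sup_op al h x|) = sup_op al h); last first.
  by apply/funext => x; rewrite gee0_abs ?sup_op_ge0.
move=> /le_trans; apply; rewrite -[leRHS]mule1.
by apply: lee_wpmul2l => //; rewrite lee_fin ltW.
Qed.

(** Local integrability of X(0,oo) bounds the integrals of T_al h over (0, a)
    uniformly over the ball, so the weights are dominated by a multiple of
    s^(al-1), which is integrable at 0. *)
Lemma weights_bounded (a : R) : (0 < a)%R ->
  exists K : R, forall w, weights w -> \int[lebesgue_line R]_(s in below a) w s <= K%:E.
Proof.
move=> a0; have mB := @measurable_line_belowe R a%:E.
have BH : below a `<=` H by move=> ? [].
have muB : lebesgue_line R (below a) < +oo.
  have -> : lebesgue_line R (below a) = a%:E by apply: lebesgue_line_below; rewrite lee_fin ltW.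
  exact: ltry.
have [K [K0 hK]] := ri_integral rhob_ri mB BH muB.
have Ifin := integral_powR_fin al0 al1 a0.
set I := (\int[_]_(_ in _) _) in Ifin.
have I0 : 0 <= I by apply: integral_ge0 => y _; rewrite lee_fin powR_ge0.
exists (K * C * fine I)%R => _ [h hb <-].
have Mh : Mplus H (sup_op al h).
  by split; [exact: measurable_sup_op|move=> ? _; exact: sup_op_ge0].
have KC : (0 <= K * C)%R by rewrite mulr_ge0 ?ltW.
have np : nonincreasing_on_pos (fun y : R => (y `^ (al - 1))%:E).
  by rewrite -(opprB 1 al); apply: nonincreasing_powRN; rewrite subr_ge0 ltW.
have mp : measurable_fun (below a) (fun y : line R => ((y : R) `^ (al - 1))%:E).
  by apply: measurable_funS (measurable_nonincreasing_line np) => [|? []//]; exact: measurable_halfline.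
rewrite EFinM fineK ?ge0_fin_numE// /I -ge0_integralZl_EFin//; last first.
  by move=> y _; rewrite lee_fin powR_ge0.
apply: ge0_le_integral.
- exact: mB.
- by move=> s [/halflineP s0 _]; exact: weight_ge0.
- by apply: measurable_funS (measurable_weight al0 h) => [|? []//]; exact: measurable_halfline.
- by apply: emeasurable_funM => //; exact: measurable_cst.
- move=> s [/halflineP s0 /= sa]; rewrite weightE// muleC; apply: lee_wpmul2r.
    by rewrite lee_fin powR_ge0.
  apply: (@le_trans _ _ (K%:E * rhob (sup_op al h))); last first.
    by rewrite EFinM; apply: lee_wpmul2l; [rewrite lee_fin ltW|exact: sup_op_unit_ball].
  apply: le_trans (hK _ Mh); apply: ge0_subset_integral.
  + exact: measurable_line_belowe.
  + exact: mB.
  + by case: Mh => m _; apply: measurable_funS m => //; exact: measurable_halfline.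
  + by move=> y _; exact: sup_op_ge0.
  + by move=> y [Hy /= ys]; split => //=; exact: lt_trans ys sa.
Qed.

(** A weight coming from a multiple of the indicator of an interval, which is
    large enough by monotonicity. *)
Lemma weights_below (a : R) : (0 < a)%R -> exists c : R, (0 < c)%R /\
  exists2 w, weights w & forall s, (0 < s)%R -> (s < a)%R -> c%:E <= w s.
Proof.
move=> a0; have a20 : (0 < 2 * a)%R by rewrite mulr_gt0.
have mB := @measurable_line_belowe R (2 * a)%:E.
set B := (_ `&` _) in mB.
have BH : B `<=` H by move=> ? [].
have EB : lebesgue_line R B = (2 * a)%:E by apply: lebesgue_line_below; rewrite lee_fin ltW.
have muB : lebesgue_line R B < +oo by rewrite EB ltry.
have M1 := @Mplus_indic R _ _ H B mB.
have rB := ri_finite rhob_ri mB BH muB; have rB0 := ri_ge0 rhob_ri M1.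
have rBfin : rhob (fun x => (\1_B x)%:E) \is a fin_num by rewrite ge0_fin_numE.
pose N := (fine (rhob (fun x => (\1_B x)%:E)) + 1)%R.
have N0 : (0 < N)%R by rewrite ltr_wpDl// fine_ge0.
have Ni0 : (0 < N^-1)%R by rewrite invr_gt0.
pose h y := N^-1%:E * (\1_B y)%:E : \bar R.
have Mh : Mplus H h by apply: MplusZ => //; exact: ltW.
have habs : (fun x => `|h x|) = h.
  by apply/funext => x; rewrite gee0_abs// mule_ge0 ?lee_fin ?(ltW Ni0).
have h1 : ri_norm rhob h <= 1.
  rewrite /ri_norm habs (ri_homogeneous rhob_ri (ltW Ni0) M1) -(fineK rBfin) -EFinM lee_fin.
  by rewrite mulrC ler_pdivrMr// mul1r lerDl.
have hb : unit_ball h.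
  by split => //; split; [case: Mh|exact: le_lt_trans h1 (ltry _)].
have ra : N^-1%:E <= rearr_halfline h a.
  rewrite /rearr_halfline /h rearrZ// -[leLHS]mule1; apply: lee_wpmul2l.
    by rewrite lee_fin ltW.
  apply: lee_fin_lbound => [|l l0]; first exact: rearr_ge0.
  rewrite lte_fin => l1; have [m1 _] := M1.
  apply/ltW/(rearr_gtP _ (@measurable_halfline R) _ m1 l0).
  have -> : distrib (lebesgue_line R) H (fun x => (\1_B x)%:E) l = (2 * a)%:E.
    rewrite -EB /distrib; congr (lebesgue_line R _); apply/seteqP; split => y /=.
      move=> [_]; rewrite lte_fin indicE.
      case: (boolP (y \in B)) => [/set_mem//|_]; rewrite normr0 => /(le_lt_trans l0).
      by rewrite ltxx.
    move=> By; split; first exact: BH.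
    by rewrite indicE mem_set// normr1 lte_fin.
  by rewrite lte_fin; rewrite mulr_natl mulr2n ltrDl.
exists (a `^ (al - 1) * (N^-1 * a))%R; split.
  by rewrite !mulr_gt0 ?powR_gt0.
exists (weight al h) => [|s s0 sa]; first by exists h.
apply: le_trans (nonincreasing_weight al0 h s0 (ltW sa)).
apply: le_trans (rearr_le_weight al0 h a0).
rewrite EFinM; apply: lee_wpmul2l; first by rewrite lee_fin powR_ge0.
have -> : (N^-1 * a)%:E = \int[lebesgue_line R]_(y in below a) N^-1%:E.
  rewrite integral_cst; last exact: measurable_line_belowe.
  by rewrite EFinM; congr (_ * _); symmetry; apply: lebesgue_line_below; rewrite lee_fin ltW.
apply: ge0_le_integral.
- exact: measurable_line_belowe.
- by move=> ? _; rewrite lee_fin ltW.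
- exact: measurable_cst.
- have mr : measurable_fun H (rearr_halfline h) by exact: measurable_rearr.
  by apply: measurable_funS mr => [|? []//]; exact: measurable_halfline.
- move=> y [/halflineP y0 /=]; rewrite lte_fin => ya.
  by apply: le_trans ra _; apply: nonincreasing_rearr => //; exact: ltW.
Qed.

End weights.

(** * Nonincreasing functions of the radial map *)

Section nonincreasing_comp.
Context (R : realType) (d : measure_display) (T : measurableType d).
Variables (mu : {sigma_finite_measure set T -> \bar R}) (D : set T) (V : T -> R).
Hypotheses (mD : measurable D) (UV : uniformizes mu D V).
Variable u : R -> \bar R.
Hypotheses (nu : nonincreasing_on_pos u) (u0 : forall s, (0 < s)%R -> 0 <= u s).
Local Notation H := (halfline R).

Lemma integral_le_comp : \int[lebesgue_line R]_(s in H) u s <= \int[mu]_(x in D) u (V x).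
Proof.
have mH := @measurable_halfline R; have UL := @uniformizes_line R.
apply: le_integral_distrib => //.
- exact: measurable_nonincreasing_line.
- by move=> s /halflineP; exact: u0.
- exact: (measurable_nonincreasing_comp mD UV nu).
- by move=> x /(unif_gt0 UV); exact: u0.
- by move=> l /ltW; exact: (le_distrib_comp mH UL mD UV nu u0).
Qed.

Lemma rearr_comp t : rearr mu D (u \o V) t = rearr_halfline u t.
Proof.
have mH := @measurable_halfline R; have UL := @uniformizes_line R.
have muV := measurable_nonincreasing_comp mD UV nu.
have mu_ := measurable_nonincreasing_line nu.
apply: eq_rearr => // l l0; apply/eqP; rewrite eq_le; apply/andP; split.
  exact: (le_distrib_comp mD UV mH UL nu u0 l0).
exact: (le_distrib_comp mH UL mD UV nu u0 l0).
Qed.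

Lemma rearr_comp_le t : (0 < t)%R -> rearr mu D (u \o V) t <= u t.
Proof.
move=> t0; have muV := measurable_nonincreasing_comp mD UV nu.
apply: lee_fin_lbound => [|l l0]; first exact: u0.
move=> /(rearr_gtP _ mD t muV l0); rewrite ltNge => /negP lt; apply/ltW.
rewrite ltNge; apply/negP => ul; apply: lt; rewrite -(unif_below UV t0).
apply: le_measure; rewrite ?inE.
- exact: measurable_superlevel.
- exact: (measurable_unif_below mD UV).
move=> x [Dx /=]; have Vx := unif_gt0 UV Dx; rewrite gee0_abs ?u0// => lu.
split => //=; rewrite ltNge; apply/negP => tV.
by have := lt_le_trans lu (le_trans (nu t0 tV) ul); rewrite ltxx.
Qed.

End nonincreasing_comp.

(** u o V is equimeasurable with u, whose norm in the representation space is thus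
    that of u o V. *)
Lemma representation_comp (R : realType) (n : nat) (n0 : (0 < n)%N)
    (rho : (Rn R n -> \bar R) -> \bar R) (rhob : (line R -> \bar R) -> \bar R) (u : R -> \bar R) :
  is_representation rho rhob -> nonincreasing_on_pos u ->
  (forall s, (0 < s)%R -> 0 <= u s) -> rho (u \o @radial R n) = rhob u.
Proof.
move=> [rhob_ri rhobE] nu u0; have mT := @measurableT _ (Rn R n).
have UV := uniformizes_radial R n0; have mH := @measurable_halfline R.
have muV : measurable_fun setT (u \o @radial R n) := measurable_nonincreasing_comp mT UV nu.
have -> : rho (u \o @radial R n) = ri_norm rho (u \o @radial R n).
  by congr rho; apply/funext => x; rewrite gee0_abs// u0// radial_gt0.
rewrite rhobE// /ri_norm; apply: (ri_rearr rhob_ri).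
- by apply: Mplus_abs; exact: measurable_rearr.
- split; first exact: measurable_nonincreasing_line.
  by move=> s /halflineP; exact: u0.
- move=> t t0; rewrite rearr_abse; transitivity (rearr_Rn (u \o @radial R n) t).
    exact: rearr_rearr.
  exact: rearr_comp.
Qed.

(** * The functional tau *)

Section optimal_range.
Context (R : realType) (n : nat) (gamma C : R).
Hypotheses (gamma_gt0 : (0 < gamma)%R) (gamma_lt : (gamma < n%:R)%R).
Local Notation mu := (lebesgue_Rn R n).
Local Notation al := (gamma / n%:R)%R.
Local Notation H := (halfline R).
Local Notation below s := (H `&` [set y : line R | (y : R)%:E < (s : R)%:E]).
Variables (rho : (Rn R n -> \bar R) -> \bar R) (rhob : (line R -> \bar R) -> \bar R).
Hypothesis rho_ri : is_ri_norm mu setT rho.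
Hypothesis rhob_ri : is_ri_norm (lebesgue_line R) H rhob.
Hypothesis rhobE : forall f, Mfun setT f -> ri_norm rho f = ri_norm rhob (rearr_Rn f).
Hypothesis C0 : (0 < C)%R.
Hypothesis sup_op_bounded : forall h, ri_space H rhob h ->
  ri_space H rhob (sup_op al h) /\ ri_norm rhob (sup_op al h) <= C%:E * ri_norm rhob h.
Implicit Types f g : Rn R n -> \bar R.

Let n0 : (0 < n)%N.
Proof. by rewrite -(ltr0n R); exact: lt_trans gamma_gt0 gamma_lt. Qed.
Let al0 : (0 < al)%R. Proof. exact: exponent_gt0. Qed.
Let al1 : (al < 1)%R. Proof. exact: exponent_lt1. Qed.
Let UV := uniformizes_radial R n0.
Local Notation V := (@radial R n).
Let mT : measurable (setT : set (Rn R n)) := measurableT.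
Let mH := @measurable_halfline R.
Local Notation W := (weights al rhob).
Local Notation B := (unit_ball rhob).

Lemma tau_lorentz f : tau gamma rhob f = lorentz_sup mu setT W f.
Proof.
rewrite /tau /lorentz_sup; congr ereal_sup; apply/seteqP; split => y /=.
  move=> [h hb <-]; exists (weight al h); first by exists h.
  by apply: eq_integral => s _; rewrite /weight muleA.
move=> [_ [h hb <-] <-]; exists h; first exact: hb.
by apply: eq_integral => s _; rewrite /weight -muleA.
Qed.

Theorem tau_ri_norm : is_ri_norm mu setT (tau gamma rhob : (Rn R n -> \bar R) -> \bar R).
Proof.
have -> : tau gamma rhob = lorentz_sup mu setT W by apply/funext; exact: tau_lorentz.
apply: (lorentz_sup_ri_norm mT UV).
- by move=> _ [h _ <-]; exact: nonincreasing_weight.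
- by move=> _ [h _ <-] s; exact: weight_ge0.

- by move=> a a0; exact: (weights_bounded al0 al1 C0 rhob_ri sup_op_bounded).
- by move=> a a0; exact: (weights_below al0 rhob_ri).
Qed.

Lemma tau_ge f h : B h ->
  \int[lebesgue_line R]_(s in H) (rearr mu setT f s * weight al h s) <= tau gamma rhob f.
Proof.
by move=> Bh; rewrite tau_lorentz; apply: lorentz_sup_ge; exists h.
Qed.

Lemma tau_le f (c : \bar R) : (forall h, B h ->
  \int[lebesgue_line R]_(s in H) (rearr mu setT f s * weight al h s) <= c) -> tau gamma rhob f <= c.
Proof.
move=> hc; rewrite tau_lorentz; apply: ge_ereal_sup => _ [_ [h Bh <-] <-].
exact: hc.
Qed.

(** * Boundedness of the fractional maximal operator *)

(** The volume S of the selected cubes is at least 3^-n t, and the bound on the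
    integral of f^* over (0, S) is a lower bound for the weight at S.  If S < t, the
    integral over (0, t) is still as large, and the power of t loses at most 3^n. *)
Lemma rearr_frac_max_le f (t : R) : (0 < t)%R -> Mfun setT f ->
  rearr_Rn (frac_max gamma f) t <= (3 ^+ n)%:E * weight al (rearr_Rn f) t.
Proof.
move=> t0 mf; have mM := measurable_frac_max gamma_gt0 gamma_lt mf.
have wt0 := weight_ge0 al (rearr_Rn f) t0.
pose K : R := (3 ^+ n)%R; have K1 : (1 <= K)%R by rewrite exprn_ege1// ler1n.
have K0 : (0 < K)%R by exact: lt_le_trans ltr01 K1.
apply: lee_fin_lbound => [|l l0]; first by rewrite mule_ge0 ?lee_fin ?(ltW K0).
move=> /(rearr_gtP _ mT t mM l0); rewrite /distrib setTI.
rewrite (_ : [set x | _] = [set x | l%:E < frac_max gamma f x]); last first.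
  by apply/seteqP; split => x /=; rewrite gee0_abs// frac_max_ge0.
move=> /(frac_max_weak gamma_gt0 gamma_lt mf l0 t0)[S [S0 tS hS]].
have wS : l%:E <= weight al (rearr_Rn f) S.
  apply: le_trans (rearr_le_weight al0 (rearr_Rn f) S0).
  rewrite (_ : l%:E = (S `^ (al - 1))%:E * (l * S `^ (1 - al))%:E); last first.
    rewrite -EFinM mulrCA -powRD ?(gt_eqF S0) ?implybT//.
    by rewrite addrC addrA subrK subrr powRr0 mulr1.
  apply: lee_wpmul2l; first by rewrite lee_fin powR_ge0.
  apply: le_trans hS _; rewrite le_eqVlt; apply/orP; left; apply/eqP.
  by apply: eq_integral => s _; rewrite rearr_rearr.
have [tS'|St] := leP t S.
  apply: le_trans wS _; apply: le_trans (nonincreasing_weight al0 (rearr_Rn f) t0 tS') _.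
  by rewrite -[leLHS]mul1e; apply: lee_wpmul2r.
have : (t `^ (al - 1))%:E * (l * S `^ (1 - al))%:E <= weight al (rearr_Rn f) t.
  apply: le_trans (rearr_le_weight al0 (rearr_Rn f) t0).
  apply: lee_wpmul2l; first by rewrite lee_fin powR_ge0.
  apply: le_trans hS _; apply: (@le_trans _ _
    (\int[lebesgue_line R]_(s in below S) rearr_halfline (rearr_Rn f) s)).
    rewrite le_eqVlt; apply/orP; left; apply/eqP.
    by apply: eq_integral => s _; rewrite rearr_rearr.
  apply: ge0_subset_integral.
  - exact: measurable_line_belowe.
  - exact: measurable_line_belowe.
  - have mr : measurable_fun H (rearr_halfline (rearr_Rn f)) by exact: measurable_rearr.
    by apply: measurable_funS mr => [|? []//]; exact: measurable_halfline.
  - by move=> y _; exact: rearr_ge0.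
  - by move=> y [Hy /= yS]; split => //=; exact: lt_trans yS _.
have Ki : (0 <= 1 - al)%R by rewrite subr_ge0 ltW.
have pK : (1 <= K * (t `^ (al - 1) * S `^ (1 - al)))%R.
  have KK : (K `^ (1 - al) <= K)%R.
    by rewrite -[leRHS]powRr1 ?(ltW K0)//; apply: ler_powR => //; rewrite gerBl ltW.
  apply: (@le_trans _ _ (K `^ (1 - al) * (t `^ (al - 1) * S `^ (1 - al)))%R); last first.
    by apply: ler_wpM2r => //; rewrite mulr_ge0 ?powR_ge0.
  rewrite mulrCA -powRM ?(ltW K0) ?(ltW S0)//.
  have tt : (t `^ (al - 1) * t `^ (1 - al) = 1)%R.
    by rewrite -powRD ?(gt_eqF t0) ?implybT// addrA subrK subrr powRr0.
  rewrite -[leLHS]tt.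
  apply: ler_wpM2l; first exact: powR_ge0.
  by apply: ge0_ler_powR; rewrite ?nnegrE ?(ltW t0)// mulr_ge0 ?ltW.
move=> h; apply: (@le_trans _ _ (K%:E * ((t `^ (al - 1))%:E * (l * S `^ (1 - al))%:E))).
  rewrite -!EFinM lee_fin (_ : K * _ = l * (K * (t `^ (al - 1) * S `^ (1 - al))))%R; last by ring.
  by rewrite -[leLHS]mulr1; apply: ler_wpM2l.
by apply: lee_wpmul2l; [rewrite lee_fin ltW|exact: h].
Qed.

Lemma integral_weight_le f h (N : R) : (0 < N)%R -> ri_space H rhob h ->
  ri_norm rhob h <= N%:E ->
  \int[lebesgue_line R]_(s in H) (rearr mu setT f s * weight al h s) <=
  N%:E * tau gamma rhob f.
Proof.
move=> N0 [mh hfin] hN; have Ni0 : (0 < N^-1)%R by rewrite invr_gt0.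
pose h' y := N^-1%:E * h y.
have nh' : ri_norm rhob h' = N^-1%:E * ri_norm rhob h.
  rewrite /ri_norm -(ri_homogeneous rhob_ri (ltW Ni0) (Mplus_abs mh)).
  by congr rhob; apply/funext => y; rewrite abseM gee0_abs// lee_fin ltW.
have h'1 : ri_norm rhob h' <= 1 by rewrite nh' lee_pdivrMl// mule1.
have Bh' : B h'.
  split => //; split; last exact: le_lt_trans h'1 (ltry _).
  by apply: emeasurable_funM => //; exact: measurable_cst.
rewrite -lee_pdivrMl//; apply: le_trans (tau_ge f Bh').
rewrite -ge0_integralZl_EFin; first last.
- exact: ltW.
- by apply: emeasurable_funM; [exact: measurable_rearr|exact: measurable_weight].
- by move=> s /halflineP s0; rewrite mule_ge0 ?rearr_ge0 ?weight_ge0.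
- exact: mH.
rewrite le_eqVlt; apply/orP; left; apply/eqP.
apply: eq_integral => s /set_mem/halflineP s0; rewrite muleCA; congr (_ * _).
by symmetry; apply: weightZ => // t t0; rewrite /rearr_halfline /h' rearrZ.
Qed.

(** The norm of f may vanish, hence the e: f^* is divided by a number slightly larger
    than its norm to land in the unit ball. *)
Theorem frac_max_bounded : bounded_op setT (frac_max gamma) rho
  (associate mu setT (tau gamma rhob)).
Proof.
have K0 : (0 < 3 ^+ n :> R)%R by rewrite exprn_gt0.
exists (3 ^+ n)%R; split => // f [mf ffin].
have mM := measurable_frac_max gamma_gt0 gamma_lt mf.
have Mabs : (fun x => `|frac_max gamma f x|) = frac_max gamma f.
  by apply/funext => x; rewrite gee0_abs// frac_max_ge0.
have N0 : 0 <= ri_norm rho f by apply: (ri_ge0 rho_ri); exact: Mplus_abs.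
have Nfin : ri_norm rho f \is a fin_num by rewrite ge0_fin_numE.
have fs : ri_space H rhob (rearr_Rn f).
  by split; [exact: measurable_rearr|rewrite -rhobE].
suff le : ri_norm (associate mu setT (tau gamma rhob)) (frac_max gamma f) <=
    (3 ^+ n)%:E * ri_norm rho f.
  split => //; split => //; apply: le_lt_trans le _.
  by rewrite lte_mul_pinfty// lee_fin ltW.
rewrite /ri_norm Mabs; apply: ge_ereal_sup => _ [k [[mk k0] k1] <-].
apply: le_trans (hardy_littlewood mu mT mk mM k0 _) _; first by move=> x _; exact: frac_max_ge0.
apply: (@le_trans _ _ ((3 ^+ n)%:E * \int[lebesgue_line R]_(s in H)
    (rearr mu setT k s * weight al (rearr_Rn f) s))).
  rewrite -ge0_integralZl_EFin; first last.
  - exact: ltW.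
  - by apply: emeasurable_funM; [exact: measurable_rearr|exact: measurable_weight].
  - by move=> s /halflineP s0; rewrite mule_ge0 ?rearr_ge0 ?weight_ge0.
  - exact: mH.
  apply: (@le_integral_halfline R
    (fun s => rearr mu setT k s * rearr mu setT (frac_max gamma f) s)
    (fun s => (3 ^+ n)%:E * (rearr mu setT k s * weight al (rearr_Rn f) s))).
  - by apply: emeasurable_funM; exact: measurable_rearr.
  - apply: emeasurable_funM; first exact: measurable_cst.
    by apply: emeasurable_funM; [exact: measurable_rearr|exact: measurable_weight].
  - by move=> s s0; rewrite mule_ge0 ?rearr_ge0.
  - move=> s s0; rewrite muleCA; apply: lee_wpmul2l; first exact: rearr_ge0.
    exact: rearr_frac_max_le.
apply: lee_wpmul2l; first by rewrite lee_fin ltW.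
apply/lee_addgt0Pr => e e0.
have Ne0 : (0 < fine (ri_norm rho f) + e)%R by rewrite ltr_wpDl// fine_ge0.
apply: (le_trans (integral_weight_le k Ne0 fs _)).
  by rewrite -rhobE// EFinD fineK// leeDl// lee_fin ltW.
rewrite EFinD fineK// -[leRHS]mule1; apply: lee_wpmul2l => //.
by rewrite adde_ge0// lee_fin ltW.
Qed.

Lemma rho_sup_op_le h : B h -> rho (sup_op al h \o V) <= C%:E.
Proof.
move=> Bh; have nu := nonincreasing_sup_op al0 h.
rewrite (representation_comp n0 (conj rhob_ri rhobE) nu); last by move=> s _; exact: sup_op_ge0.
exact: sup_op_unit_ball C0 sup_op_bounded _ Bh.
Qed.

(** * Optimality of the range *)

(** M_gamma (T_al h o V) dominates the weight of h composed with V. *)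
Lemma zeta_weight_le (zeta : (Rn R n -> \bar R) -> \bar R) (K : R) h :
  is_ri_norm mu setT zeta -> (0 < K)%R ->
  (forall f, ri_space setT rho f -> ri_norm zeta (frac_max gamma f) <= K%:E * ri_norm rho f) ->
  B h -> zeta (weight al h \o V) <= (K * C)%:E.
Proof.
move=> zeta_ri K0 hK Bh; have nu := nonincreasing_sup_op al0 h.
have u0 (s : R) : (0 < s)%R -> 0 <= sup_op al h s by move=> _; exact: sup_op_ge0.
have [mu_ _] := Mplus_comp mT UV nu u0.
have nrm : ri_norm rho (sup_op al h \o V) <= C%:E.
  rewrite /ri_norm (_ : (fun x => _) = sup_op al h \o V); first exact: rho_sup_op_le.
  by apply/funext => x; rewrite gee0_abs// sup_op_ge0.
have us : ri_space setT rho (sup_op al h \o V).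
  by split => //; exact: le_lt_trans nrm (ltry _).
rewrite EFinM; apply: le_trans (lee_wpmul2l _ nrm); last by rewrite lee_fin ltW.
apply: le_trans (hK _ us); apply: (ri_le zeta_ri).
- apply: (Mplus_comp mT UV); first exact: nonincreasing_weight.
  by move=> s; exact: weight_ge0.
- by apply: Mplus_abs; exact: measurable_frac_max.
- move=> x _; rewrite gee0_abs ?frac_max_ge0//=.
  rewrite weightE ?radial_gt0//.
  exact: frac_max_radial.
Qed.

(** The product of f^* and the weight is nonincreasing, so composing it with V keeps
    its integral, to which Hoelder's inequality for zeta applies on R^n. *)
Lemma tau_le_assoc (zeta : (Rn R n -> \bar R) -> \bar R) (K : R) f :
  is_ri_norm mu setT zeta -> (0 < K)%R ->
  (forall h, B h -> zeta (weight al h \o V) <= K%:E) -> Mplus setT f ->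
  tau gamma rhob f <= K%:E * associate mu setT zeta f.
Proof.
move=> zeta_ri K0 hK Mf; have [mf f0] := Mf; apply: tau_le => h Bh.
have nr := @nonincreasing_rearr _ _ _ mu setT f.
have nw := nonincreasing_weight al0 h.
have w0 s := @weight_ge0 R al h s.
have r0 s : (0 < s)%R -> 0 <= rearr mu setT f s by move=> _; exact: rearr_ge0.
have MrV := Mplus_comp mT UV nr r0; have MwV := Mplus_comp mT UV nw w0.
have np : nonincreasing_on_pos (fun s => rearr mu setT f s * weight al h s).
  move=> s t s0 st; apply: lee_pmul; [exact: rearr_ge0| |exact: nr|exact: nw].
  by apply: w0; exact: lt_le_trans s0 st.
apply: le_trans (integral_le_comp mT UV np _) _.
  by move=> s s0; rewrite mule_ge0 ?r0 ?w0.
under eq_integral do rewrite muleC.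
apply: le_trans (assoc_holder mT zeta_ri K0 MwV MrV (hK _ Bh)) _.
apply: lee_wpmul2l; first by rewrite lee_fin ltW.
apply: (assoc_le_rearr mT UV zeta_ri) => // t t0.
rewrite (_ : rearr mu setT _ t = rearr mu setT f t)//.
apply: eq_rearr; [exact: mT|exact: mT|by case: MrV|exact: mf|move=> l l0].
exact: distrib_rearr_comp.
Qed.

(** tau <= K zeta' passes to the associate norms as zeta'' <= K tau'. *)
Theorem range_optimal (zeta : (Rn R n -> \bar R) -> \bar R) :
  is_ri_norm mu setT zeta -> bounded_op setT (frac_max gamma) rho zeta ->
  embedded setT (associate mu setT (tau gamma rhob)) zeta.
Proof.
move=> zeta_ri [K [K0 hK]].
have KC0 : (0 < K * C)%R by rewrite mulr_gt0.
exists (K * C)%R; split => // f [mf ffin]; have Mf := Mplus_abs mf.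
have tau_ri := tau_ri_norm.
have hW h : B h -> zeta (weight al h \o V) <= (K * C)%:E.
  by apply: zeta_weight_le => // g gs; case: (hK g gs).
suff le : ri_norm zeta f <= (K * C)%:E * ri_norm (associate mu setT (tau gamma rhob)) f.
  by split => //; split => //; apply: le_lt_trans le _; rewrite lte_mul_pinfty// lee_fin ltW.
apply: le_trans (lorentz_luxemburg mT UV zeta_ri Mf) _.
apply: ge_ereal_sup => _ [g [Mg g1] <-].
apply: (assoc_holder mT tau_ri KC0 Mg Mf).
apply: le_trans (tau_le_assoc zeta_ri KC0 hW Mg) _.
by rewrite -[leRHS]mule1; apply: lee_wpmul2l => //; rewrite lee_fin ltW.
Qed.

(** * The dual Hardy operator *)

Lemma dual_hardy_ge0 f t : 0 <= dual_hardy gamma f t.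
Proof.
by apply: integral_ge0 => s _; rewrite mule_ge0 ?rearr_ge0// lee_fin powR_ge0.
Qed.

Let ker f (s : line R) : \bar R := rearr_Rn f s * ((s : R) `^ (al - 1))%:E.

Let measurable_ker f : measurable_fun H (ker f).
Proof.
apply: emeasurable_funM; first exact: measurable_rearr.
have np : nonincreasing_on_pos (fun y : R => (y `^ (al - 1))%:E).
  by rewrite -(opprB 1 al); apply: nonincreasing_powRN; rewrite subr_ge0 ltW.
exact: measurable_nonincreasing_line np.
Qed.

Let ker_ge0 f s : 0 <= ker f s.
Proof. by rewrite mule_ge0 ?rearr_ge0// lee_fin powR_ge0. Qed.

Lemma above_itv (t : R) : (0 < t)%R ->
  (`]t, +oo[%classic : set (line R)) = H `&` [set s : line R | t%:E < (s : R)%:E].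
Proof.
move=> t0; apply/seteqP; split => s /=; rewrite in_itv/= andbT lte_fin.
  by move=> ts; split => //; apply/halflineP; exact: lt_trans ts.
by move=> [].
Qed.

Lemma dual_hardyE f (t : R) : (0 < t)%R ->
  dual_hardy gamma f t = \int[lebesgue_line R]_(s in H `&` [set s : line R | t%:E < (s : R)%:E]) ker f s.
Proof. by move=> t0; rewrite /dual_hardy above_itv. Qed.

Lemma nonincreasing_dual_hardy f : nonincreasing_on_pos (dual_hardy gamma f : R -> \bar R).
Proof.
move=> s t s0 st; have t0 := lt_le_trans s0 st; rewrite !dual_hardyE//.
have mI (r : R) : measurable (H `&` [set x : line R | r%:E < (x : R)%:E]).
  by apply: measurable_superlevel_ge0 => //; exact: measurable_line_EFin.
apply: ge0_subset_integral.
- exact: mI.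
- exact: mI.
- by apply: measurable_funS (measurable_ker f) => [//|? []//].
- by move=> x _; exact: ker_ge0.
- by move=> x [Hx /= tx]; split => //=; apply: le_lt_trans tx; rewrite lee_fin.
Qed.

(** The Hardy operator, with the weight s^al, is the adjoint of the dual one. *)
Lemma integral_weightE f h :
  \int[lebesgue_line R]_(s in H) (rearr mu setT f s * weight al h s) =
  \int[lebesgue_line R]_(y in H) (sup_op al h y * dual_hardy gamma f y).
Proof.
transitivity (\int[lebesgue_line R]_(s in H)
    (ker f s * \int[lebesgue_line R]_(y in below s) sup_op al h y)).
  apply: eq_integral => s /set_mem/halflineP s0.
  by rewrite weightE// muleA.
rewrite (tonelli_kernel (lebesgue_line R) mH (measurable_line_EFin mH) (measurable_ker f)).
- apply: eq_integral => y /set_mem/halflineP y0; congr (_ * _).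
  by rewrite dual_hardyE.
- exact: measurable_sup_op.
- by move=> s _; exact: ker_ge0.
- by move=> s _; exact: sup_op_ge0.
Qed.

(** A competitor k for the associate norm may be replaced by T_al k^*, at the price of
    no constant, since k^* <= T_al k^*. *)
Lemma assoc_dual_hardy_le f : Mplus setT f ->
  associate mu setT rho (dual_hardy gamma f \o V) <= tau gamma rhob f.
Proof.
move=> Mf; apply: ge_ereal_sup => _ [k [Mk k1] <-]; have [mk k0] := Mk.
have nd := nonincreasing_dual_hardy f.
have d0 (s : R) : (0 < s)%R -> 0 <= dual_hardy gamma f s by move=> _; exact: dual_hardy_ge0.
have [mdV dV0] := Mplus_comp mT UV nd d0.
have kabs : (fun x => `|k x|) = k by apply/funext => x; rewrite gee0_abs// k0.
have nk : ri_norm rhob (rearr_Rn k) <= 1 by rewrite -rhobE// /ri_norm kabs.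
have Bk : B (rearr_Rn k).
  by split => //; split; [exact: measurable_rearr|exact: le_lt_trans nk (ltry _)].
apply: le_trans (tau_ge f Bk).
apply: le_trans (hardy_littlewood mu mT mk mdV k0 dV0) _.
have md := measurable_nonincreasing_line nd.
apply: (@le_trans _ _ (\int[lebesgue_line R]_(s in H) (sup_op al (rearr_Rn k) s * dual_hardy gamma f s))).
  apply: (@le_integral_halfline R
    (fun s => rearr mu setT k s * rearr mu setT (dual_hardy gamma f \o V) s)
    (fun s => sup_op al (rearr_Rn k) s * dual_hardy gamma f s)).
  - by apply: emeasurable_funM; exact: measurable_rearr.
  - by apply: emeasurable_funM => //; exact: measurable_sup_op.
  - by move=> s _; rewrite mule_ge0 ?rearr_ge0.
  - move=> s s0; apply: lee_pmul; [exact: rearr_ge0|exact: rearr_ge0| |].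
      by apply: le_trans (rearr_le_sup_op al _ s0); rewrite rearr_rearr.
    exact: (rearr_comp_le mT UV nd d0 s0).
by rewrite -integral_weightE.
Qed.

(** T_al h o V has norm at most C, and is thus a competitor up to that constant. *)
Lemma tau_le_assoc_dual_hardy f :
  tau gamma rhob f <= C%:E * associate mu setT rho (dual_hardy gamma f \o V).
Proof.
apply: tau_le => h Bh; rewrite integral_weightE.
have nd := nonincreasing_dual_hardy f; have ns := nonincreasing_sup_op al0 h.
have d0 (s : R) : (0 < s)%R -> 0 <= dual_hardy gamma f s by move=> _; exact: dual_hardy_ge0.
have s0 (s : R) : (0 < s)%R -> 0 <= sup_op al h s by move=> _; exact: sup_op_ge0.
have np : nonincreasing_on_pos (fun s => sup_op al h s * dual_hardy gamma f s).
  move=> s t t0 st; apply: lee_pmul; [exact: sup_op_ge0|exact: dual_hardy_ge0| |].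
    exact: ns.
  exact: nd.
apply: le_trans (integral_le_comp mT UV np _) _.
  by move=> s t0; rewrite mule_ge0 ?s0 ?d0.
exact: (assoc_holder mT rho_ri C0 (Mplus_comp mT UV ns s0) (Mplus_comp mT UV nd d0)
  (rho_sup_op_le Bh)).
Qed.

Theorem tau_equivalent (rhob' : (line R -> \bar R) -> \bar R) f :
  is_representation (associate mu setT rho) rhob' -> Mplus setT f ->
  ri_norm rhob' (dual_hardy gamma f) <= tau gamma rhob f /\
  tau gamma rhob f <= C%:E * ri_norm rhob' (dual_hardy gamma f).
Proof.
move=> rep Mf.
have -> : ri_norm rhob' (dual_hardy gamma f) =
    associate mu setT rho (dual_hardy gamma f \o V).
  rewrite (representation_comp n0 rep (nonincreasing_dual_hardy f)); last first.
    by move=> s _; exact: dual_hardy_ge0.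
  by congr rhob'; apply/funext => s; rewrite gee0_abs// dual_hardy_ge0.
by split; [exact: assoc_dual_hardy_le|exact: tau_le_assoc_dual_hardy].
Qed.

End optimal_range.

Unset Implicit Arguments.
Set Strict Implicit.
Set Printing Implicit Defensive.

Theorem theorem4p2 (R : realType) (n : nat) (gamma : R)
  (rho : (Rn R n -> \bar R) -> \bar R)
  (rhob : (line R -> \bar R) -> \bar R)
  (gamma_gt0 : (0 < gamma)%R) (gamma_lt : (gamma < n%:R)%R)
  (rho_ri : is_ri_norm (lebesgue_Rn R n) setT rho)
  (rhob_repr : is_representation rho rhob)
  (sup_bounded : bounded_op (halfline R) (sup_op (gamma / n%:R)) rhob rhob) :
  let tau_X := tau gamma rhob : (Rn R n -> \bar R) -> \bar R in
  let tau_X' := associate (lebesgue_Rn R n) setT tau_X in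
  [/\ is_ri_norm (lebesgue_Rn R n) setT tau_X,
      is_ri_norm (lebesgue_Rn R n) setT tau_X',
      bounded_op setT (frac_max gamma) rho tau_X',
      forall zeta : (Rn R n -> \bar R) -> \bar R,
        is_ri_norm (lebesgue_Rn R n) setT zeta ->
        bounded_op setT (frac_max gamma) rho zeta ->
        embedded setT tau_X' zeta
    & forall rhob' : (line R -> \bar R) -> \bar R,
        is_representation (associate (lebesgue_Rn R n) setT rho) rhob' ->
        exists c C : R, [/\ (0 < c)%R, (0 < C)%R &
          forall f : Rn R n -> \bar R, Mplus setT f ->
            c%:E * ri_norm rhob' (dual_hardy gamma f) <= tau_X f /\
            tau_X f <= C%:E * ri_norm rhob' (dual_hardy gamma f)] ].

Proof.
have [rhob_ri rhobE] := rhob_repr; have [C [C0 hC]] := sup_bounded.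
have tau_ri := tau_ri_norm gamma_gt0 gamma_lt rhob_ri C0 hC.
have n0 : (0 < n)%N by rewrite -(ltr0n R); exact: lt_trans gamma_gt0 gamma_lt.
split.
- exact: tau_ri.
- exact: (associate_ri_norm measurableT (uniformizes_radial R n0) tau_ri).
- exact: (frac_max_bounded gamma_gt0 gamma_lt rho_ri rhob_ri rhobE).
- move=> zeta; exact: (range_optimal gamma_gt0 gamma_lt rhob_ri rhobE C0 hC).
- move=> rhob' rep; exists 1%R, C; split => // f Mf; rewrite mul1e.
  exact: (tau_equivalent gamma_gt0 gamma_lt rho_ri rhob_ri rhobE C0 hC).
Qed.
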